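(* Let $\mathcal{S}$ be the number of edges in the matching graph $M$, and let $c$ be any constant fixed in advance. There is a Monte Carlo algorithm that solves the reporting variant of Generalised Pattern Matching in $\mathcal{O}(\sqrt{\mathcal{S}}\, n\log m\sqrt{\log n})$ time. The error is one-sided (only false positives are allowed), and the error probability is at most $1/n^c$.
   Context: Generalised Pattern Matching (GPM): the input is a text $T\in\Sigma_T^n$, a pattern $P\in\Sigma_P^m$, and a matching relationship $M\subseteq\Sigma_T\times\Sigma_P$, viewed as a bipartite graph (the matching graph) on vertex set $\Sigma_T\cup\Sigma_P$ whose edges are the matching pairs. Reporting variant: output all $i\in[n-m+1]$ such that $T[i+j-1]$ matches $P[j]$ for all $j\in[m]$. The alphabet sizes are polynomial in $n$, and the matching graph is accessed through oracles answering in $\mathcal{O}(1)$ time: (1) whether $a\in\Sigma_T$ and $b\in\Sigma_P$ match; (2) the degree of a given character in $M$; (3) the $k$-th neighbour of a given $a\in\Sigma_T$ (for an arbitrary fixed order of neighbours). Word RAM model. *)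

(* Defs.v *)
From mathcomp Require Import all_boot all_order all_algebra.
From mathcomp Require Import reals exp.

Set Implicit Arguments.
Unset Strict Implicit.
Unset Printing Implicit Defensive.

Import Order.TTheory GRing.Theory Num.Theory.

(** * Generalised pattern matching *)

(** The characters of an alphabet of size [s] are the integers [0, ..., s - 1].
    [nbrs] is the arbitrary but fixed order in which the neighbours of a text
    character are listed. *)
Record gpm := Gpm {
  text_len : nat;
  pat_len : nat;
  text_alph : nat;
  pat_alph : nat;
  text : text_len.-tuple 'I_text_alph;
  pattern : pat_len.-tuple 'I_pat_alph;
  matching : {set 'I_text_alph * 'I_pat_alph};
  nbrs : 'I_text_alph -> seq 'I_pat_alph;
  nbrsP : forall a,
    perm_eq (nbrs a) (enum [set b | (a, b) \in matching])
}.

(** Positions of the text are reported counting from 1, whereas tuples are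
    indexed from 0: for [j : 'I_m], the character facing [P[j + 1]] at position
    [i] is [T[i + j]], that is, the entry of the tuple with index [i + j - 1]. *)
Definition occurs (G : gpm) (i : nat) : bool :=
  (1 <= i <= text_len G - pat_len G + 1) &&
  [forall j : 'I_(pat_len G), forall k : 'I_(text_len G),
     (k.+1 == i + j) ==>
     ((tnth (text G) k, tnth (pattern G) j) \in matching G)].

(** The three oracles, on arbitrary integers; ill-formed queries are answered
    by 0, and neighbours are counted from 0. *)
Definition match_oracle (G : gpm) (a b : nat) : bool :=
  [exists e in matching G, (e.1 == a :> nat) && (e.2 == b :> nat)].

Definition text_degree_oracle (G : gpm) (a : nat) : nat :=
  #|[set e in matching G | e.1 == a :> nat]|.

Definition pat_degree_oracle (G : gpm) (b : nat) : nat :=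
  #|[set e in matching G | e.2 == b :> nat]|.

Definition nbr_oracle (G : gpm) (a k : nat) : nat :=
  if insub a is Some a' then nth 0 [seq val b | b <- nbrs (g := G) a'] k else 0.

(** * Randomised word RAM with oracle access to the matching graph *)

Inductive binop :=
  BAdd | BSub | BMul | BDiv | BMod | BAnd | BOr | BXor | BShl | BShr.

(** Registers and addresses of instructions are natural numbers; a program
    mentions only finitely many of them. *)
Inductive instr :=
| Const (r k : nat)                (* r := k *)
| Bin (o : binop) (r r1 r2 : nat)  (* r := r1 o r2 *)
| Read (r r1 : nat)                (* r := mem[r1] *)
| Write (r1 r2 : nat)              (* mem[r1] := r2 *)
| Jump (l : nat)
| JumpEq (r1 r2 l : nat)           (* jump to l if r1 = r2 *)
| JumpLt (r1 r2 l : nat)           (* jump to l if r1 < r2 *)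
| Random (r : nat)                 (* r := a fresh uniform random word *)
| Report (r : nat)                 (* append r to the output *)
| MatchQ (r r1 r2 : nat)
| TextDegQ (r r1 : nat)
| PatDegQ (r r1 : nat)
| NbrQ (r r1 r2 : nat).

Definition program := seq instr.

Record state := State {
  pc : nat;
  reg : nat -> nat;
  mem : nat -> nat;
  drawn : nat; (* number of random words consumed so far *)
  out : seq nat
}.

Section Semantics.

Variable w : nat. (* word size *)

Definition word (x : nat) : nat := x %% 2 ^ w.

(** [x] and [y] are words; subtraction wraps around. *)
Definition eval_binop (o : binop) (x y : nat) : nat :=
  match o with
  | BAdd => x + y
  | BSub => x + 2 ^ w - y
  | BMul => x * y
  | BDiv => x %/ y
  | BMod => x %% y
  | BAnd => Nat.land x y
  | BOr  => Nat.lor x y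
  | BXor => Nat.lxor x y
  | BShl => x * 2 ^ y
  | BShr => x %/ 2 ^ y
  end.

Definition set_reg (s : state) (r v : nat) : state :=
  State (pc s).+1 [eta reg s with r |-> word v] (mem s) (drawn s) (out s).

Definition jump (s : state) (b : bool) (l : nat) : state :=
  State (if b then l else (pc s).+1) (reg s) (mem s) (drawn s) (out s).

Definition exec (G : gpm) (tape : seq nat) (i : instr) (s : state) : state :=
  let v := reg s in
  match i with
  | Const r k => set_reg s r k
  | Bin o r r1 r2 => set_reg s r (eval_binop o (v r1) (v r2))
  | Read r r1 => set_reg s r (mem s (v r1))
  | Write r1 r2 =>
      State (pc s).+1 v [eta mem s with v r1 |-> v r2] (drawn s) (out s)
  | Jump l => jump s true l
  | JumpEq r1 r2 l => jump s (v r1 == v r2) l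
  | JumpLt r1 r2 l => jump s (v r1 < v r2) l
  | Random r =>
      State (pc s).+1 [eta v with r |-> word (nth 0 tape (drawn s))] (mem s)
        (drawn s).+1 (out s)
  | Report r => State (pc s).+1 v (mem s) (drawn s) (rcons (out s) (v r))
  | MatchQ r r1 r2 => set_reg s r (match_oracle G (v r1) (v r2))
  | TextDegQ r r1 => set_reg s r (text_degree_oracle G (v r1))
  | PatDegQ r r1 => set_reg s r (pat_degree_oracle G (v r1))
  | NbrQ r r1 r2 => set_reg s r (nbr_oracle G (v r1) (v r2))
  end.

(** A program halts by leaving its code. *)
Definition halted (p : program) (s : state) : bool := size p <= pc s.

(** Every instruction, oracle queries included, takes one unit of time. *)
Definition step (G : gpm) (tape : seq nat) (p : program) (s : state) : state :=
  if onth p (pc s) is Some i then exec G tape i s else s.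

(** Initially, registers 0 to 3 hold the lengths of the text and of the pattern
    and the sizes of their alphabets, and the memory holds the text followed by
    the pattern; everything else is 0. *)
Definition init (G : gpm) : state :=
  let input := [seq val a | a <- text G] ++ [seq val b | b <- pattern G] in
  let sizes := [:: text_len G; pat_len G; text_alph G; pat_alph G] in
  State 0 (fun r => word (nth 0 sizes r)) (fun x => word (nth 0 input x)) 0 [::].

(** The state after [t] steps. At most [t] random words have been drawn by
    then, so that a tape of [t] independent uniform words is long enough. *)
Definition run (G : gpm) (p : program) (t : nat) (tape : t.-tuple 'I_(2 ^ w)) :
    state :=
  iter t (step G [seq val x | x <- tape] p) (init G).

End Semantics.

Local Open Scope ring_scope.

(** Probability of [A] under the uniform distribution. *)
Definition unif_prob (R : realType) (T : finType) (A : {set T}) : R :=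
  #|A|%:R / #|T|%:R.

(** sqrt(S) n log(m) sqrt(log n), where, as usual inside an O, the factors that
    could vanish (S = 0, m = 1 or n = 1) are read as being at least 1. *)
Definition time_bound (R : realType) (n m S : nat) : R :=
  Num.sqrt (maxn 1 S)%:R * n%:R * Num.max 1 (ln m%:R)
  * Num.sqrt (Num.max 1 (ln n%:R)).

(* Main.v *)
Require Import Defs.
From Stdlib Require Import ZArith Reals Lra Lia Psatz.
From mathcomp Require Import all_boot all_order all_algebra.
From mathcomp Require Import Rstruct complex zify.

(** For a text character [x] of degree at most [D], the positions where [x] faces
    a non-neighbour are found by hashing the pattern alphabet into [4 D] buckets:
    a bucket [b] marks the alignments where some text character none of whose
    neighbours hashes to [b] faces a pattern character in [b]. This never marks
    an occurrence, and a given mismatch stays unmarked only if the pattern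
    character collides with one of at most [D] neighbours, which multiply-shift
    hashing makes happen with probability at most 1/2; [O(log n)] independent
    rounds suffice. A text character of degree more than [D] gets a convolution
    of its own, and there are at most [S / D] of them. With [D ^ 2 log n] of the
    order of [S], this is [O(sqrt (S log n))] convolutions, each of which takes
    time [O(n log m)] by fast Fourier transforms of length [O(m)].

    A word RAM of word size [O(log n)] has no complex numbers, so the transforms
    run in fixed point arithmetic with the scale [q = N ^ 32]; the roots of unity
    are obtained by iterated half-angle formulas and integer square roots, and
    the error stays below the gap between 0 and 1. The RAM program is compiled
    from a small structured language over the integers, for which weakest
    preconditions also bound the running time. *)

(* The factor 4 in the number of buckets comes from the collision probability 2 / B of
   multiply-shift hashing: a union bound over [D] neighbours leaves 1/2. The number of edges cannot
   be computed in the time allowed, because the alphabets may be much larger than [n]; the threshold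
   is balanced instead against the sum of the degrees of the distinct letters of the text, which is
   at most the number of edges. When this sum is below [lg], the threshold is 0: every letter with a
   neighbour is heavy, and a single round treats the letters without neighbours free of error.
   Programs compute with unbounded integers of which the machine keeps the residues modulo 2^w, so
   signed values need no encoding, and only divisions, comparisons, addresses and oracle queries
   carry range conditions. The transform is studied over any commutative ring with a suitable
   sequence of roots; rounding is a separate relation between integers and exact complex values.
   Probabilities are handled as cardinals of sets of tapes. *)
Delimit Scope Z_scope with Z.
Delimit Scope R_scope with Re.

(** * A structured language over the integers *)

Module Language.

Set Implicit Arguments.
Unset Strict Implicit.
Unset Printing Implicit Defensive.
Local Open Scope nat_scope.
Inductive arith := OAdd | OSub | OMul | ODiv | OMod.

(** [EWrap] generates no code. Values are integers that the machine holds modulo 2^w, and [EWrap]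
    marks the places where the program relies on that reduction, which happens only for hashing. *)
Inductive expr :=
| EVar (x : nat)
| ECst (k : nat)
| ELenT
| ELenP
| EBin (o : arith) (e1 e2 : expr)
| EWrap (e : expr)
| EGet (a : nat) (e : expr)
| EIn (e : expr)
| EMatch (e1 e2 : expr)
| EDeg (e : expr)
| ENbr (e1 e2 : expr).

Inductive test := TLt (e1 e2 : expr) | TEq (e1 e2 : expr).

Inductive cmd :=
| Skip
| Asg (x : nat) (e : expr)
| Put (a : nat) (e1 e2 : expr)
| Seq (c1 c2 : cmd)
| If (b : test) (c1 c2 : cmd)
| For (x : nat) (b : expr) (c : cmd)
| Rand (x : nat)
| Rep (e : expr).

Record store := Store {
  var : nat -> Z;
  arr : nat -> Z -> Z;
  used : nat;
  reps : seq nat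
}.

Definition setv st x v :=
  Store (fun y => if Nat.eqb y x then v else var st y) (arr st) (used st) (reps st).

Definition seta st a i v :=
  Store (var st)
    (fun b j => if Nat.eqb b a then if Z.eqb j i then v else arr st b j
                else arr st b j)
    (used st) (reps st).

(** Arrays are interleaved: cell [i] of array [a] has address base + 16 i + a. No array needs a
    declared length, and distinct cells never overlap as long as [a] is below 16. *)
Definition num_arrays := 16.

(** Registers 0 to 4 are reserved for the input sizes and for the base address
    of the arrays; the other odd registers hold variables, the even ones
    temporary values. *)
Definition vreg x := (2 * x + 5)%N.
Definition treg d := (2 * d + 6)%N.

Definition binop_of o :=
  match o with
  | OAdd => BAdd | OSub => BSub | OMul => BMul | ODiv => BDiv | OMod => BMod
  end.

Definition addr_code d a :=
  [:: Const (treg d.+1) num_arrays; Bin BMul (treg d) (treg d) (treg d.+1);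
      Const (treg d.+1) a; Bin BAdd (treg d) (treg d) (treg d.+1);
      Bin BAdd (treg d) (treg d) 4].

Definition move r r' := [:: Const r 0; Bin BAdd r r r'].

Fixpoint expr_code d e :=
  match e with
  | EVar x => move (treg d) (vreg x)
  | ECst k => [:: Const (treg d) k]
  | ELenT => move (treg d) 0
  | ELenP => move (treg d) 1
  | EBin o e1 e2 => expr_code d e1 ++ expr_code d.+1 e2 ++
      [:: Bin (binop_of o) (treg d) (treg d) (treg d.+1)]
  | EWrap e => expr_code d e
  | EGet a e => expr_code d e ++ addr_code d a ++ [:: Read (treg d) (treg d)]
  | EIn e => expr_code d e ++ [:: Read (treg d) (treg d)]
  | EMatch e1 e2 => expr_code d e1 ++ expr_code d.+1 e2 ++
      [:: MatchQ (treg d) (treg d) (treg d.+1)]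
  | EDeg e => expr_code d e ++ [:: TextDegQ (treg d) (treg d)]
  | ENbr e1 e2 => expr_code d e1 ++ expr_code d.+1 e2 ++
      [:: NbrQ (treg d) (treg d) (treg d.+1)]
  end.

Definition test_code b l :=
  match b with
  | TLt e1 e2 => expr_code 0 e1 ++ expr_code 1 e2 ++ [:: JumpLt (treg 0) (treg 1) l]
  | TEq e1 e2 => expr_code 0 e1 ++ expr_code 1 e2 ++ [:: JumpEq (treg 0) (treg 1) l]
  end.

Definition test_size b := size (test_code b 0).

Fixpoint code_size c : nat :=
  match c with
  | Skip => 0
  | Asg x e => size (expr_code 0 e) + 2
  | Put a e1 e2 => size (expr_code 0 e1) + 5 + size (expr_code 1 e2) + 1
  | Seq c1 c2 => code_size c1 + code_size c2
  | If b c1 c2 => test_size b + code_size c2 + 1 + code_size c1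
  | For x b c => 1 + test_size (TLt (EVar x) b) + 1 + code_size c + 3
  | Rand x => 1
  | Rep e => size (expr_code 0 e) + 1
  end.

(** [compile l c] is the code of [c] for an insertion at address [l]. *)
Fixpoint compile l c : program :=
  match c with
  | Skip => [::]
  | Asg x e => expr_code 0 e ++ move (vreg x) (treg 0)
  | Put a e1 e2 => expr_code 0 e1 ++ addr_code 0 a ++ expr_code 1 e2 ++
      [:: Write (treg 0) (treg 1)]
  | Seq c1 c2 => compile l c1 ++ compile (l + code_size c1) c2
  | If b c1 c2 =>
      let l1 := l + test_size b in
      let l2 := l1 + code_size c2 + 1 in
      test_code b l2 ++ compile l1 c2 ++ [:: Jump (l2 + code_size c1)] ++
      compile l2 c1
  | For x b c =>
      let l1 := l + 1 + test_size (TLt (EVar x) b) + 1 in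
      [:: Const (vreg x) 0] ++ test_code (TLt (EVar x) b) l1 ++
      [:: Jump (l1 + code_size c + 3)] ++ compile l1 c ++
      [:: Const (treg 0) 1; Bin BAdd (vreg x) (vreg x) (treg 0); Jump (l + 1)]
  | Rand x => [:: Random (vreg x)]
  | Rep e => expr_code 0 e ++ [:: Report (treg 0)]
  end.

Fixpoint writes_var y c : bool :=
  match c with
  | Asg x _ | Rand x => Nat.eqb y x
  | Seq c1 c2 | If _ c1 c2 => writes_var y c1 || writes_var y c2
  | For x _ c => Nat.eqb y x || writes_var y c
  | _ => false
  end.

Fixpoint writes_arr a c : bool :=
  match c with
  | Put b _ _ => Nat.eqb a b
  | Seq c1 c2 | If _ c1 c2 => writes_arr a c1 || writes_arr a c2
  | For _ _ c => writes_arr a c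
  | _ => false
  end.

Fixpoint draws c : bool :=
  match c with
  | Rand _ => true
  | Seq c1 c2 | If _ c1 c2 => draws c1 || draws c2
  | For _ _ c => draws c
  | _ => false
  end.

Fixpoint reports c : bool :=
  match c with
  | Rep _ => true
  | Seq c1 c2 | If _ c1 c2 => reports c1 || reports c2
  | For _ _ c => reports c
  | _ => false
  end.

(** The compiled loop evaluates its bound before each iteration, while [wp] evaluates it once on
    entry; the two agree for a constant, an input length, or a variable that the loop does not
    write. *)
Definition stable_bound x b c :=
  match b with
  | EVar y => ~~ Nat.eqb y x && ~~ writes_var y c
  | ECst _ | ELenT | ELenP => true
  | _ => false
  end.

Fixpoint wf c : bool :=
  match c with
  | Put a _ _ => a < num_arrays
  | Seq c1 c2 | If _ c1 c2 => wf c1 && wf c2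
  | For x b c => [&& stable_bound x b c, ~~ writes_var x c & wf c]
  | _ => true
  end.

Definition frame c st st' :=
  [/\ forall y, writes_var y c = false -> var st' y = var st y,
      forall a, writes_arr a c = false -> forall i, arr st' a i = arr st a i,
      draws c = false -> used st' = used st
    & reports c = false -> reps st' = reps st].

Lemma frame_refl c st : frame c st st.
Proof. by split. Qed.

Lemma frame_trans c st1 st2 st3 :
  frame c st1 st2 -> frame c st2 st3 -> frame c st1 st3.
Proof.
move=> [v1 a1 u1 r1] [v2 a2 u2 r2]; split.
- by move=> y hy; rewrite v2 // v1.
- by move=> y hy i; rewrite a2 // a1.
- by move=> h; rewrite u2 // u1.
- by move=> h; rewrite r2 // r1.
Qed.

Lemma frame_weaken c c' st st' :
  (forall y, writes_var y c' = false -> writes_var y c = false) ->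
  (forall a, writes_arr a c' = false -> writes_arr a c = false) ->
  (draws c' = false -> draws c = false) ->
  (reports c' = false -> reports c = false) ->
  frame c st st' -> frame c' st st'.
Proof.
move=> hv ha hd hr [v a u r]; split.
- by move=> y /hv; apply: v.
- by move=> y /ha; apply: a.
- by move/hd.
- by move/hr.
Qed.

Section Meaning.

Variables (w : nat) (G : gpm) (tape : seq nat) (lim : Z).

Definition W := Z.of_nat (2 ^ w).

Definition input := [seq val a | a <- text G] ++ [seq val b | b <- pattern G].

Definition arith_op o : Z -> Z -> Z :=
  match o with
  | OAdd => Z.add | OSub => Z.sub | OMul => Z.mul | ODiv => Z.div | OMod => Z.modulo
  end.

Fixpoint eval st e : Z :=
  match e with
  | EVar x => var st x
  | ECst k => Z.of_nat k
  | ELenT => Z.of_nat (text_len G)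
  | ELenP => Z.of_nat (pat_len G)
  | EBin o e1 e2 => arith_op o (eval st e1) (eval st e2)
  | EWrap e => Z.modulo (eval st e) W
  | EGet a e => arr st a (eval st e)
  | EIn e => Z.of_nat (nth 0 input (Z.to_nat (eval st e)))
  | EMatch e1 e2 =>
      Z.of_nat (match_oracle G (Z.to_nat (eval st e1)) (Z.to_nat (eval st e2)))
  | EDeg e => Z.of_nat (text_degree_oracle G (Z.to_nat (eval st e)))
  | ENbr e1 e2 =>
      Z.of_nat (nbr_oracle G (Z.to_nat (eval st e1)) (Z.to_nat (eval st e2)))
  end.

Definition is_word (z : Z) : Prop := (0 <= z < W)%Z.

(** The word operations other than additions, subtractions and products are
    correct on canonical representatives only. *)
Fixpoint safe st e : Prop :=
  match e with
  | EBin o e1 e2 => safe st e1 /\ safe st e2 /\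
      match o with
      | ODiv | OMod => is_word (eval st e1) /\ is_word (eval st e2) /\
                       (0 < eval st e2)%Z
      | _ => True
      end
  | EWrap e => safe st e
  | EGet a e => safe st e /\ (0 <= eval st e < lim)%Z /\ a < num_arrays
  | EIn e => safe st e /\ (0 <= eval st e < Z.of_nat (size input))%Z
  | EMatch e1 e2 | ENbr e1 e2 =>
      safe st e1 /\ safe st e2 /\ is_word (eval st e1) /\ is_word (eval st e2)
  | EDeg e => safe st e /\ is_word (eval st e)
  | _ => True
  end.

Definition test_val st b : bool :=
  match b with
  | TLt e1 e2 => Z.ltb (eval st e1) (eval st e2)
  | TEq e1 e2 => Z.eqb (eval st e1) (eval st e2)
  end.

Definition test_safe st b : Prop :=
  match b with
  | TLt e1 e2 | TEq e1 e2 => safe st e1 /\ safe st e2 /\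
                             is_word (eval st e1) /\ is_word (eval st e2)
  end.

Definition loop_size x b := 1 + test_size (TLt (EVar x) b).

(** [k] is the time spent so far. *)
Fixpoint wp c (Q : store -> nat -> Prop) st (k : nat) : Prop :=
  match c with
  | Skip => Q st k
  | Asg x e => safe st e /\ Q (setv st x (eval st e)) (k + code_size c)
  | Put a e1 e2 => safe st e1 /\ safe st e2 /\ (0 <= eval st e1 < lim)%Z /\
      Q (seta st a (eval st e1) (eval st e2)) (k + code_size c)
  | Seq c1 c2 => wp c1 (wp c2 Q) st k
  | If b c1 c2 => test_safe st b /\
      if test_val st b then wp c1 Q st (k + test_size b)
      else wp c2 (fun st' k' => Q st' (k' + 1)) st (k + test_size b)
  | For x b c => safe st b /\ is_word (eval st b) /\
      (fix loop (j i : nat) st k : Prop :=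
         match j with
         | 0 => Q (setv st x (Z.of_nat i)) (k + loop_size x b)
         | j'.+1 => wp c (fun st' k' => loop j' i.+1 st' (k' + 3))
                      (setv st x (Z.of_nat i)) (k + test_size (TLt (EVar x) b))
         end) (Z.to_nat (eval st b)) 0 st (k + 1)
  | Rand x => Q (setv (Store (var st) (arr st) (used st).+1 (reps st)) x
                  (Z.of_nat (word w (nth 0 tape (used st))))) (k + 1)
  | Rep e => safe st e /\ is_word (eval st e) /\
      Q (Store (var st) (arr st) (used st) (rcons (reps st) (Z.to_nat (eval st e))))
        (k + code_size c)
  end.

(** A named copy of the anonymous fixpoint inside [wp], convertible to it, over which inductions can
    be stated. *)
Definition wp_loop x b c (Q : store -> nat -> Prop) :=
  fix loop (j i : nat) st k : Prop :=
  match j with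
  | 0 => Q (setv st x (Z.of_nat i)) (k + loop_size x b)
  | j'.+1 => wp c (fun st' k' => loop j' i.+1 st' (k' + 3))
               (setv st x (Z.of_nat i)) (k + test_size (TLt (EVar x) b))
  end.

Lemma wp_mono c (Q Q' : store -> nat -> Prop) st k :
  (forall st' k', Q st' k' -> Q' st' k') -> wp c Q st k -> wp c Q' st k.
Proof.
elim: c Q Q' st k => /=.
- by move=> Q Q' st k h; apply: h.
- by move=> x e Q Q' st k h [h1 h2]; split => //; apply: h.
- by move=> a e1 e2 Q Q' st k h [h1 [h2 [h3 h4]]]; refine (conj h1 (conj h2 (conj h3 _))); apply: h.
- move=> c1 IH1 c2 IH2 Q Q' st k h; apply: IH1 => st' k'; exact: IH2.
- move=> b c1 IH1 c2 IH2 Q Q' st k h [h1 h2]; split => //.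
  case: ifP h2 => _; first exact: IH1.
  by apply: IH2 => st' k'; apply: h.
- move=> x b c IH Q Q' st k h [h1 [h2 h3]]; refine (conj h1 (conj h2 _)).
  have mono j i s k' : wp_loop x b c Q j i s k' -> wp_loop x b c Q' j i s k'.
    elim: j i s k' => [|j IHj] i s k' /=; first exact: h.
    by apply: IH => st' k''; apply: IHj.
  exact: mono.
- by move=> x Q Q' st k h; apply: h.
- by move=> e Q Q' st k h [h1 [h2 h3]]; refine (conj h1 (conj h2 _)); apply: h.
Qed.

(** What a command cannot write is read off its syntax, so later specifications mention only what
    changes and recover the rest from [frame]. *)
Lemma wp_frame c Q st k :
  wp c Q st k -> wp c (fun st' k' => Q st' k' /\ frame c st st') st k.
Proof.
elim: c Q st k => /=.
- by move=> Q st k h; split.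
- move=> x e Q st k [h1 h2]; split=> //; split=> //; split=> //=.
  by move=> y /= ->.
- move=> a e1 e2 Q st k [h1 [h2 [h3 h4]]].
  refine (conj h1 (conj h2 (conj h3 (conj h4 _)))); split=> //=.
  by move=> b /= ->.
- move=> c1 IH1 c2 IH2 Q st k /IH1; apply: wp_mono => s1 k1 [/IH2 h f1].
  apply: wp_mono h => s2 k2 [h f2]; split => //.
  apply: (@frame_trans _ _ s1).
  + by apply: frame_weaken f1 => /= [y|y||]; case/Bool.orb_false_elim.
  + by apply: frame_weaken f2 => /= [y|y||]; case/Bool.orb_false_elim.
- move=> b c1 IH1 c2 IH2 Q st k [h1 h2]; split => //.
  case: ifP h2 => _ h2.
  + apply: wp_mono (IH1 _ _ _ h2) => s2 k2 [h f2]; split => //.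
    by apply: frame_weaken f2 => /= [y|y||]; case/Bool.orb_false_elim.
  + apply: wp_mono (IH2 _ _ _ h2) => s2 k2 [h f2]; split => //.
    by apply: frame_weaken f2 => /= [y|y||]; case/Bool.orb_false_elim.
- move=> x b c IH Q st k [h1 [h2 h3]]; refine (conj h1 (conj h2 _)).
  have setf s i : frame (For x b c) st s -> frame (For x b c) st (setv s x i).
    case=> [v a u r]; split=> // y /=.
    by case: (boolP (Nat.eqb y x)) => //= e hy; apply: v; rewrite /= (negbTE e).
  have loop_frame j i s k' : wp_loop x b c Q j i s k' -> frame (For x b c) st s ->
      wp_loop x b c (fun st' k' => Q st' k' /\ frame (For x b c) st st') j i s k'.
    elim: j i s k' => [|j IHj] i s k' /=; first by move=> h f; split=> //; apply: setf.
    move=> /IH h f; apply: wp_mono h => s1 k1 [h f1]; apply: IHj => //.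
    apply: (frame_trans (setf _ (Z.of_nat i) f)).
    by apply: frame_weaken f1 => //= y; case/Bool.orb_false_elim.
  exact: loop_frame h3 (frame_refl _ _).
- by move=> x Q st k h; split=> //; split=> //= y ->.
- by move=> e Q st k [h1 [h2 h3]]; refine (conj h1 (conj h2 (conj h3 _))); split.
Qed.

Lemma wp_forE x b c Q st k :
  wp (For x b c) Q st k =
  (safe st b /\ is_word (eval st b) /\
   wp_loop x b c Q (Z.to_nat (eval st b)) 0 st (k + 1)).
Proof. by []. Qed.

(** An iteration pays for the test, at most [T] for the body, and 3 for incrementing the counter and
    jumping back; the additive terms are the initialisation and the last, failing test. *)
Lemma wp_for (I : nat -> store -> Prop) (n T : nat) x b c Q st k :
  safe st b -> eval st b = Z.of_nat n -> n < 2 ^ w -> I 0 st ->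
  (forall i st' k', i < n -> I i st' -> frame (For x b c) st st' ->
     wp c (fun st2 k2 => I i.+1 st2 /\ k2 <= k' + T) (setv st' x (Z.of_nat i)) k') ->
  (forall st' k', I n st' -> frame (For x b c) st st' ->
     k' <= k + n * (T + loop_size x b + 3) + 1 + loop_size x b ->
     Q (setv st' x (Z.of_nat n)) k') ->
  wp (For x b c) Q st k.
Proof.
move=> hs hb hn I0 Istep post; rewrite wp_forE; split=> //; split.
  by rewrite hb /is_word /W; lia.
rewrite hb Nat2Z.id.
have hall: forall j i s k', i + j = n -> I i s -> frame (For x b c) st s ->
    k' <= k + i * (T + loop_size x b + 3) + 1 ->
    wp_loop x b c Q j i s k'; last first.
  by apply: (hall n 0); [lia | | exact: frame_refl | lia].
elim=> [|j IHj] i s k' hij hI hf hk /=.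
  have e: i = n by lia.
  rewrite e in hI hk *; apply: post => //; lia.
have hi: i < n by lia.
have /wp_frame := Istep i s (k' + test_size (TLt (EVar x) b)) hi hI hf.
apply: wp_mono => s1 k1 [[h hk1] f1]; apply: IHj => //; first by lia.
  apply: (@frame_trans _ _ (setv s x (Z.of_nat i))); last first.
    by apply: frame_weaken f1 => //= y; case/Bool.orb_false_elim.
  case: hf => [v a u r]; split=> // y /=.
  by case: (boolP (Nat.eqb y x)) => //= e hy; apply: v; rewrite /= (negbTE e).
rewrite /loop_size in hk *; rewrite mulSn; lia.
Qed.

End Meaning.

End Language.
Import Language.

(** * Soundness of the compiler *)

Module Compiler.

Set Implicit Arguments.
Unset Strict Implicit.
Unset Printing Implicit Defensive.
Local Open Scope nat_scope.
Ltac ilia := intros; lia.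

Lemma of_nat_divn x y : 0 < y -> Z.of_nat (x %/ y) = (Z.of_nat x / Z.of_nat y)%Z.
Proof.
move=> y0; have := divn_eq x y; have := ltn_pmod x y0; move: (x %/ y) (x %% y) => s r h e.
by apply: (Z.div_unique _ _ _ (Z.of_nat r)); lia.
Qed.

Lemma of_nat_modn x y : 0 < y -> Z.of_nat (x %% y) = (Z.of_nat x mod Z.of_nat y)%Z.
Proof.
move=> y0; have := divn_eq x y; have := ltn_pmod x y0; move: (x %/ y) (x %% y) => s r h e.
by apply: (Z.mod_unique _ _ (Z.of_nat s)); lia.
Qed.

Lemma size_test_code b l : size (test_code b l) = test_size b.
Proof. by case: b => e1 e2; rewrite /test_size /test_code !size_cat. Qed.

Lemma test_size_lt x b : test_size (TLt (EVar x) b) = 2 + (size (expr_code 1 b) + 1).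
Proof. by rewrite /test_size /test_code !size_cat. Qed.

Lemma size_compile l c : size (compile l c) = code_size c.
Proof.
elim: c l => [|x e|a e1 e2|c1 IH1 c2 IH2|b c1 IH1 c2 IH2|x b c IH|x|e] l //;
  rewrite /compile -/compile !size_cat ?size_test_code ?IH1 ?IH2 ?IH //;
  rewrite /code_size -/code_size /= ?test_size_lt; lia.
Qed.

Section Soundness.

Variables (w : nat) (G : gpm) (tape : seq nat) (lim : Z) (p : program).

Local Notation W := (Language.W w).
Local Notation base := (size (input G)).
Hypothesis lim_fits : (Z.of_nat base + Z.of_nat num_arrays * lim <= W)%Z.
Hypothesis lim_ge0 : (0 <= lim)%Z.

Definition wz (z : Z) : nat := Z.to_nat (z mod W).

Lemma W_gt0 : (0 < W)%Z.
Proof.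
have h : 0 < 2 ^ w by rewrite expn_gt0.
by rewrite /Language.W; ilia.
Qed.

Lemma wzE z : Z.of_nat (wz z) = (z mod W)%Z.
Proof. by rewrite /wz Z2Nat.id //; have := Z.mod_pos_bound z W W_gt0; ilia. Qed.

Lemma wordE x : Z.of_nat (word w x) = (Z.of_nat x mod W)%Z.
Proof. by rewrite /word of_nat_modn // expn_gt0. Qed.

Lemma wz_nat x : wz (Z.of_nat x) = word w x.
Proof. by apply: Nat2Z.inj; rewrite wzE wordE. Qed.

Lemma wz_lt z : wz z < 2 ^ w.
Proof.
have := Z.mod_pos_bound z W W_gt0; have := wzE z; rewrite /Language.W; ilia.
Qed.

Lemma word_wz z : word w (wz z) = wz z.
Proof. by rewrite /word modn_small // wz_lt. Qed.

Lemma word_word x : word w (word w x) = word w x.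
Proof. by rewrite /word modn_mod. Qed.

Lemma wz_word z : is_word w z -> wz z = Z.to_nat z.
Proof. by move=> h; rewrite /wz Z.mod_small. Qed.

Lemma wz_wrap z : wz (z mod W) = wz z.
Proof. by rewrite /wz Z.mod_mod //; have := W_gt0; ilia. Qed.

Lemma word_arith o z1 z2 :
  match o with
  | ODiv | OMod => is_word w z1 /\ is_word w z2 /\ (0 < z2)%Z
  | _ => True
  end ->
  word w (eval_binop w (binop_of o) (wz z1) (wz z2)) = wz (arith_op o z1 z2).
Proof.
have W0 := W_gt0; have Wn : Z.of_nat (2 ^ w) = W by [].
case: o => /= h; apply: Nat2Z.inj; rewrite wzE wordE.
- have -> : Z.of_nat (wz z1 + wz z2) = (Z.of_nat (wz z1) + Z.of_nat (wz z2))%Z by ilia.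
  by rewrite !wzE -Zplus_mod.
- have h2 := wz_lt z2.
  have -> : Z.of_nat (wz z1 + 2 ^ w - wz z2) =
    (Z.of_nat (wz z1) - Z.of_nat (wz z2) + 1 * W)%Z by ilia.
  by rewrite Z_mod_plus_full !wzE -Zminus_mod.
- have -> : Z.of_nat (wz z1 * wz z2) = (Z.of_nat (wz z1) * Z.of_nat (wz z2))%Z by ilia.
  by rewrite !wzE -Zmult_mod.
- case: h => h1 [h2 h3]; rewrite !wz_word //.
  congr Z.modulo; rewrite /is_word in h1 h2.
  by rewrite of_nat_divn; [rewrite !Z2Nat.id | ]; ilia.
- case: h => h1 [h2 h3]; rewrite !wz_word //.
  congr Z.modulo; rewrite /is_word in h1 h2.
  by rewrite of_nat_modn; [rewrite !Z2Nat.id | ]; ilia.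
Qed.

Definition at_ l (c : program) := forall i, i < size c -> onth p (l + i) = onth c i.

Lemma at_cat l c1 c2 : at_ l (c1 ++ c2) -> at_ l c1 /\ at_ (l + size c1) c2.
Proof.
move=> h; split=> i hi.
  rewrite h ?size_cat; last by ilia.
  by rewrite onth_cat hi.
rewrite -addnA h ?size_cat ?ltn_add2l //.
by rewrite onth_cat ltnNge leq_addr /= addKn.
Qed.

Lemma at_cons l i c : at_ l (i :: c) -> onth p l = Some i /\ at_ l.+1 c.
Proof.
move=> h; split; first by have := h 0 isT; rewrite addn0.
by move=> j hj; rewrite addSnnS h.
Qed.

Definition steps k s := iter k (step w G tape p) s.

Arguments steps : simpl never.

Lemma stepsD k1 k2 s : steps (k1 + k2) s = steps k2 (steps k1 s).
Proof. by rewrite /steps addnC iterD. Qed.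

Lemma step_exec s i : onth p (pc s) = Some i -> step w G tape p s = exec w G tape i s.
Proof. by rewrite /step => ->. Qed.

Lemma steps_cons k s l i : onth p l = Some i -> pc s = l ->
  steps k.+1 s = steps k (exec w G tape i s).
Proof. by move=> h e; rewrite /steps iterSr (step_exec (i := i)) // e. Qed.

Record rel st s : Prop := Rel {
  rel_n : reg s 0 = word w (text_len G);
  rel_m : reg s 1 = word w (pat_len G);
  rel_base : reg s 4 = word w base;
  rel_var : forall x, reg s (vreg x) = wz (var st x);
  rel_in : forall x, x < base -> Defs.mem s x = word w (nth 0 (input G) x);
  rel_arr : forall a i, a < num_arrays -> (Z.of_nat i < lim)%Z ->
    Defs.mem s (base + num_arrays * i + a) = wz (arr st a (Z.of_nat i));
  rel_drawn : drawn s = used st;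
  rel_out : out s = reps st
}.

(** [treg d] holds [v], and nothing relevant has changed except registers
    [treg d'] with [d <= d']. *)
Record result st s d (v : nat) s' : Prop := Result {
  res_rel : rel st s';
  res_val : reg s' (treg d) = v;
  res_low : forall d', d' < d -> reg s' (treg d') = reg s (treg d')
}.

Lemma treg_high k d : k < 6 -> (k == treg d) = false.
Proof. by move=> h; apply/eqP; rewrite /treg; lia. Qed.

Lemma rel_set_treg st s d v : rel st s -> rel st (set_reg w s (treg d) v).
Proof.
move=> [h0 h1 h4 hv hi ha hd ho]; split; rewrite /= ?treg_high //.
by move=> x; case: eqP => //; rewrite /vreg /treg; ilia.
Qed.

Lemma result_set st s d v : rel st s ->
  result st s d (word w v) (set_reg w s (treg d) v).
Proof.
move=> h; split; first exact: rel_set_treg.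
  by rewrite /= eqxx.
by move=> d' hd; rewrite /=; case: eqP => //; rewrite /treg; ilia.
Qed.

Lemma move_correct d r st s :
  rel st s -> r != treg d -> at_ (pc s) (move (treg d) r) ->
  exists2 s', steps 2 s = s' & pc s' = pc s + 2 /\ result st s d (word w (reg s r)) s'.
Proof.
move=> hr hne /at_cons[h1 /at_cons[h2 _]].
rewrite (steps_cons _ h1) // (steps_cons _ h2) //.
eexists; first by [].
rewrite /= eqxx (negbTE hne) addn2; split=> //; split.
- by do 2!apply: rel_set_treg.
- by rewrite /= eqxx /= /word mod0n add0n.
- by move=> d' hd; rewrite /=; case: eqP => //; rewrite /treg; ilia.
Qed.

Lemma vreg_treg x d : vreg x != treg d.
Proof. by apply/eqP; rewrite /vreg /treg; ilia. Qed.

Lemma treg_vreg d x : (treg d == vreg x) = false.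
Proof. by apply/eqP; rewrite /vreg /treg; lia. Qed.

Lemma addr_correct d a z st s :
  rel st s -> at_ (pc s) (addr_code d a) -> reg s (treg d) = wz z ->
  (0 <= z < lim)%Z -> a < num_arrays ->
  exists2 s', steps 5 s = s' & pc s' = pc s + 5 /\
    result st s d (base + num_arrays * Z.to_nat z + a) s'.
Proof.
move=> hr /at_cons[h1 /at_cons[h2 /at_cons[h3 /at_cons[h4 /at_cons[h5 _]]]]] hz hlim ha.
have ne : (treg d == treg d.+1) = false by apply/eqP; rewrite /treg; ilia.
have ne' : (treg d.+1 == treg d) = false by rewrite eq_sym.
rewrite (steps_cons _ h1) // (steps_cons _ h2) // (steps_cons _ h3) //.
rewrite (steps_cons _ h4) // (steps_cons _ h5) //.
eexists; first by [].
split; first by rewrite /=; ilia.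
have hlt : base + num_arrays * Z.to_nat z + a < 2 ^ w.
  by move: lim_fits ha; rewrite /Language.W /num_arrays; ilia.
split.
- by do 5!apply: rel_set_treg.
- rewrite /= !eqxx ne hz !treg_high //.
  rewrite (rel_base hr) wz_word; last first.
    by move: lim_fits; rewrite /is_word /num_arrays; ilia.
  rewrite /word !(modnMmr, modnDmr, modnDml) (@modn_small (_ * _)); last by ilia.
  by rewrite (@modn_small a) ?modn_small; ilia.
- move=> d' hd; rewrite /=.
  have -> : (treg d' == treg d) = false by apply/eqP; rewrite /treg; ilia.
  by have -> : (treg d' == treg d.+1) = false by apply/eqP; rewrite /treg; ilia.
Qed.

Lemma step_treg st s d i v : rel st s -> onth p (pc s) = Some i ->
  exec w G tape i s = set_reg w s (treg d) v ->
  exists2 s', steps 1 s = s' & pc s' = pc s + 1 /\ result st s d (word w v) s'.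
Proof.
move=> hr h e; rewrite (steps_cons _ h) // e; eexists; first by [].
by rewrite addn1; split; last exact: result_set.
Qed.

Lemma expr_correct e d st s : rel st s -> at_ (pc s) (expr_code d e) -> safe w G lim st e ->
  exists2 s', steps (size (expr_code d e)) s = s' &
    pc s' = pc s + size (expr_code d e) /\ result st s d (wz (eval w G st e)) s'.
Proof.
elim: e d st s => [x|k|||o e1 IH1 e2 IH2|e IH|a e IH|e IH|e1 IH1 e2 IH2|e IH|e1 IH1 e2 IH2] d st s hr.
- move=> /(move_correct hr (vreg_treg x d))[s' h1 [h2 h3]] _; exists s' => //.
  by split=> //; rewrite (rel_var hr) word_wz in h3.
- move=> /at_cons[h _] _ /=; rewrite wz_nat; exact: (step_treg hr h).
- have hne : 0 != treg d by rewrite treg_high.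
  move=> /(move_correct hr hne)[s' h1 [h2 h3]] _; exists s' => //.
  by split=> //; rewrite (rel_n hr) -(wz_nat (text_len G)) word_wz in h3.
- have hne : 1 != treg d by rewrite treg_high.
  move=> /(move_correct hr hne)[s' h1 [h2 h3]] _; exists s' => //.
  by split=> //; rewrite (rel_m hr) -(wz_nat (pat_len G)) word_wz in h3.
- move=> /= /at_cat[h1 /at_cat[h2 h3]] [s1 [s2 so]].
  have [t1 e1' [p1 r1]] := IH1 d st s hr h1 s1.
  rewrite -p1 in h2 h3.
  have [t2 e2' [p2 r2]] := IH2 d.+1 st t1 (res_rel r1) h2 s2.
  rewrite -p2 in h3; case/at_cons: h3 => h3 _.
  have eqv : exec w G tape (Bin (binop_of o) (treg d) (treg d) (treg d.+1)) t2 =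
      set_reg w t2 (treg d) (eval_binop w (binop_of o) (wz (eval w G st e1)) (wz (eval w G st e2))).
    by rewrite /= (res_val r2) (res_low r2) // (res_val r1).
  have [t3 e3' [p3 r3]] := step_treg (res_rel r2) h3 eqv.
  exists t3; first by rewrite !size_cat /= !stepsD e1' e2'.
  split; first by rewrite p3 p2 p1 !size_cat -!addnA.
  split; first exact: res_rel r3.
    by rewrite (res_val r3) word_arith.
  by move=> d' hd; rewrite (res_low r3) // (res_low r2) ?(res_low r1) //; ilia.
- move=> h s1; have [t1 e1' [p1 r1]] := IH d st s hr h s1.
  by exists t1 => //; split=> //=; rewrite wz_wrap.
- move=> /at_cat[h1 /at_cat[h2 h3]] [s1 [hlim ha]].
  have [t1 e1' [p1 r1]] := IH d st s hr h1 s1.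
  rewrite -p1 in h2 h3.
  have [t2 e2' [p2 r2]] := addr_correct (res_rel r1) h2 (res_val r1) hlim ha.
  rewrite -p2 in h3; case/at_cons: h3 => h3 _.
  have eqv : exec w G tape (Read (treg d) (treg d)) t2 =
      set_reg w t2 (treg d) (wz (arr st a (eval w G st e))).
    rewrite /= (res_val r2) (rel_arr (res_rel r2)) //; last by ilia.
    by rewrite Z2Nat.id //; ilia.
  have [t3 e3' [p3 r3]] := step_treg (res_rel r2) h3 eqv.
  exists t3; first by rewrite !size_cat /= !stepsD e1' e2'.
  split; first by rewrite p3 p2 p1 !size_cat -!addnA.
  split; first exact: res_rel r3.
    by rewrite (res_val r3) word_wz.
  by move=> d' hd; rewrite (res_low r3) // (res_low r2) ?(res_low r1) //; ilia.
- move=> /= /at_cat[h1 h3] [s1 hlim].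
  have [t1 e1' [p1 r1]] := IH d st s hr h1 s1.
  rewrite -p1 in h3; case/at_cons: h3 => h3 _.
  have eqv : exec w G tape (Read (treg d) (treg d)) t1 =
      set_reg w t1 (treg d) (word w (nth 0 (input G) (Z.to_nat (eval w G st e)))).
    rewrite /= (res_val r1) wz_word; last first.
      by move: lim_fits lim_ge0; rewrite /is_word /num_arrays; ilia.
    by rewrite (rel_in (res_rel r1)) //; ilia.
  have [t3 e3' [p3 r3]] := step_treg (res_rel r1) h3 eqv.
  exists t3; first by rewrite !size_cat /= !stepsD e1'.
  split; first by rewrite p3 p1 !size_cat -!addnA.
  split; first exact: res_rel r3.
    by rewrite (res_val r3) word_word wz_nat.
  by move=> d' hd; rewrite (res_low r3) // ?(res_low r1) //; ilia.
- move=> /= /at_cat[h1 /at_cat[h2 h3]] [s1 [s2 [w1 w2]]].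
  have [t1 e1' [p1 r1]] := IH1 d st s hr h1 s1.
  rewrite -p1 in h2 h3.
  have [t2 e2' [p2 r2]] := IH2 d.+1 st t1 (res_rel r1) h2 s2.
  rewrite -p2 in h3; case/at_cons: h3 => h3 _.
  have [t3 e3' [p3 r3]] := step_treg (res_rel r2) h3 erefl.
  exists t3; first by rewrite !size_cat /= !stepsD e1' e2'.
  split; first by rewrite p3 p2 p1 !size_cat -!addnA.
  split; first exact: res_rel r3.
    by rewrite (res_val r3) (res_val r2) (res_low r2) // (res_val r1) wz_nat !wz_word.
  by move=> d' hd; rewrite (res_low r3) // (res_low r2) ?(res_low r1) //; ilia.
- move=> /= /at_cat[h1 h3] [s1 w1].
  have [t1 e1' [p1 r1]] := IH d st s hr h1 s1.
  rewrite -p1 in h3; case/at_cons: h3 => h3 _.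
  have [t3 e3' [p3 r3]] := step_treg (res_rel r1) h3 erefl.
  exists t3; first by rewrite !size_cat /= !stepsD e1'.
  split; first by rewrite p3 p1 !size_cat -!addnA.
  split; first exact: res_rel r3.
    by rewrite (res_val r3) (res_val r1) wz_nat wz_word.
  by move=> d' hd; rewrite (res_low r3) // (res_low r1).
- move=> /= /at_cat[h1 /at_cat[h2 h3]] [s1 [s2 [w1 w2]]].
  have [t1 e1' [p1 r1]] := IH1 d st s hr h1 s1.
  rewrite -p1 in h2 h3.
  have [t2 e2' [p2 r2]] := IH2 d.+1 st t1 (res_rel r1) h2 s2.
  rewrite -p2 in h3; case/at_cons: h3 => h3 _.
  have [t3 e3' [p3 r3]] := step_treg (res_rel r2) h3 erefl.
  exists t3; first by rewrite !size_cat /= !stepsD e1' e2'.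
  split; first by rewrite p3 p2 p1 !size_cat -!addnA.
  split; first exact: res_rel r3.
    by rewrite (res_val r3) (res_val r2) (res_low r2) // (res_val r1) wz_nat !wz_word.
  by move=> d' hd; rewrite (res_low r3) // (res_low r2) ?(res_low r1) //; ilia.
Qed.


Lemma rel_jump st s b l : rel st s -> rel st (jump s b l).
Proof. by case. Qed.

Lemma is_word_eq z1 z2 : is_word w z1 -> is_word w z2 -> (wz z1 == wz z2) = Z.eqb z1 z2.
Proof. by move=> h1 h2; rewrite !wz_word //; rewrite /is_word in h1 h2; lia. Qed.

Lemma is_word_lt z1 z2 : is_word w z1 -> is_word w z2 -> (wz z1 < wz z2) = Z.ltb z1 z2.
Proof. by move=> h1 h2; rewrite !wz_word //; rewrite /is_word in h1 h2; lia. Qed.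

Lemma test_correct b l st s :
  rel st s -> at_ (pc s) (test_code b l) -> test_safe w G lim st b ->
  exists2 s', steps (test_size b) s = s' &
    rel st s' /\ pc s' = if test_val w G st b then l else pc s + test_size b.
Proof.
case: b => e1 e2 hr /at_cat[h1 /at_cat[h2 h3]] [s1 [s2 [w1 w2]]];
  have [t1 e1' [p1 r1]] := expr_correct hr h1 s1;
  rewrite -p1 in h2 h3;
  have [t2 e2' [p2 r2]] := expr_correct (res_rel r1) h2 s2;
  rewrite -p2 in h3; case/at_cons: h3 => h3 _;
  rewrite /test_size /test_code !size_cat !stepsD e1' e2' /= (steps_cons _ h3) //;
  (eexists; first by []); split; try (by apply: rel_jump (res_rel r2));
  rewrite /= (res_val r2) (res_low r2) // (res_val r1).
- by rewrite is_word_lt // p2 p1; case: ifP => // _; rewrite !addnA addn1.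
- by rewrite is_word_eq // p2 p1; case: ifP => // _; rewrite !addnA addn1.
Qed.

Lemma rel_pc st s l : rel st s ->
  rel st (State l (reg s) (Defs.mem s) (drawn s) (out s)).
Proof. by case. Qed.

Lemma rel_setv st s x v l r :
  rel st s -> (forall k, k < 5 -> r k = reg s k) ->
  (forall y, r (vreg y) = if y == x then wz v else reg s (vreg y)) ->
  rel (setv st x v) (State l r (Defs.mem s) (drawn s) (out s)).
Proof.
move=> [h0 h1 h4 hv hi ha hd ho] lo hi'; split; rewrite /= ?lo //.
move=> y; rewrite hi' hv; have -> : Nat.eqb y x = (y == x) by lia.
by case: ifP.
Qed.

Lemma vreg_inj x y : (vreg x == vreg y) = (x == y).
Proof. by rewrite /vreg; lia. Qed.

Lemma vreg_low k x : k < 5 -> (k == vreg x) = false.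
Proof. by move=> h; apply/eqP; rewrite /vreg; lia. Qed.

Lemma rel_set_vreg st s x v l : rel st s -> v = wz l ->
  rel (setv st x l) (set_reg w s (vreg x) v).
Proof.
move=> hr ->; apply: rel_setv => // [k hk|y] /=; first by rewrite vreg_low.
by rewrite vreg_inj word_wz.
Qed.

Lemma stable_set x b c st v :
  stable_bound x b c -> eval w G (setv st x v) b = eval w G st b.
Proof. by case: b => //= y /andP[/negbTE-> _]. Qed.

Lemma stable_safe x b c st z : stable_bound x b c ->
  is_word w z -> is_word w (eval w G st b) ->
  test_safe w G lim (setv st x z) (TLt (EVar x) b).
Proof.
move=> h hz hb; rewrite /= (stable_set _ _ h) Nat.eqb_refl; do !split=> //; last first.
all: try (by case: hz); try (by case: hb).
by case: b h {hb}.
Qed.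

Lemma stable_eval x b c st st' v :
  stable_bound x b c -> frame c (setv st x v) st' -> eval w G st' b = eval w G st b.
Proof.
case: b => //= y /andP[/negbTE h1 /negbTE h2] [hv _ _ _].
by rewrite hv // /= h1.
Qed.

(** The number of steps depends on the run and is therefore existential; the postcondition, applied
    to [k + j], is what bounds it. *)
Lemma cmd_correct c (Q : store -> nat -> Prop) st k s :
  wf c -> wp w G tape lim c Q st k -> rel st s -> at_ (pc s) (compile (pc s) c) ->
  exists j st', [/\ rel st' (steps j s), pc (steps j s) = pc s + code_size c
                  & Q st' (k + j)].
Proof.
elim: c Q st k s => [|x e|a e1 e2|c1 IH1 c2 IH2|b c1 IH1 c2 IH2|x b c IH|x|e] Q st k s.
- by move=> _ h hr _; exists 0, st; rewrite !addn0.
- move=> _ [sf h] hr /at_cat[h1 h2].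
  have [t1 e1' [p1 r1]] := expr_correct hr h1 sf.
  rewrite -p1 in h2; case/at_cons: h2 => h2 /at_cons[h3 _].
  exists (code_size (Asg x e)), (setv st x (eval w G st e)); rewrite /= stepsD e1'.
  rewrite (steps_cons _ h2) // (steps_cons _ h3) //; split=> //; last first.
    by rewrite /= p1; lia.
  apply: rel_setv (res_rel r1) _ _ => /= [i hi|y].
    by rewrite vreg_low.
  rewrite !vreg_inj eqxx treg_vreg (res_val r1).
  by case: (y == x); rewrite // /word mod0n add0n -/(word w _) word_wz.
- move=> ha [s1 [s2 [hlim h]]] hr /at_cat[h1 /at_cat[h2 /at_cat[h3 h4]]].
  have [t1 e1' [p1 r1]] := expr_correct hr h1 s1.
  rewrite -p1 in h2 h3 h4.
  have [t2 e2' [p2 r2]] := addr_correct (res_rel r1) h2 (res_val r1) hlim ha.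
  rewrite -p2 in h3 h4.
  have [t3 e3' [p3 r3]] := expr_correct (res_rel r2) h3 s2.
  rewrite -p3 in h4; case/at_cons: h4 => h4 _.
  exists (code_size (Put a e1 e2)), (seta st a (eval w G st e1) (eval w G st e2)).
  rewrite /= !stepsD e1' e2' e3' (steps_cons _ h4) //; split=> //; last first.
    by rewrite /= p3 p2 p1; lia.
  move: (res_rel r3) => [q0 q1 q4 qv qi qa qd qo]; split=> //=.
    move=> i hi; rewrite (res_low r3) // (res_val r2).
    by have -> : (i == base + num_arrays * Z.to_nat (eval w G st e1) + a) = false; [lia|exact: qi].
  move=> b i hb hi; rewrite (res_low r3) // (res_val r2) (res_val r3).
  have -> : (base + num_arrays * i + b == base + num_arrays * Z.to_nat (eval w G st e1) + a) =
    Nat.eqb b a && Z.eqb (Z.of_nat i) (eval w G st e1).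
    by move: ha hb; rewrite /wf /num_arrays; lia.
  by case: (Nat.eqb b a) => /=; last exact: qa; case: ifP => // _; exact: qa.
- move=> /= /andP[w1 w2] h hr /at_cat[h1 h2].
  have [j1 [st1 [r1 p1 q1]]] := IH1 _ _ _ _ w1 h hr h1.
  rewrite size_compile -p1 in h2.
  have [j2 [st2 [r2 p2 q2]]] := IH2 _ _ _ _ w2 q1 r1 h2.
  exists (j1 + j2), st2; rewrite stepsD ?addnA; split=> //.
  by rewrite p2 p1; lia.
- move=> /= /andP[w1 w2] [sf h] hr /at_cat[h1 /at_cat[h2 h3]].
  rewrite size_test_code in h2 h3; rewrite size_compile in h3.
  have [t1 e1' [r1 p1]] := test_correct hr h1 sf.
  case: ifP h p1 => hb h p1.
    case: (at_cat (c1 := [:: Jump _]) h3) => _ h4; rewrite /= in h4.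
    rewrite -p1 in h4.
    have [j1 [st1 [q1 q2 q3]]] := IH1 _ _ _ _ w1 h r1 h4.
    exists (test_size b + j1), st1; rewrite stepsD e1'; split=> //; last by rewrite addnA.
    by rewrite q2 p1; lia.
  rewrite -p1 in h2 h3.
  have [j1 [st1 [q1 q2 q3]]] := IH2 _ _ _ _ w2 h r1 h2.
  rewrite -q2 in h3; case/at_cons: h3 => h3 _.
  exists (test_size b + j1 + 1), st1; rewrite !stepsD e1' (steps_cons _ h3) //; split.
  + exact: rel_jump.
  + by rewrite /=; lia.
  + by rewrite !addnA.
- rewrite [wf _]/= wp_forE => /and3P[w1 w2 w3] [sf [wb h]] hr; rewrite /compile -/compile.
  have [l hl] : exists l, pc s = l by exists (pc s).
  rewrite hl => /at_cat[/at_cons[h0 _]] /at_cat[h1 /at_cat[/at_cons[h2 _]] /at_cat[h3 h4]].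
  rewrite size_compile in h4; rewrite !(size_test_code (TLt _ _)) in h2 h3 h4.
  rewrite [size [:: _]]/= in h1; rewrite /= in h2 h3 h4.
  move/at_cons: h4 => [h4 /at_cons[h5 /at_cons[h6 _]]].
  have [t1 [e1' [r1 p1]]] : exists t1, steps 1 s = t1 /\
      rel (setv st x 0) t1 /\ pc t1 = l + 1.
    rewrite (steps_cons _ h0) //; eexists; split; first by [].
    split; last by rewrite /= hl addn1.
    exact: rel_set_vreg.
  (* Every iteration starts at address [l + 1], just after the instruction that resets the counter;
     the induction on the remaining iterations starts there from an arbitrary related state. *)
  suff loop : forall j i st' t k', (Z.of_nat (i + j) = eval w G st b)%Z ->
      eval w G st' b = eval w G st b ->
      rel (setv st' x (Z.of_nat i)) t -> pc t = l + 1 ->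
      wp_loop w G tape lim x b c Q j i st' k' ->
      exists j' st2, [/\ rel st2 (steps j' t),
        pc (steps j' t) = l + 1 + test_size (TLt (EVar x) b) + 1 + code_size c + 3
        & Q st2 (k' + j')].
    have hb : Z.of_nat (0 + Z.to_nat (eval w G st b)) = eval w G st b.
      by rewrite /is_word in wb; lia.
    have [j [st2 [q1 q2 q3]]] := loop _ _ _ _ _ hb erefl r1 p1 h.
    exists (1 + j), st2; rewrite stepsD e1'; split=> //; last by rewrite addnA.
    by rewrite q2 /=; lia.
  elim=> [|j IHj] i st' t k' hij hev hrel hpc hw.
  - have sf' : test_safe w G lim (setv st' x (Z.of_nat i)) (TLt (EVar x) b).
      by apply: (stable_safe w1); rewrite ?hev //; rewrite /is_word in wb *; lia.
    rewrite -hpc in h1.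
    have [t2 e2' [r2 p2]] := test_correct hrel h1 sf'.
    have hb : test_val w G (setv st' x (Z.of_nat i)) (TLt (EVar x) b) = false.
      by rewrite /= Nat.eqb_refl (stable_set _ _ w1); lia.
    rewrite hb hpc in p2.
    have es : steps (loop_size x b) t = steps 1 t2 by rewrite /loop_size addnC stepsD e2'.
    exists (loop_size x b); eexists; rewrite es; split; last exact: hw.
    + by rewrite (steps_cons _ h2) //; apply: rel_jump r2.
    + by rewrite (steps_cons _ h2) //=; lia.
  - have sf' : test_safe w G lim (setv st' x (Z.of_nat i)) (TLt (EVar x) b).
      by apply: (stable_safe w1); rewrite ?hev //; rewrite /is_word in wb *; lia.
    have h1' := h1; rewrite -hpc in h1'.
    have [t2 e2' [r2 p2]] := test_correct hrel h1' sf'.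
    have hb : test_val w G (setv st' x (Z.of_nat i)) (TLt (EVar x) b) = true.
      by rewrite /= Nat.eqb_refl (stable_set _ _ w1); lia.
    rewrite hb hpc in p2.
    have h3' : at_ (pc t2) (compile (pc t2) c) by rewrite p2.
    (* The framed premise is used because [f3] shows that the body changes neither the counter nor
       the bound. *)
    have [j1 [st2 [q1 q2 [q3 f3]]]] := IH _ _ _ _ w3 (wp_frame hw) r2 h3'.
    have h4' : onth p (pc (steps j1 t2)) = Some (Const (treg 0) 1).
      by rewrite -h4 q2 p2; congr onth; lia.
    have vx : var st2 x = Z.of_nat i.
      by case: f3 => -> //=; [rewrite Nat.eqb_refl | apply: negbTE].
    have [t3 [e3' [r3 p3]]] : exists t3, steps 3 (steps j1 t2) = t3 /\
        rel (setv st2 x (Z.of_nat i.+1)) t3 /\ pc t3 = l + 1.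
      rewrite (steps_cons _ h4') // (steps_cons _ h5) /=; last by rewrite q2 p2; lia.
      rewrite (steps_cons _ h6) /=; last by rewrite q2 p2; lia.
      eexists; split; first by [].
      split; last by [].
      have q1' := q1; apply: rel_setv q1' _ _ => /= [u hu|y]; first by rewrite vreg_low // treg_high //; lia.
      rewrite vreg_inj !(negbTE (vreg_treg _ _)) (rel_var q1) vx wz_nat.
      case: (y == x) => //; rewrite -/(Z.of_nat i.+1) wz_nat /word modnDm.
      by rewrite addn1.
    have hij' : Z.of_nat (i.+1 + j) = eval w G st b by lia.
    have hev' : eval w G st2 b = eval w G st b by rewrite (stable_eval w1 f3).
    have [j' [st3 [z1 z2 z3]]] := IHj _ _ _ _ hij' hev' r3 p3 q3.
    exists (test_size (TLt (EVar x) b) + j1 + 3 + j'), st3.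
    by rewrite !stepsD e2' e3' !addnA; split.
- move=> _ h hr /at_cons[h1 _]; exists 1; eexists; split; last exact: h.
  + rewrite (steps_cons _ h1) //=; case: (hr) => q0 q1 q4 qv qi qa qd qo.
    split=> //=; rewrite ?vreg_low //.
    move=> y; rewrite vreg_inj; have -> : Nat.eqb y x = (y == x) by lia.
    by case: eqP => // _; rewrite wz_nat word_word qd.
    by rewrite qd.
  + by rewrite (steps_cons _ h1) //= addn1.
- move=> _ [sf [wv h]] hr /at_cat[h1 h2].
  have [t1 e1' [p1 r1]] := expr_correct hr h1 sf.
  rewrite -p1 in h2; case/at_cons: h2 => h2 _.
  exists (code_size (Rep e)); eexists; split; last exact: h.
  + rewrite /= stepsD e1' (steps_cons _ h2) //.
    case: (res_rel r1) => q0 q1 q4 qv qi qa qd qo; split=> //=.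
    by rewrite qo (res_val r1) wz_word.
  + by rewrite /= stepsD e1' (steps_cons _ h2) //= p1; lia.
Qed.


End Soundness.

Definition start := Store (fun _ => 0%Z) (fun _ _ => 0%Z) 0 [::].

(** One instruction puts the end of the input, [n + m], into register 4 as the base address of the
    arrays; the code of [c] thus starts at address 1 and at time 1. *)
Definition program_of c : program := Bin BAdd 4 0 1 :: compile 1 c.

Lemma program_of_correct (w : nat) (G : gpm) (t : nat) (tape : t.-tuple 'I_(2 ^ w))
    (lim : Z) c (Q : store -> nat -> Prop) :
  (Z.of_nat (size (input G)) + Z.of_nat num_arrays * lim <= W w)%Z -> (0 <= lim)%Z ->
  wf c -> wp w G [seq val x | x <- tape] lim c Q start 1 ->
  (forall st k, Q st k -> k <= t) ->
  halted (program_of c) (run G (program_of c) tape) /\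
  exists st k, Q st k /\ out (run G (program_of c) tape) = reps st.
Proof.
move=> hlim lim0 hc hw ht.
set p := program_of c; set tp := [seq val x | x <- tape].
have h0 : onth p 0 = Some (Bin BAdd 4 0 1) by [].
set s1 := exec w G tp (Bin BAdd 4 0 1) (init w G).
have e0 : steps w G tp p 1 (init w G) = s1.
  exact: (steps_cons w G tp 0 h0 (erefl : pc (init w G) = 0)).
have pc1 : pc s1 = 1 by [].
have r1 : rel w G lim start s1.
  split=> //=.
  - by rewrite /word modnDm /input size_cat !size_map !size_tuple.
  - move=> x; rewrite /vreg; have -> : (2 * x + 5 == 4) = false by lia.
    by rewrite nth_default /= ?/word ?mod0n //=; lia.
  - move=> a i _ hi; rewrite nth_default -/(input G) ?/word ?mod0n //; lia.
have hat : at_ p (pc s1) (compile (pc s1) c) by move=> i hi; rewrite /p /=.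
have [j [st [r2 p2 q2]]] := cmd_correct hlim lim0 hc hw r1 hat.
rewrite -/tp in r2 p2.
have hj := ht _ _ q2.
have hs : size p <= pc (steps w G tp p (1 + j) (init w G)).
  by rewrite stepsD e0 [size _]/= size_compile p2 pc1; lia.
(* A halted state is a fixed point of [step], so running for any [t] beyond the actual time changes
   nothing. *)
have fix_halt k s : size p <= pc s -> steps w G tp p k s = s.
  by move=> h; elim: k => //= k IH; rewrite /steps /= -/(steps _ _ _ _ _ _) IH /step onth_default.
have -> : run G p tape = steps w G tp p (1 + j) (init w G).
  rewrite /run -/(steps w G tp p t (init w G)).
  have -> : t = (1 + j) + (t - (1 + j)) by lia.
  by rewrite stepsD fix_halt.
split=> //; exists st, (1 + j); split=> //.
by rewrite stepsD e0 (rel_out r2).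
Qed.

End Compiler.
Import Compiler.

(** * Convolution by the fast Fourier transform *)

Module FourierAlgebra.

Set Implicit Arguments.
Unset Strict Implicit.
Unset Printing Implicit Defensive.
From mathcomp Require Import ring.
Import GRing.Theory.
Local Open Scope ring_scope.

Section Transform.

Variables (K : comNzRingType) (r rc : nat -> K).
Hypothesis r0 : r 0%N = 1.
Hypothesis r_even : forall b, r b.*2 ^+ 2 = r b.
Hypothesis r_odd : forall b, r b.*2.+1 ^+ 2 = - r b.
Hypothesis r_rc : forall b, r b * rc b = 1.

(** Block [b] of length [2 h] holds a polynomial modulo [x^(2 h) - r b ^ 2];
    it is reduced modulo [x^h - r b] and [x^h + r b]. *)
Definition fwd h (X : nat -> K) i : K :=
  if odd (i %/ h)%N then X (i - h)%N - r (i %/ (2 * h))%N * X i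
  else X i + r (i %/ (2 * h))%N * X (i + h)%N.

Definition bwd h (Y : nat -> K) i : K :=
  if odd (i %/ h)%N then (Y (i - h)%N - Y i) * rc (i %/ (2 * h))%N
  else Y i + Y (i + h)%N.

Lemma divn_2h i h : (i %/ (2 * h) = (i %/ h)./2)%N.
Proof. by rewrite mulnC divnMA divn2. Qed.

Lemma bwd_fwd h X i : (0 < h)%N -> bwd h (fwd h X) i = X i *+ 2.
Proof.
move=> hh; rewrite /bwd /fwd !divn_2h.
case: ifP => ho.
  have hi : (h <= i)%N by case: leqP ho => // hi; rewrite divn_small.
  have e : ((i - h) %/ h = (i %/ h).-1)%N.
    by have := divnDr (i - h) (dvdnn h); rewrite divnn hh subnK // => ->; rewrite addn1.
  have e2 : odd (i %/ h)%N.-1 = false by case: (i %/ h)%N ho => //= u /negbTE.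
  have e3 : ((i %/ h).-1)./2 = (i %/ h)./2.
    by case: (i %/ h)%N ho => //= u hu; rewrite uphalf_half (negbTE hu).
  rewrite e e2 e3 ho subnK //.
  have := r_rc (i %/ h)%N./2; move: (r _) (rc _) (X i) (X (i - h)%N) => a b x y hab.
  have -> : (y + a * x - (y - a * x)) * b = (a * b) * (x *+ 2) by ring.
  by rewrite hab mul1r.
have e : ((i + h) %/ h = (i %/ h).+1)%N by rewrite divnDr // divnn hh addn1.
rewrite e /= ho /= uphalf_half ho add0n addnK.
by rewrite addrACA subrr addr0.
Qed.

Variable L : nat.
Notation N := (2 ^ L)%N.

Fixpoint lev (A : nat -> K) l : nat -> K :=
  if l is l'.+1 then fwd (2 ^ (L - l'.+1)) (lev A l') else A.

(** With h = 2^(L - l) and b = i / h, block b holds the polynomial with coefficients [A] reduced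
    modulo x^h - r b ^ 2; replacing x^h by r b ^ 2 gives the sum. In the induction the sum splits
    into even and odd [k], and [r_even], [r_odd] turn the twiddle factor, with its sign, into the
    missing odd power. *)
Lemma lev_eval A l i : (l <= L)%N -> (i < N)%N ->
  lev A l i = \sum_(k < 2 ^ l)
    A (2 ^ (L - l) * k + i %% 2 ^ (L - l))%N * r (i %/ 2 ^ (L - l)) ^+ (2 * k).
Proof.
elim: l i => [|l IH] i hl hi.
  by rewrite subn0 expn0 big_ord1 muln0 add0n modn_small //= divn_small // r0 expr1n mulr1.
have eh : (2 ^ (L - l) = 2 * 2 ^ (L - l.+1))%N by rewrite -expnS; congr expn; lia.
rewrite /= /fwd; set h := (2 ^ (L - l.+1))%N in eh *.
have hh : (0 < h)%N by rewrite expn_gt0.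
have eN : (N = h * 2 ^ l.+1)%N by rewrite -expnD; congr expn; lia.
have sumE (f : nat -> K) : \sum_(k < 2 ^ l.+1) f k = \sum_(k < 2 ^ l) (f (2 * k)%N + f (2 * k).+1).
  rewrite expnS mul2n -addnn -(big_mkord xpredT) -(big_mkord xpredT (fun k => f (2 * k)%N + f (2 * k).+1)).
  elim: (2 ^ l)%N => [|u IHu]; first by rewrite !big_geq.
  rewrite addSn addnS !big_nat_recr //= IHu -addrA; congr (_ + (_ + _)); congr f; lia.
rewrite (sumE (fun k => A (h * k + i %% h)%N * r (i %/ h) ^+ (2 * k))).
have dm := divn_eq i h; have hm := ltn_pmod i hh.
have hq : (i %/ h < 2 ^ l.+1)%N by rewrite ltn_divLR // mulnC -eN.
have inN : (i < N)%N := hi.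
(* The two positions that meet in a butterfly lie in the same block of the previous level, so both
   are expanded with the same root; they differ only in the parity of the index into [A]. *)
have base j : (j < N)%N -> ((j %/ h)./2 = (i %/ h)./2)%N -> (j %% h = i %% h)%N ->
   lev A l j = \sum_(k < 2 ^ l) A (h * (2 * k + odd (j %/ h)%N) + i %% h)%N * r (i %/ h)%N./2 ^+ (2 * k).
  move=> hj e1 e2; rewrite IH //; last by lia.
  rewrite eh divn_2h e1; apply: eq_bigr => k _; congr (A _ * _).
  have -> : (j %% (2 * h) = h * odd (j %/ h) + i %% h)%N.
    have dj := divn_eq j h; have od := odd_double_half (j %/ h).
    have hm2 : (h * odd (j %/ h) + j %% h < 2 * h)%N.
      have := ltn_pmod j hh; case: (odd _); lia.
    have e3 : (j = (j %/ h)./2 * (2 * h) + (h * odd (j %/ h) + j %% h))%N.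
      by rewrite {1}dj -{1}od mulnDl -muln2; lia.
    by rewrite {1}e3 modnMDl modn_small // e2.
  by lia.
have even_pow (x : K) k : (- x) ^+ (2 * k) = x ^+ (2 * k) by rewrite !exprM sqrrN.
rewrite divn_2h; case: ifP => ho.
- have hi1 : (h <= i)%N by case: leqP ho => // hi'; rewrite divn_small.
  have e : ((i - h) %/ h = (i %/ h).-1)%N.
    by have := divnDr (i - h) (dvdnn h); rewrite divnn hh subnK // => ->; rewrite addn1.
  have e2 : odd (i %/ h)%N.-1 = false by case: (i %/ h)%N ho => //= u /negbTE.
  have e3 : ((i %/ h).-1)./2 = (i %/ h)%N./2.
    by case: (i %/ h)%N ho => //= u hu; rewrite uphalf_half (negbTE hu).
  have em : ((i - h) %% h = i %% h)%N by rewrite -[in RHS](subnK hi1) modnDr.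
  rewrite (base i) // (base (i - h)%N) ?e //; last by move: hi; clear; lia.
  rewrite e2 ho.
  have er : r (i %/ h)%N ^+ 2 = - r (i %/ h)%N./2.
    by rewrite -r_odd -[in LHS](odd_double_half (i %/ h)%N) ho.
  rewrite mulr_sumr -sumrB; apply: eq_bigr => k _.
  by rewrite addn0 addn1 !(exprM _ 2) !er [_ ^+ (2 * k).+1]exprS (exprM (- _) 2) !sqrrN mulNr mulrN [in RHS]mulrCA.
- have hi1 : (i + h < N)%N.
    have ev : ((i %/ h).+1 < 2 ^ l.+1)%N.
      rewrite ltn_neqAle hq andbT; apply/eqP => e5.
      by have := congr1 odd e5; rewrite expnS mul2n odd_double /= ho.
    rewrite [X in (_ < X)%N]eN; apply: leq_trans (leq_mul (leqnn h) ev).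
    by move: dm hm; clear; nia.
  have e : ((i + h) %/ h = (i %/ h).+1)%N by rewrite divnDr // divnn hh addn1.
  have em : ((i + h) %% h = i %% h)%N by rewrite modnDr.
  rewrite (base i) // (base (i + h)%N) ?e //=; last by rewrite uphalf_half ho.
  rewrite ho /=.
  have er : r (i %/ h)%N ^+ 2 = r (i %/ h)%N./2.
    by have := odd_double_half (i %/ h)%N; rewrite ho add0n => h5; rewrite -[in RHS]r_even h5.
  rewrite mulr_sumr -big_split; apply: eq_bigr => k _ /=.
  by rewrite addn0 addn1 !(exprM _ 2) !er [_ ^+ (2 * k).+1]exprS (exprM (r (i %/ h)%N./2) 2) [in RHS]mulrCA.
Qed.

Lemma lev_full A b : (b < N)%N -> lev A L b = \sum_(k < N) A k * r b ^+ (2 * k).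
Proof.
move=> hb; rewrite lev_eval // subnn expn0; apply: eq_bigr => k _.
by rewrite mul1n modn1 addn0 divn1.
Qed.

(** Squaring [r b] gives [r b./2] up to a sign, which the next even power removes; after L steps the
    index is 0. So the evaluation points [r b ^+ 2] are N-th roots of unity, which makes the
    convolution cyclic. *)
Lemma r_unity b : (b < N)%N -> r b ^+ (2 * N) = 1.
Proof.
elim: L b => [|l IH] b hb.
  by have -> : b = 0%N; [move: hb; clear; rewrite expn0; lia | rewrite r0 expr1n].
have hb2 : (b./2 < 2 ^ l)%N by move: hb; rewrite expnS; have := odd_double_half b; clear; lia.
have e : r b ^+ 2 = r b./2 \/ r b ^+ 2 = - r b./2.
  have := odd_double_half b; case: (odd b) => /= h; [right|left].
    by rewrite -{1}h add1n r_odd.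
  by rewrite -{1}h add0n r_even.
have {}e : r b ^+ (2 * 2 ^ l.+1) = r b./2 ^+ (2 * 2 ^ l).
  by rewrite exprM expnS; case: e => ->; rewrite // !exprM sqrrN.
by rewrite e IH.
Qed.

Definition cyc (A B : nat -> K) i := \sum_(y < N) B y * A ((i + (N - y)) %% N)%N.

Lemma lev_cyc A B b : (b < N)%N -> lev (cyc A B) L b = lev A L b * lev B L b.
Proof.
move=> hb; rewrite !lev_full // mulr_sumr.
under eq_bigr => k _ do rewrite mulr_suml.
rewrite exchange_big /=; apply: eq_bigr => y _.
have N0 : (0 < N)%N by rewrite expn_gt0.
(* For fixed [y], the substitution k = x + y modulo N is a bijection, and even powers of [r b] do
   not see the reduction modulo N of half their exponent. *)
have inj : injective (fun x : 'I_N => Ordinal (ltn_pmod (x + y) N0)).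
  move=> u v /(congr1 val) /= /eqP; rewrite eqn_modDr !modn_small ?ltn_ord // => /eqP h.
  exact: val_inj.
rewrite mulr_suml (reindex_inj inj) /=; apply: eq_bigr => x _.
have -> : (((x + y) %% N + (N - y)) %% N = x)%N.
  rewrite modnDml -addnA subnKC; last exact/ltnW/ltn_ord.
  by rewrite modnDr modn_small ?ltn_ord.
have -> : r b ^+ (2 * ((x + y) %% N)) = r b ^+ (2 * (x + y)).
  rewrite [in RHS](divn_eq (x + y) N) mulnDr exprD.
  have -> : (2 * ((x + y) %/ N * N) = 2 * N * ((x + y) %/ N))%N by rewrite mulnCA mulnC.
  by rewrite [r b ^+ (2 * N * _)]exprM r_unity // expr1n mul1r.
by rewrite mulnDr exprD; ring.
Qed.

Fixpoint unlev (P : nat -> K) l : nat -> K :=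
  if l is l'.+1 then bwd (2 ^ l') (unlev P l') else P.

(** [bwd] reads position [i] and its partner only, and the partner stays below N because N / h is
    even. *)
Lemma eq_bwd h X Y i l : (0 < h)%N -> N = (h * 2 ^ l.+1)%N -> (i < N)%N ->
  (forall j, (j < N)%N -> X j = Y j) -> bwd h X i = bwd h Y i.
Proof.
move=> hh eN hi e; rewrite /bwd; case: ifP => ho.
  rewrite !e //; move: hi; clear; lia.
rewrite !e //.
have dm := divn_eq i h; have hm := ltn_pmod i hh.
have hq : (i %/ h < 2 ^ l.+1)%N by rewrite ltn_divLR // mulnC -eN.
have ev : ((i %/ h).+1 < 2 ^ l.+1)%N.
  rewrite ltn_neqAle hq andbT; apply/eqP => e5.
  by have := congr1 odd e5; rewrite expnS mul2n odd_double /= ho.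
rewrite [X in (_ < X)%N]eN; apply: leq_trans (leq_mul (leqnn h) ev).
by move: dm hm; clear; nia.
Qed.

Lemma inv_lev C P l i : (l <= L)%N -> (forall j, (j < N)%N -> P j = lev C L j) ->
  (i < N)%N -> unlev P l i = lev C (L - l) i *+ 2 ^ l.
Proof.
move=> hl hP; elim: l hl i => [|l IH] hl i hi; first by rewrite subn0 /= hP.
have hh : (0 < 2 ^ l)%N by rewrite expn_gt0.
have eN : N = (2 ^ l * 2 ^ (L - l.+1).+1)%N by rewrite -expnD; congr expn; move: hl; clear; lia.
rewrite [LHS]/= (eq_bwd hh eN hi (Y := fun j => lev C (L - l) j *+ 2 ^ l)); last first.
  by move=> j hj; apply: IH => //; apply: ltnW.
have -> : (L - l)%N = (L - l.+1).+1 by move: hl; clear; lia.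
have -> : bwd (2 ^ l) (fun j => lev C (L - l.+1).+1 j *+ 2 ^ l) i =
    bwd (2 ^ l) (fwd (2 ^ l) (lev C (L - l.+1))) i *+ 2 ^ l.
  have -> : lev C (L - l.+1).+1 = fwd (2 ^ l) (lev C (L - l.+1)).
    by rewrite [LHS]/=; congr (fwd (2 ^ _) _); move: hl; clear; lia.
  by rewrite /bwd; case: ifP => _; rewrite ?mulrnDl ?mulrnBl // -mulrnBl mulrnAl.
by rewrite bwd_fwd // -mulrnA -expnS.
Qed.

(** Each inverse level doubles the values, so the result is [N] times the convolution. No division
    by [N] is made; the decision threshold is scaled instead. *)
Lemma inv_cyc A B P i : (forall j, (j < N)%N -> P j = lev A L j * lev B L j) ->
  (i < N)%N -> unlev P L i = cyc A B i *+ N.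
Proof.
move=> hP hi; rewrite (inv_lev (C := cyc A B)) ?subnn //.
by move=> j hj; rewrite lev_cyc // hP.
Qed.

End Transform.

(** Serves only the final rearrangement of the constants and factors of the time bound. *)
Lemma mulr_regroup (R : comNzRingType) (a x p y k s r z : R) :
  a * (x * (p * y) * (k * (s * (r * z)))) = a * p * k * r * (s * x * y * z).
Proof. by ring. Qed.

End FourierAlgebra.
Import FourierAlgebra.

(** * Roots of unity *)

Module Roots.

Set Implicit Arguments.
Unset Strict Implicit.
Unset Printing Implicit Defensive.
Import GRing.Theory.

Local Notation cplx := (complex R).

Section Roots.

Local Open Scope R_scope.

(** Cosine and sine of pi / 2^(k + 1), by cos (x / 2) = sqrt ((1 + cos x) / 2) and sin (x / 2) = sin
    x / (2 cos (x / 2)). Only these operations have to be imitated on integers. *)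
Fixpoint half_root k : R * R :=
  if k is k'.+1 then
    let c := sqrt ((1 + (half_root k').1) / 2) in (c, (half_root k').2 / (2 * c))
  else (0, 1).

Lemma root_spec k : [/\ 0 <= (half_root k).1 <= 1, 0 <= (half_root k).2 <= 1
  & (half_root k).1 * (half_root k).1 + (half_root k).2 * (half_root k).2 = 1].
Proof.
elim: k => [|k [c01 s01 e]] /=; first by split; lra.
move: c01 s01 e; move: (half_root k) => [c s] /= c01 s01 e.
have h0 : 0 <= (1 + c) / 2 by lra.
have hs := sqrt_sqrt _ h0; have hp := sqrt_lt_R0 ((1 + c) / 2).
have {}hp : 0 < sqrt ((1 + c) / 2) by apply: hp; lra.
move: (sqrt _) hs hp => u hs hp.
have e1 : u * u + (s / (2 * u)) * (s / (2 * u)) = 1.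
  have -> : s / (2 * u) * (s / (2 * u)) = (s * s) / (4 * (u * u)) by field; lra.
  rewrite hs; have -> : s * s = (1 - c) * (1 + c) by lra.
  by field; lra.
have s0 : 0 <= s / (2 * u) by apply: Rmult_le_pos; [lra | apply/Rlt_le/Rinv_0_lt_compat; lra].
by split; [split|split|] => //; nra.
Qed.

(** Double-angle formulas. The lower bound on the cosine keeps the division by twice the cosine well
    conditioned once it is rounded. *)
Lemma root_double k :
  [/\ (half_root k.+1).1 * (half_root k.+1).1 - (half_root k.+1).2 * (half_root k.+1).2
        = (half_root k).1,
      2 * (half_root k.+1).1 * (half_root k.+1).2 = (half_root k).2
    & 1 / 2 <= (half_root k.+1).1].
Proof.
have [c01 s01 e] := root_spec k; rewrite /=.
move: c01 s01 e; move: (half_root k) => [c s] /= c01 s01 e.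
have h0 : 0 <= (1 + c) / 2 by lra.
have hs := sqrt_sqrt _ h0; have hp := sqrt_lt_R0 ((1 + c) / 2).
have {}hp : 0 < sqrt ((1 + c) / 2) by apply: hp; lra.
move: (sqrt _) hs hp => u hs hp; split.
- have -> : s / (2 * u) * (s / (2 * u)) = (s * s) / (4 * (u * u)) by field; lra.
  rewrite hs; have -> : s * s = (1 - c) * (1 + c) by lra.
  by field; lra.
- by field; lra.
- nra.
Qed.

End Roots.

Local Open Scope ring_scope.

Definition croot k : cplx := Complex (half_root k).1 (half_root k).2.

Lemma croot_sqr k : croot k.+1 ^+ 2 = croot k.
Proof.
rewrite /croot; move: (root_double k); move: (half_root k.+1) (half_root k) => [c s] [c' s'] [h1 h2 _].
rewrite expr2; apply/eqP; rewrite eq_complex /=; apply/andP; split; apply/eqP.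
  by rewrite /= in h1; rewrite -h1.
rewrite /= in h2; rewrite -h2; change ((c * s + s * c)%Re = (2 * c * s)%Re); lra.
Qed.

Lemma croot0_sqr : croot 0 ^+ 2 = -1.
Proof.
rewrite expr2; apply/eqP; rewrite eq_complex /=; apply/andP; split; apply/eqP.
  by change ((0 * 0 - 1 * 1)%Re = (- (1))%Re); lra.
by change ((0 * 1 + 1 * 0)%Re = (- 0)%Re); lra.
Qed.

(** Twiddle factors in bit-reversed order: [tw b ^+ 2] is [tw b./2] up to the
    sign given by the parity of [b]. *)
Fixpoint tw_rec fuel b : cplx :=
  if fuel is f.+1 then
    if b == 0%N then 1 else croot (trunc_log 2 b) * tw_rec f (b - 2 ^ trunc_log 2 b)%N
  else 1.

Definition tw b := tw_rec b b.

Lemma tw_rec_enough f b : (b <= f)%N -> tw_rec f b = tw b.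
Proof.
rewrite /tw; elim/ltn_ind: b f => b IH [|f] hf.
  by move: hf; rewrite leqn0 => /eqP ->.
case: b IH hf => [|b] IH hf //=.
have h := trunc_log_bounds (isT : 1 < 2)%N (isT : 0 < b.+1)%N.
have p0 : (0 < 2 ^ trunc_log 2 b.+1)%N by rewrite expn_gt0.
by rewrite !IH //; move: h hf p0; clear; lia.
Qed.

Lemma tw0 : tw 0 = 1.
Proof. by []. Qed.

(** [tw b] is the product of [croot k] over the bits k of [b], so the table of the first 2^k factors
    is doubled by multiplying it with [croot k]. *)
Lemma tw_add k j : (j < 2 ^ k)%N -> tw (2 ^ k + j) = croot k * tw j.
Proof.
move=> hj; have p0 : (0 < 2 ^ k)%N by rewrite expn_gt0.
have e : trunc_log 2 (2 ^ k + j) = k.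
  by apply: trunc_log_eq => //; rewrite expnS; move: hj; clear; lia.
rewrite {1}/tw; case E : (2 ^ k + j)%N => [|b]; first by move: E p0; clear; lia.
rewrite [tw_rec _ _]/= -E e addKn; congr (_ * _).
by apply: tw_rec_enough; move: E p0; clear; lia.
Qed.

Lemma split_pow b : (0 < b)%N -> exists k j, b = (2 ^ k + j)%N /\ (j < 2 ^ k)%N.
Proof.
move=> hb; have := trunc_log_bounds (isT : 1 < 2)%N hb.
rewrite /=; move: (trunc_log 2 b) => k; rewrite expnS => h.
by exists k, (b - 2 ^ k)%N; move: h; clear; lia.
Qed.

(** Doubling [b] shifts its bits, and [croot k.+1 ^+ 2] is [croot k]; a new lowest bit contributes
    [croot 0 ^+ 2], which is -1. The induction strips the highest bit. *)
Lemma tw_parity b : tw b.*2 ^+ 2 = tw b /\ tw b.*2.+1 ^+ 2 = - tw b.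
Proof.
elim/ltn_ind: b => b IH; case: (posnP b) => [->|hb].
  rewrite tw0 expr1n; split=> //; rewrite (_ : 1%N = (2 ^ 0 + 0)%N) // tw_add //.
  by rewrite tw0 mulr1 croot0_sqr.
have [k [j [e hj]]] := split_pow hb.
have p0 : (0 < 2 ^ k)%N by rewrite expn_gt0.
have [h1 h2] : tw j.*2 ^+ 2 = tw j /\ tw j.*2.+1 ^+ 2 = - tw j.
  by apply: IH; move: e p0; clear; lia.
have -> : b.*2 = (2 ^ k.+1 + j.*2)%N by rewrite e doubleD expnS mul2n.
rewrite -addnS !tw_add; try (by rewrite expnS; move: hj; clear; lia).
by split; rewrite exprMn croot_sqr ?h1 ?h2 e tw_add // mulrN.
Qed.

Definition conj_tw b := conjc (tw b).

Definition unit_c (z : cplx) : Prop := z * conjc z = 1.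

Lemma croot_unit k : unit_c (croot k).
Proof.
have [_ _ h] := root_spec k; rewrite /unit_c /croot; move: (half_root k) h => [c s] /= h.
apply/eqP; rewrite eq_complex /=; apply/andP; split; apply/eqP.
  by change ((c * c - s * - s)%Re = 1%Re); lra.
by change ((c * - s + s * c)%Re = 0%Re); lra.
Qed.

(** All factors have modulus 1, so the inverse transform needs only the conjugates of the same
    table. *)
Lemma tw_unit b : tw b * conj_tw b = 1.
Proof.
rewrite /conj_tw; elim/ltn_ind: b => b IH; case: (posnP b) => [->|hb].
  by rewrite tw0 conjc1 mulr1.
have [k [j [e hj]]] := split_pow hb.
have p0 : (0 < 2 ^ k)%N by rewrite expn_gt0.
have hjb : (j < b)%N by move: e p0; clear; lia.
rewrite e tw_add // rmorphM mulrACA (croot_unit k) (IH j hjb) mulr1 //.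
Qed.

Definition re (z : cplx) : R := let: Complex a _ := z in a.
Definition im (z : cplx) : R := let: Complex _ b := z in b.

Local Open Scope R_scope.

Lemma re_add x y : re (x + y)%R = re x + re y. Proof. by case: x; case: y. Qed.
Lemma im_add x y : im (x + y)%R = im x + im y. Proof. by case: x; case: y. Qed.
Lemma re_sub x y : re (x - y)%R = re x - re y. Proof. by case: x; case: y. Qed.
Lemma im_sub x y : im (x - y)%R = im x - im y. Proof. by case: x; case: y. Qed.
Lemma re_mul x y : re (x * y)%R = re x * re y - im x * im y.
Proof. by case: x; case: y. Qed.
Lemma im_mul x y : im (x * y)%R = re x * im y + im x * re y.
Proof. by case: x; case: y. Qed.
Lemma re_conj x : re (conjc x) = re x. Proof. by case: x. Qed.
Lemma im_conj x : im (conjc x) = - im x. Proof. by case: x. Qed.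

Lemma tw_le1 b : Rabs (re (tw b)) <= 1 /\ Rabs (im (tw b)) <= 1.
Proof.
have := congr1 re (tw_unit b); rewrite /conj_tw re_mul re_conj im_conj.
move: (re _) (im _) => x y /= h.
have {}h : x * x + y * y = 1 by rewrite -[RHS]h; lra.
by split; apply: Rabs_le; nra.
Qed.

End Roots.
Import Roots.

(** * Fixed point arithmetic *)

Module FixedPoint.

Set Implicit Arguments.
Unset Strict Implicit.
Unset Printing Implicit Defensive.
Local Notation cplx := (complex R).
Local Open Scope R_scope.

Lemma Rabs_bound x a : Rabs x <= a -> - a <= x <= a.
Proof. by move=> h; split; [have := Rle_abs (- x); rewrite Rabs_Ropp; lra | have := Rle_abs x; lra]. Qed.

(** The pair [(a, b)] approximates [Q x] up to [E] in each coordinate, where [x]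
    has coordinates of size at most [M]. *)
Record apx (Q M E : R) (a b : Z) (x : cplx) : Prop := Apx {
  apx_re : Rabs (IZR a - Q * re x) <= E;
  apx_im : Rabs (IZR b - Q * im x) <= E;
  apx_mre : Rabs (re x) <= M;
  apx_mim : Rabs (im x) <= M
}.

Lemma apx_le Q M E M' E' a b x : M <= M' -> E <= E' -> apx Q M E a b x -> apx Q M' E' a b x.
Proof. by move=> hM hE [h1 h2 h3 h4]; split; lra. Qed.

Lemma apx_add Q M1 E1 M2 E2 a b c d x y : apx Q M1 E1 a b x -> apx Q M2 E2 c d y ->
  apx Q (M1 + M2) (E1 + E2) (a + c) (b + d) (x + y)%R.
Proof.
move=> [a1 a2 a3 a4] [b1 b2 b3 b4]; split; rewrite ?re_add ?im_add ?plus_IZR;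
  apply: Rabs_le; move: (Rabs_bound a1) (Rabs_bound a2) (Rabs_bound a3) (Rabs_bound a4)
  (Rabs_bound b1) (Rabs_bound b2) (Rabs_bound b3) (Rabs_bound b4); lra.
Qed.

Lemma apx_sub Q M1 E1 M2 E2 a b c d x y : apx Q M1 E1 a b x -> apx Q M2 E2 c d y ->
  apx Q (M1 + M2) (E1 + E2) (a - c) (b - d) (x - y)%R.
Proof.
move=> [a1 a2 a3 a4] [b1 b2 b3 b4]; split; rewrite ?re_sub ?im_sub ?minus_IZR;
  apply: Rabs_le; move: (Rabs_bound a1) (Rabs_bound a2) (Rabs_bound a3) (Rabs_bound a4)
  (Rabs_bound b1) (Rabs_bound b2) (Rabs_bound b3) (Rabs_bound b4); lra.
Qed.

Lemma apx_conj Q M E a b x : apx Q M E a b x -> apx Q M E a (- b) (conjc x).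
Proof.
move=> [a1 a2 a3 a4]; split; rewrite ?re_conj ?im_conj ?opp_IZR ?Rabs_Ropp //.
have -> : - IZR b - Q * - im x = - (IZR b - Q * im x) by lra.
by rewrite Rabs_Ropp.
Qed.

Lemma abs_mul_le x y a b : Rabs x <= a -> Rabs y <= b -> Rabs (x * y) <= a * b.
Proof. by move=> h1 h2; rewrite Rabs_mult; apply: Rmult_le_compat => //; apply: Rabs_pos. Qed.

Lemma product_error Q M1 E1 M2 E2 a c x y : 0 <= Q ->
  Rabs (a - Q * x) <= E1 -> Rabs x <= M1 -> Rabs (c - Q * y) <= E2 -> Rabs y <= M2 ->
  Rabs (a * c - Q * Q * (x * y)) <= (Q * M1 + E1) * E2 + Q * M2 * E1.
Proof.
move=> hQ h1 h2 h3 h4.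
have -> : a * c - Q * Q * (x * y) = a * (c - Q * y) + (Q * y) * (a - Q * x) by ring.
have ha : Rabs a <= Q * M1 + E1.
  have hx := @abs_mul_le Q x Q M1; rewrite (Rabs_pos_eq Q) // in hx.
  have {}hx := Rabs_bound (hx (Rle_refl _) h2).
  by apply: Rabs_le; move: (Rabs_bound h1); lra.
have hy : Rabs (Q * y) <= Q * M2.
  by apply: abs_mul_le => //; rewrite Rabs_pos_eq //; lra.
apply: Rle_trans (Rabs_triang _ _) _; apply: Rplus_le_compat; exact: abs_mul_le.
Qed.

Lemma IZR_div e q : (0 < q)%Z -> IZR (e / q) * IZR q <= IZR e < IZR (e / q) * IZR q + IZR q.
Proof.
move=> hq; have h1 := Z.div_mod e q; have h2 := Z.mod_pos_bound e q hq.
have e1 : e = (q * (e / q) + e mod q)%Z by apply: h1; lia.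
rewrite -mult_IZR -plus_IZR; split; [apply: IZR_le | apply: IZR_lt]; lia.
Qed.

Lemma floor_error q e v D : (0 < q)%Z ->
  Rabs (IZR e - IZR q * IZR q * v) <= IZR q * (D - 1) -> Rabs (IZR (e / q) - IZR q * v) <= D.
Proof.
move=> hq h; have [h1 h2] := IZR_div e hq; have hp := IZR_lt _ _ hq.
have [h3 h4] := Rabs_bound h.
by apply: Rabs_le; split; nra.
Qed.

(** Each coordinate of a complex product combines two real products, hence the factor 2; the 1
    subtracted from [D] pays for the floor in the division by [q]. *)
Lemma apx_mul q M1 E1 M2 E2 D a b c d x y : (0 < q)%Z ->
  apx (IZR q) M1 E1 a b x -> apx (IZR q) M2 E2 c d y ->
  2 * ((IZR q * M1 + E1) * E2 + IZR q * M2 * E1) <= IZR q * (D - 1) ->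
  apx (IZR q) (2 * M1 * M2) D ((a * c - b * d) / q) ((a * d + b * c) / q) (x * y)%R.
Proof.
move=> hq [a1 a2 a3 a4] [b1 b2 b3 b4] hD; have hp := IZR_lt _ _ hq.
have q0 : 0 <= IZR q by lra.
have P1 := product_error q0 a1 a3 b1 b3; have P2 := product_error q0 a2 a4 b2 b4.
have P3 := product_error q0 a1 a3 b2 b4; have P4 := product_error q0 a2 a4 b1 b3.
have m1 := abs_mul_le a3 b3; have m2 := abs_mul_le a4 b4.
have m3 := abs_mul_le a3 b4; have m4 := abs_mul_le a4 b3.
split; rewrite ?re_mul ?im_mul.
- apply: floor_error => //; rewrite minus_IZR !mult_IZR; apply: Rabs_le.
  by move: (Rabs_bound P1) (Rabs_bound P2); lra.
- apply: floor_error => //; rewrite plus_IZR !mult_IZR; apply: Rabs_le.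
  by move: (Rabs_bound P3) (Rabs_bound P4); lra.
- by apply: Rabs_le; move: (Rabs_bound m1) (Rabs_bound m2); lra.
- by apply: Rabs_le; move: (Rabs_bound m3) (Rabs_bound m4); lra.
Qed.

Lemma apx_size Q M E a b x : 0 <= Q -> apx Q M E a b x ->
  Rabs (IZR a) <= Q * M + E /\ Rabs (IZR b) <= Q * M + E.
Proof.
move=> hQ [a1 a2 a3 a4].
have h1 : Rabs (Q * re x) <= Q * M by apply: abs_mul_le; rewrite // Rabs_pos_eq //; lra.
have h2 : Rabs (Q * im x) <= Q * M by apply: abs_mul_le; rewrite // Rabs_pos_eq //; lra.
by split; apply: Rabs_le; move: (Rabs_bound a1) (Rabs_bound a2) (Rabs_bound h1) (Rabs_bound h2); lra.
Qed.

(** Signed products are shifted by q^3 before the unsigned division; these bounds make the shifted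
    values nonnegative and smaller than 2 q^3, hence words. *)
Lemma apx_product_size q M1 E1 M2 E2 B a b c d x y : (0 < q)%Z ->
  apx (IZR q) M1 E1 a b x -> apx (IZR q) M2 E2 c d y ->
  E1 <= IZR q -> E2 <= IZR q -> M1 <= B -> M2 <= B -> 2 * ((B + 1) * (B + 1)) < IZR q ->
  (- (q * q * q) < a * c - b * d < q * q * q)%Z /\ (- (q * q * q) < a * d + b * c < q * q * q)%Z.
Proof.
move=> hq h1 h2 e1 e2 m1 m2 hB; have hp := IZR_lt _ _ hq.
have q0 : 0 <= IZR q by lra.
have [a1 b1] := apx_size q0 h1; have [c1 d1] := apx_size q0 h2.
have s1 : IZR q * M1 + E1 <= IZR q * (B + 1) by nra.
have s2 : IZR q * M2 + E2 <= IZR q * (B + 1) by nra.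
have P u v : Rabs u <= IZR q * M1 + E1 -> Rabs v <= IZR q * M2 + E2 ->
   Rabs (u * v) <= IZR q * IZR q * ((B + 1) * (B + 1)).
  move=> hu hv; have -> : IZR q * IZR q * ((B + 1) * (B + 1)) = (IZR q * (B + 1)) * (IZR q * (B + 1)) by ring.
  by apply: abs_mul_le; lra.
have big : 2 * (IZR q * IZR q * ((B + 1) * (B + 1))) < IZR q * IZR q * IZR q.
  have : 0 < IZR q * IZR q by nra.
  by nra.
move: (Rabs_bound (P _ _ a1 c1)) (Rabs_bound (P _ _ b1 d1)) (Rabs_bound (P _ _ a1 d1)) (Rabs_bound (P _ _ b1 c1)).
move=> z1 z2 z3 z4.
have e3 : IZR (q * q * q) = IZR q * IZR q * IZR q by rewrite !mult_IZR.
by split; split; apply: lt_IZR; rewrite ?opp_IZR ?minus_IZR ?plus_IZR e3 !mult_IZR; lra.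
Qed.

(** The error terms [M * t], [E * t / q] and [E] are each at most [E]; doubled for the two real
    products they give 6 E, and the floor, at most 1 <= E, makes 7 E. *)
Lemma apx_twiddle q M E t a b c d x y : (0 < q)%Z -> 1 <= E -> 0 <= M ->
  M * t <= E -> t <= IZR q ->
  apx (IZR q) M E a b x -> apx (IZR q) 1 t c d y ->
  apx (IZR q) (2 * M) (7 * E) ((a * c - b * d) / q) ((a * d + b * c) / q) (x * y)%R.
Proof.
move=> hq hE hM hMt ht h1 h2; have hp := IZR_lt _ _ hq.
have t0 : 0 <= t by have := apx_re h2; have := Rabs_pos (IZR c - IZR q * re y); lra.
have -> : 2 * M = 2 * M * 1 by ring.
apply: (apx_mul hq h1 h2); nra.
Qed.

(** The true growth factors are 3 for the size and 8 for the error; 3 is rounded up to 4, and in the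
    inverse butterfly 14 to 16, so that L levels contribute exact powers of N = 2^L. *)
Lemma apx_fwd q M E t a b c d u v x z y : (0 < q)%Z -> 1 <= E -> 0 <= M ->
  M * t <= E -> t <= IZR q ->
  apx (IZR q) M E u v z -> apx (IZR q) M E a b x -> apx (IZR q) 1 t c d y ->
  apx (IZR q) (4 * M) (8 * E) (u + (a * c - b * d) / q) (v + (a * d + b * c) / q) (z + y * x)%R /\
  apx (IZR q) (4 * M) (8 * E) (u - (a * c - b * d) / q) (v - (a * d + b * c) / q) (z - y * x)%R.
Proof.
move=> hq hE hM hMt ht h0 h1 h2; have h3 := apx_twiddle hq hE hM hMt ht h1 h2.
rewrite GRing.mulrC; split; [have := apx_add h0 h3 | have := apx_sub h0 h3]; apply: apx_le; lra.
Qed.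

Lemma apx_bwd q M E t a b c d u v x z y : (0 < q)%Z -> 1 <= E -> 0 <= M ->
  M * t <= E -> t <= IZR q ->
  apx (IZR q) M E u v z -> apx (IZR q) M E a b x -> apx (IZR q) 1 t c d y ->
  apx (IZR q) (4 * M) (16 * E) (u + a) (v + b) (z + x)%R /\
  apx (IZR q) (4 * M) (16 * E) (((u - a) * c - (v - b) * - d) / q) (((u - a) * - d + (v - b) * c) / q)
     ((z - x) * conjc y)%R.
Proof.
move=> hq hE hM hMt ht h0 h1 h2; split; first by have := apx_add h0 h1; apply: apx_le; lra.
have h3 := apx_sub h0 h1.
have := apx_twiddle hq _ _ _ ht h3 (apx_conj h2); move=> h4.
by apply: apx_le (h4 _ _ _); lra.
Qed.

Lemma apx_square q M E a b c d x y : (0 < q)%Z -> 1 <= E -> 1 <= M -> E <= IZR q ->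
  apx (IZR q) M E a b x -> apx (IZR q) M E c d y ->
  apx (IZR q) (2 * M * M) (7 * M * E) ((a * c - b * d) / q) ((a * d + b * c) / q) (x * y)%R.
Proof.
move=> hq hE hM hEq h1 h2; have hp := IZR_lt _ _ hq.
apply: (apx_mul hq h1 h2).
have : 0 <= IZR q * ((M - 1) * E) by apply: Rmult_le_pos; nra.
have : E * E <= IZR q * E by nra.
have : 0 <= IZR q * (E - 1) by nra.
nra.
Qed.

Lemma apx_exact q x : 0 <= IZR q -> Rabs (IZR x) <= 1 ->
  apx (IZR q) 1 0 (x * q) 0 (Complex (IZR x) 0).
Proof.
move=> hq h; split; rewrite /= ?mult_IZR //.
- by rewrite (_ : IZR x * IZR q - IZR q * IZR x = 0); last ring; rewrite Rabs_R0; lra.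
- by rewrite (_ : 0 - IZR q * 0 = 0); last ring; rewrite Rabs_R0; lra.
- by rewrite Rabs_R0; lra.
Qed.

Lemma mul_le a b c d : 0 <= a -> 0 <= c -> a <= b -> c <= d -> a * c <= b * d.
Proof. exact: Rmult_le_compat. Qed.

(** The square root does not amplify the error: since p >= Q / 2, moving [p] up by [e] or down by
    [2 * e] changes its square by more than Q e, whereas the error of [r] changes the radicand by at
    most Q e / 2. The slack covers the floors of the division and of the root. *)
Lemma isqrt_error Q p g r e X Y : 8 <= e -> 100 * e <= Q -> Q / 2 <= p ->
  p * p = Q * (Q + g) / 2 -> - e <= r - g <= e -> X * 2 <= Q * (Q + r) ->
  Q * (Q + r) < X * 2 + 2 -> Y * Y <= X -> X < (Y + 1) * (Y + 1) -> 0 <= Y ->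
  Y <= p + e /\ p - 2 * e <= Y + 1.
Proof.
move=> he hQ hp ep [r1 r2] X1 X2 Y1 Y2 Y0.
have pe : Q / 2 * e <= p * e by apply: mul_le; lra.
have Qr : Q * (g - e) <= Q * r by apply: Rmult_le_compat_l; lra.
have Qr' : Q * r <= Q * (g + e) by apply: Rmult_le_compat_l; lra.
have Qe : 100 * e * e <= Q * e by apply: mul_le; lra.
have e8 : 8 * 8 <= e * e by apply: mul_le; lra.
split; apply: Rnot_lt_le => hlt.
- have : (p + e) * (p + e) <= Y * Y by apply: mul_le; lra.
  lra.
- have : (Y + 1) * (Y + 1) <= (p - 2 * e) * (p - 2 * e) by apply: mul_le; lra.
  lra.
Qed.

(** [p], [g], [z] stand for [Q c'], [Q c], [Q s'], where [s = 2 c' s']. *)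
Lemma half_sine_error Q p c' s' e I V Y : 8 <= e -> 100 * e <= Q -> 0 <= s' <= 1 ->
  p = Q * c' -> Y <= p + e -> p - 2 * e <= Y + 1 -> 47 / 100 * Q <= Y ->
  - e <= I - Q * (2 * c' * s') <= e ->
  V * (2 * Y) <= Q * I -> Q * I < V * (2 * Y) + 2 * Y ->
  - (8 * e) <= V - Q * s' <= 8 * e.
Proof.
move=> he hQ [s0 s1] ep up lo Y1 [i1 i2] V1 V2.
have QI : Q * (2 * p * s' - e) <= Q * I by apply: Rmult_le_compat_l; rewrite ?ep; lra.
have QI' : Q * I <= Q * (2 * p * s' + e) by apply: Rmult_le_compat_l; rewrite ?ep; lra.
have z0 : 0 <= Q * s' by apply: Rmult_le_pos; lra.
have z1 : Q * s' <= Q by rewrite -[X in _ <= X]Rmult_1_r; apply: Rmult_le_compat_l; lra.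
have Yz : Y * (Q * s') <= (p + e) * (Q * s') by apply: Rmult_le_compat_r; lra.
have Yz' : (p - 2 * e - 1) * (Q * s') <= Y * (Q * s') by apply: Rmult_le_compat_r; lra.
have ez : e * (Q * s') <= e * Q by apply: Rmult_le_compat_l; lra.
have Ye : 47 / 100 * Q * (8 * e - 1) <= Y * (8 * e - 1) by apply: Rmult_le_compat_r; lra.
have eQ : 8 * Q <= e * Q by apply: Rmult_le_compat_r; lra.
split; apply: Rnot_lt_le => hlt.
- have : Y * V <= Y * (Q * s' - 8 * e) by apply: Rmult_le_compat_l; lra.
  lra.
- have : Y * (Q * s' + 8 * e) <= Y * V by apply: Rmult_le_compat_l; lra.
  lra.
Qed.

(** One half-angle step multiplies the error bound by 8, so L steps contribute 8^L = N^3, which the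
    scale absorbs easily. *)
Lemma root_step k q e cr ci y : (0 < q)%Z -> 8 <= e -> 100 * e <= IZR q ->
  apx (IZR q) 1 e cr ci (croot k) ->
  (0 <= y)%Z -> (y * y <= (q * (q + cr)) / 2)%Z -> ((q * (q + cr)) / 2 < (y + 1) * (y + 1))%Z ->
  (0 < y)%Z /\ apx (IZR q) 1 (8 * e) y ((q * ci) / (2 * y)) (croot k.+1).
Proof.
move=> hq he hqe [h1 h2 _ _] y0 hy1 hy2; have hp := IZR_lt _ _ hq.
have [cp sp e1] := root_spec k.+1; have := root_double k.
move: h1 h2; rewrite /croot; move: (half_root k.+1) (half_root k) cp sp e1 => [c' s'] [c s] /=.
move=> cp sp e1 /Rabs_bound h1 /Rabs_bound h2 [d1 d2 d3].
have hX := IZR_div (q * (q + cr)) (erefl : (0 < 2)%Z).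
move: ((q * (q + cr)) / 2)%Z hX hy1 hy2 => X [X1 X2] hy1 hy2.
have {}hy1 := IZR_le _ _ hy1; have {}hy2 := IZR_lt _ _ hy2; have y0' := IZR_le _ _ y0.
rewrite mult_IZR plus_IZR in X1 X2; rewrite !mult_IZR !plus_IZR in hy1 hy2.
move: (IZR X) (IZR cr) X1 X2 hy1 hy2 h1 => X' r X1 X2 hy1 hy2 h1.
have hc2 : c' * c' = (1 + c) / 2 by lra.
have E1 : IZR q * c' * (IZR q * c') = IZR q * IZR q * ((1 + c) / 2) by rewrite -hc2; ring.
have hp2 : IZR q / 2 <= IZR q * c' by have := Rmult_le_compat_l _ _ _ (Rlt_le _ _ hp) d3; lra.
have [up lo] := @isqrt_error (IZR q) (IZR q * c') (IZR q * c) r e X' (IZR y) ltac:(lra) ltac:(lra) ltac:(lra)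
  ltac:(lra) ltac:(lra) ltac:(lra) ltac:(lra) ltac:(lra) ltac:(lra) ltac:(lra).
(* Here p - 2 e - 1 is bounded below using p >= Q / 2, e <= Q / 100 and Q >= 800. *)
have Y1 : 47 / 100 * IZR q <= IZR y by lra.
have yp : (0 < y)%Z by apply: lt_IZR; lra.
split=> //.
have h2y : (0 < 2 * y)%Z by lia.
have [V1 V2] := IZR_div (q * ci) h2y.
rewrite /croot; split=> /=; try (by apply: Rabs_le; lra).
move: V1 V2; rewrite !mult_IZR.
move: (IZR (q * ci / (2 * y))) => V V1 V2.
rewrite -d2 in h2; apply: Rabs_le.
by apply: (@half_sine_error (IZR q) (IZR q * c') c' s' e (IZR ci) V (IZR y)); lra.
Qed.

End FixedPoint.
Import FixedPoint.

(** * Transforms and convolutions on the RAM *)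

Module Convolution.

Set Implicit Arguments.
Unset Strict Implicit.
Unset Printing Implicit Defensive.
Local Open Scope nat_scope.

Notation vN := 0. Notation vN2 := 1. Notation vL := 2. Notation vQ := 3.
Notation vQ2 := 4. Notation vQ3 := 5. Notation vLQ := 6. Notation vlg := 7.
Notation vh := 8. Notation vb := 9. Notation vi := 10. Notation vj := 11.
Notation vx := 12. Notation vy := 13. Notation vt := 14. Notation vu := 15.
Notation vv := 16. Notation vz := 17. Notation vl := 18. Notation vq := 19.
Notation vk := 20. Notation vnb := 21. Notation vs := 22. Notation vblk := 23.
Notation vS := 24. Notation vcnt := 25. Notation vD := 26. Notation vB := 27.
Notation vR := 28. Notation vrep := 29. Notation vbeta := 30. Notation vp := 31.
Notation vran := 33. Notation vG := 34. Notation va := 35.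
Notation vdeg := 36. Notation vX := 37. Notation vtr := 38. Notation vti := 39.
Notation vcount := 40.

Notation aTR := 0. Notation aTI := 1. Notation aAR := 2. Notation aAI := 3.
Notation aBR := 4. Notation aBI := 5. Notation aU := 6. Notation aV := 7.
Notation abad := 8. Notation amark := 9. Notation adist := 10. Notation atab := 11.

Notation "a +' b" := (EBin OAdd a b) (at level 50, left associativity).
Notation "a -' b" := (EBin OSub a b) (at level 50, left associativity).
Notation "a *' b" := (EBin OMul a b) (at level 40, left associativity).
Notation "a /' b" := (EBin ODiv a b) (at level 40, left associativity).
Notation "x <- e" := (Asg x e) (at level 60).
Notation "a ;; b" := (Seq a b) (at level 62, right associativity).
Notation "$ x" := (EVar x) (at level 5, format "$ x").

(** The machine divides unsigned words only: adding q^3 makes the operand nonnegative, and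
    subtracting q^2 afterwards undoes this exactly, so the result is the floor of a signed quotient
    by [q]. *)
Definition scaled e := ((e +' $vQ3) /' $vQ) -' $vQ2.

Definition fft_body :=
  vb <- $vq /' $vh ;; vi <- $vq +' $vh *' $vb ;; vj <- $vi +' $vh ;;
  vx <- EGet aAR $vj ;; vy <- EGet aAI $vj ;; vt <- EGet aTR $vb ;; vu <- EGet aTI $vb ;;
  vv <- scaled ($vx *' $vt -' $vy *' $vu) ;; vz <- scaled ($vx *' $vu +' $vy *' $vt) ;;
  vx <- EGet aAR $vi ;; vy <- EGet aAI $vi ;;
  Put aAR $vj ($vx -' $vv) ;; Put aAI $vj ($vy -' $vz) ;;
  Put aAR $vi ($vx +' $vv) ;; Put aAI $vi ($vy +' $vz).

Definition fft :=
  vh <- $vN ;;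
  For vl $vL (vh <- $vh /' ECst 2 ;; For vq $vN2 fft_body).

Definition ifft_body :=
  vb <- $vq /' $vh ;; vi <- $vq +' $vh *' $vb ;; vj <- $vi +' $vh ;;
  vx <- EGet aAR $vj ;; vy <- EGet aAI $vj ;; vt <- EGet aAR $vi ;; vu <- EGet aAI $vi ;;
  vv <- $vt -' $vx ;; vz <- $vu -' $vy ;;
  vtr <- EGet aTR $vb ;; vti <- ECst 0 -' EGet aTI $vb ;;
  Put aAR $vi ($vt +' $vx) ;; Put aAI $vi ($vu +' $vy) ;;
  Put aAR $vj (scaled ($vv *' $vtr -' $vz *' $vti)) ;;
  Put aAI $vj (scaled ($vv *' $vti +' $vz *' $vtr)).

Definition ifft :=
  vh <- ECst 1 ;;
  For vl $vL (For vq $vN2 ifft_body ;; vh <- $vh *' ECst 2).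

(** Error bound for the table of twiddle factors: 8 at the start, multiplied by 8 in each of the [L]
    doublings of the table. *)
Definition tau (L : nat) : R := (8 * 8 ^ L)%Re.

Record par (q : Z) (L : nat) (st : store) : Prop := Par {
  par_N : var st vN = Z.of_nat (2 ^ L);
  par_N2 : var st vN2 = Z.of_nat (2 ^ L.-1);
  par_L : var st vL = Z.of_nat L;
  par_Q : var st vQ = q;
  par_Q2 : var st vQ2 = (q * q)%Z;
  par_Q3 : var st vQ3 = (q * q * q)%Z;
  par_tw : forall b, b < 2 ^ L ->
    apx (IZR (q)) 1 (tau L) (arr st aTR (Z.of_nat b)) (arr st aTI (Z.of_nat b)) (tw b)
}.

(** A boolean test on the program text, so that preservation of [par] is settled by evaluation. *)
Definition keeps_par c : bool :=
  [&& ~~ writes_var vN c, ~~ writes_var vN2 c, ~~ writes_var vL c, ~~ writes_var vQ c,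
      ~~ writes_var vQ2 c, ~~ writes_var vQ3 c, ~~ writes_arr aTR c & ~~ writes_arr aTI c].

Lemma par_frame q L c st st' : keeps_par c -> frame c st st' -> par q L st -> par q L st'.
Proof.
case/and5P=> /negbTE h1 /negbTE h2 /negbTE h3 /negbTE h4 /and4P[/negbTE h5 /negbTE h6 /negbTE h7 /negbTE h8].
move=> [fv fa _ _] [p1 p2 p3 p4 p5 p6 p7].
by split; rewrite ?fv // => b hb; rewrite !fa //; apply: p7.
Qed.

(** A generous bound shared by the straight-line loop bodies; their actual instruction counts are
    compared with it by computation. *)
Definition body_cost := 250.

Ltac wpsimpl st := cbv beta iota zeta delta [wp eval safe setv seta var arr used reps
  arith_op Nat.eqb scaled test_safe test_val];
  fold (var st); fold (arr st); fold (used st); fold (reps st).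

Ltac vc := repeat match goal with |- _ /\ _ => split | |- True => exact I end.

(** Number of the butterfly that owns position [a] when partners are [h] apart: the last bit of
    [a %/ h], which tells the partners apart, is dropped. *)
Definition slot h a := a %/ (2 * h) * h + a %% h.

Lemma butterfly h n : 0 < h ->
  let i := n + h * (n %/ h) in
  [/\ odd (i %/ h) = false, odd ((i + h) %/ h), i %/ (2 * h) = n %/ h,
      (i + h) %/ (2 * h) = n %/ h
    & forall a, (slot h a == n) = (a == i) || (a == i + h)].
Proof.
move=> h0 i; have dn := divn_eq n h; have mn := ltn_pmod n h0.
have e1 : i = (n %/ h).*2 * h + n %% h by rewrite /i -muln2; lia.
have e2 : i + h = ((n %/ h).*2.+1) * h + n %% h by rewrite e1; lia.
have d1 : i %/ h = (n %/ h).*2 by rewrite e1 divnMDl // [_ %% h %/ h]divn_small // addn0.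
have d2 : (i + h) %/ h = (n %/ h).*2.+1 by rewrite e2 divnMDl // [_ %% h %/ h]divn_small // addn0.
split; rewrite ?divn_2h ?d1 ?d2 /= ?odd_double ?doubleK ?uphalf_double //.
move=> a; rewrite /slot divn_2h; have da := divn_eq a h; have ma := ltn_pmod a h0.
have od := odd_double_half (a %/ h).
apply/eqP/orP => [e|[/eqP ->|/eqP ->]].
- have q1 : (a %/ h)./2 = n %/ h.
    by rewrite -e divnMDl // [(a %% h) %/ h]divn_small // addn0.
  have q2 : a %% h = n %% h by rewrite -e modnMDl modn_mod.
  by move: od da; rewrite q1 q2 e1; case: (odd _) => /= <- ->; [right|left]; apply/eqP; lia.
- by rewrite d1 doubleK e1 modnMDl modn_mod.
- by rewrite d2 /= uphalf_double e2 modnMDl modn_mod.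
Qed.

Lemma tau_ge1 L : (1 <= tau L)%Re.
Proof. by rewrite /tau; have := pow_R1_Rle 8 L; lra. Qed.

Section Loops.

Variables (w : nat) (G : gpm) (tape : seq nat) (lim : Z).
Notation wpc := (wp w G tape lim).

Lemma wp_use c (Q Q' : store -> nat -> Prop) st k : wpc c Q st k ->
  (forall st' k', Q st' k' -> frame c st st' -> Q' st' k') -> wpc c Q' st k.
Proof. by move=> h1 h2; apply: wp_mono (wp_frame h1) => st' k' [h3 h4]; apply: h2. Qed.

Lemma wp_seq c1 c2 Q st k : wpc c1 (wpc c2 Q) st k -> wpc (Seq c1 c2) Q st k.
Proof. by []. Qed.

Lemma wp_for_simple (I : nat -> store -> Prop) (n T : nat) x b c Q st k :
  safe w G lim st b -> eval w G st b = Z.of_nat n -> n < 2 ^ w -> loop_size x b <= 7 -> I 0 st ->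
  (forall i st' k', i < n -> I i st' -> frame (For x b c) st st' ->
     wpc c (fun st2 k2 => I i.+1 st2 /\ k2 <= k' + T) (setv st' x (Z.of_nat i)) k') ->
  (forall st' k', I n st' -> frame (For x b c) st (setv st' x (Z.of_nat n)) ->
     k' <= k + n * (T + 10) + 8 -> Q (setv st' x (Z.of_nat n)) k') ->
  wpc (For x b c) Q st k.
Proof.
move=> h1 h2 h3 h4 h5 h6 post; apply: (wp_for (I := I) (T := T)) h6 _ => // st' k' hI fr hk.
apply: post => //; last first.
  have : n * (T + loop_size x b + 3) <= n * (T + 10) by rewrite leq_mul2l; lia.
  lia.
case: fr => fv fa fu fr; split=> // y /= hy.
by case: (boolP (Nat.eqb y x)) => [e|/negbTE e]; [move: hy; rewrite e | apply: fv].
Qed.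

End Loops.

(** What a level requires of the current bounds. [good_t] lets [E] absorb the error of the twiddle
    factors, and [good_B] prevents overflow of products; [2 * M] and [good_2E] are there because the
    inverse butterfly multiplies a difference of two entries. *)
Record good (L : nat) (q : Z) (M E : R) : Prop := Good {
  good_M : (1 <= M)%Re;
  good_E : (1 <= E)%Re;
  good_t : (M * tau L <= E)%Re;
  good_q : (E <= IZR q)%Re;
  good_B : (2 * ((2 * M + 1) * (2 * M + 1)) < IZR q)%Re;
  good_2E : (2 * E <= IZR q)%Re
}.

Definition approximates (L : nat) (q : Z) (M E : R) st (X : nat -> complex R) := forall a, a < 2 ^ L ->
  apx (IZR q) M E (arr st aAR (Z.of_nat a)) (arr st aAI (Z.of_nat a)) (X a).

Definition rN L : R := IZR (Z.of_nat (2 ^ L)).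

Definition fill_pattern :=
  For vq $vN (vi <- EBin OMod ($vN -' $vq) $vN ;;
    If (TLt $vi ELenP) (Put aAR $vq (EGet aV $vi *' $vQ)) (Put aAR $vq (ECst 0)) ;;
    Put aAI $vq (ECst 0)).

Definition copy_spectrum :=
  For vq $vN (Put aBR $vq (EGet aAR $vq) ;; Put aBI $vq (EGet aAI $vq)).

Definition fill_text :=
  For vq $vN (Put aAR $vq (EGet aU ($vs +' $vq) *' $vQ) ;; Put aAI $vq (ECst 0)).

Definition multiply :=
  For vq $vN (vx <- EGet aAR $vq ;; vy <- EGet aAI $vq ;; vt <- EGet aBR $vq ;; vu <- EGet aBI $vq ;;
    Put aAR $vq (scaled ($vx *' $vt -' $vy *' $vu)) ;;
    Put aAI $vq (scaled ($vx *' $vu +' $vy *' $vt))).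

(** The inverse transform leaves [N] times the count at scale [q], so N q / 2 lies midway between
    the counts 0 and 1. Both sides are shifted by q^3 because the machine compares nonnegative
    words. *)
Definition mark_block :=
  For vq ELenP (If (TLt ($vN2 *' $vQ +' $vQ3) (EGet aAR $vq +' $vQ3))
    (Put abad ($vs +' $vq) (ECst 1)) Skip).

Definition conv_block :=
  vs <- $vblk *' ELenP ;; fill_text ;; fft ;; multiply ;; ifft ;; mark_block.

(** The spectrum of the pattern is computed once and reused for every block of [m] alignments, which
    keeps the length of the transforms of order [m]. *)
Definition conv :=
  fill_pattern ;; fft ;; copy_spectrum ;; For vblk $vnb conv_block.

Definition b2r (b : bool) : R := IZR (Z.b2z b).

Definition signal (u : nat -> bool) s a : complex R := Complex (b2r (u (s + a))) 0%Re.

(** The pattern is stored backwards modulo N, which turns cyclic convolution into correlation: as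
    long as nothing wraps around, coefficient [i] is the sum of u (s + i + j) v j over j < m. *)
Definition kernel L m (v : nat -> bool) a : complex R :=
  let j := (2 ^ L - a) %% 2 ^ L in Complex (b2r ((j < m) && v j)) 0%Re.

Definition hit m (u v : nat -> bool) p := [exists j : 'I_m, u (p + j) && v j].

Lemma cplx_eq (x y : complex R) : re x = re y -> im x = im y -> x = y.
Proof. by case: x => a b; case: y => c d /= -> ->. Qed.

Lemma re_muln z n : re (z *+ n)%R = (IZR (Z.of_nat n) * re z)%Re.
Proof.
elim: n => [|n IH]; first by rewrite GRing.mulr0n; change (0 = 0 * re z)%Re; lra.
have -> : Z.of_nat n.+1 = (1 + Z.of_nat n)%Z by lia.
by rewrite GRing.mulrS re_add IH plus_IZR; lra.
Qed.

(** For i, j < m the index i + j stays below 2 m <= N, so nothing wraps around; all terms are 0 or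
    1, so one hit already forces the sum up to 1. *)
Lemma cyc_hit L m u v s i : 0 < m -> 2 * m <= 2 ^ L -> i < m ->
  let C := cyc L (signal u s) (kernel L m v) i in
  if hit m u v (s + i) then (1 <= re C)%Re else re C = 0%Re.
Proof.
move=> m0 hm hi C; have N0 : 0 < 2 ^ L by rewrite expn_gt0.
have term (y : 'I_(2 ^ L)) : let j := (2 ^ L - y) %% 2 ^ L in
    (kernel L m v y * signal u s ((i + (2 ^ L - y)) %% 2 ^ L))%R =
    Complex (b2r [&& j < m, v j & u (s + i + j)]) 0%Re.
  move=> j; rewrite /kernel /signal -/j -modnDmr -/j.
  case: (ltnP j m) => hj; last first.
    by apply: cplx_eq; rewrite ?re_mul ?im_mul /b2r /=; lra.
  rewrite (@modn_small (i + j)); last by move: hi hj hm; clear; lia.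
  rewrite addnA; case: (v j); case: (u _); apply: cplx_eq;
    rewrite ?re_mul ?im_mul /b2r /=; lra.
case: ifP => h.
- case/existsP: h => j /andP[uj vj].
  (* Position N - j modulo N of the kernel carries pattern index [j]; j = 0 is treated apart because
     N - 0 has to be reduced. *)
  have hjN : (2 ^ L - j) %% 2 ^ L < 2 ^ L by rewrite ltn_pmod.
  have ejj : (2 ^ L - (2 ^ L - j) %% 2 ^ L) %% 2 ^ L = j.
    have jm := ltn_ord j.
    case: (posnP j) => [->|j0]; first by rewrite subn0 modnn subn0 modnn.
    rewrite (@modn_small (2 ^ L - j)); last by move: j0 N0; clear; lia.
    by rewrite subKn ?modn_small //; move: jm hm; clear; lia.
  rewrite /C /cyc (bigD1 (Ordinal hjN)) //= re_add.
  rewrite (term (Ordinal hjN)) /= ejj ltn_ord vj uj /=.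
  apply: (Rle_trans _ (b2r true + 0)); first by rewrite /b2r /=; lra.
  apply: Rplus_le_compat_l.
  apply: (big_ind (fun z => (0 <= re z)%Re)) => [|x y hx hy|k _].
    by change (0 <= 0)%Re; lra.
    by rewrite re_add; lra.
  rewrite term; change (Rle R0 (b2r [&& (2 ^ L - k) %% 2 ^ L < m, v ((2 ^ L - k) %% 2 ^ L) & u (s + i + (2 ^ L - k) %% 2 ^ L)])); rewrite /b2r; case: (_ && _) => /=; lra.
- rewrite /C /cyc big1 // => k _; rewrite term.
  case: andP => // -[h1 /andP[h2 h3]]; case/existsP: h.
  by exists (Ordinal h1); rewrite /= h2 h3.
Qed.

Lemma IZR_pow2 l : IZR (Z.of_nat (2 ^ l)) = (2 ^ l)%Re.
Proof.
elim: l => [|l IH] //; rewrite expnS.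
have -> : Z.of_nat (2 * 2 ^ l) = (2 * Z.of_nat (2 ^ l))%Z by lia.
by rewrite mult_IZR IH.
Qed.

(** * Specifications of the transforms and of the blockwise convolution *)

Section Specs.

Variables (w : nat) (G : gpm) (tape : seq nat) (lim : Z) (L : nat) (q : Z).
Hypothesis L0 : 0 < L.
Hypothesis lim_N : (Z.of_nat (2 ^ L) <= lim)%Z.
Hypothesis lim_W : (lim <= W w)%Z.
Hypothesis W_big : (2 * (q * q * q) <= W w)%Z.
Hypothesis q_gt0 : (0 < q)%Z.
Hypothesis q_big : (IZR (Z.of_nat (2 ^ L)) ^ 32 <= IZR q)%Re.

Notation wpc := (wp w G tape lim).
Notation N := (2 ^ L).

Lemma scaled_div e : ((e + q * q * q) / q - q * q = e / q)%Z.
Proof. rewrite Z.div_add; [ring | move: q_gt0; lia]. Qed.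

Lemma q_word : is_word w q /\ (q <= q * q * q)%Z.
Proof.
move: q_gt0 W_big; rewrite /is_word; move: (W w) => WW; clear=> q0 h.
have h1 : (q <= q * q)%Z by nia.
have h2 : (q * q <= q * q * q)%Z by nia.
by split; lia.
Qed.

Lemma apx_arr_word (e : Z) : (- (q * q * q) < e < q * q * q)%Z -> is_word w (e + q * q * q).
Proof. by move: W_big; rewrite /is_word; lia. Qed.

Lemma fft_body_spec (h n b i j : nat) (x y t u : Z) st k (Q : store -> nat -> Prop) :
  b = n %/ h -> i = n + h * b -> j = i + h ->
  arr st aAR (Z.of_nat j) = x -> arr st aAI (Z.of_nat j) = y ->
  arr st aTR (Z.of_nat b) = t -> arr st aTI (Z.of_nat b) = u ->
  0 < h -> var st vq = Z.of_nat n -> var st vh = Z.of_nat h -> n < N -> j < N -> par q L st ->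
  (- (q * q * q) < x * t - y * u < q * q * q)%Z ->
  (- (q * q * q) < x * u + y * t < q * q * q)%Z ->
  (forall st' k',
    (forall a, arr st' aAR (Z.of_nat a) =
      if a == i then (arr st aAR (Z.of_nat i) + (x * t - y * u) / q)%Z
      else if a == j then (arr st aAR (Z.of_nat i) - (x * t - y * u) / q)%Z
      else arr st aAR (Z.of_nat a)) ->
    (forall a, arr st' aAI (Z.of_nat a) =
      if a == i then (arr st aAI (Z.of_nat i) + (x * u + y * t) / q)%Z
      else if a == j then (arr st aAI (Z.of_nat i) - (x * u + y * t) / q)%Z
      else arr st aAI (Z.of_nat a)) ->
    k' <= k + body_cost -> Q st' k') ->
  wpc fft_body Q st k.
Proof.
move=> b_ i_ j_ x_ y_ t_ u_ h0 eq eh hn hj [_ _ _ pQ pQ2 pQ3 _] s1 s2 post.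
have eb : (Z.of_nat n / Z.of_nat h = Z.of_nat b)%Z by rewrite b_ -of_nat_divn.
have ei : (Z.of_nat n + Z.of_nat h * Z.of_nat b = Z.of_nat i)%Z by rewrite i_; clear; lia.
have ej : (Z.of_nat i + Z.of_nat h = Z.of_nat j)%Z by rewrite j_; clear; lia.
have bj : b <= i by rewrite i_; apply: leq_trans (leq_pmull _ h0) (leq_addl _ _).
rewrite /fft_body; wpsimpl st; rewrite ?(eq, eh, pQ, pQ2, pQ3, eb, ei, ej) ?(x_, y_, t_, u_).
move: (expn_gt0 2 L) lim_N lim_W q_word q_gt0; rewrite /= => N0 limN limW [qw _] q0.
rewrite !scaled_div; have neq : (i == j) = false by apply/eqP; move: h0; rewrite j_; clear; lia.
have ibj : i < N by move: hj; rewrite j_; clear; lia.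
have hNw : (Z.of_nat N <= W w)%Z by lia.
vc; try (by rewrite /is_word; lia); try (by apply: apx_arr_word); try by [].
apply: post => [a|a|] /=; last by rewrite -!addnA leq_add2l.
- have -> : Z.eqb (Z.of_nat a) (Z.of_nat i) = (a == i) by lia.
  by have -> : Z.eqb (Z.of_nat a) (Z.of_nat j) = (a == j) by lia.
- have -> : Z.eqb (Z.of_nat a) (Z.of_nat i) = (a == i) by lia.
  by have -> : Z.eqb (Z.of_nat a) (Z.of_nat j) = (a == j) by lia.
Qed.

Lemma ifft_body_spec (h n b i j : nat) (x y t u : Z) st k (Q : store -> nat -> Prop) :
  b = n %/ h -> i = n + h * b -> j = i + h ->
  (arr st aAR (Z.of_nat i) - arr st aAR (Z.of_nat j))%Z = x ->
  (arr st aAI (Z.of_nat i) - arr st aAI (Z.of_nat j))%Z = y ->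
  arr st aTR (Z.of_nat b) = t -> (- arr st aTI (Z.of_nat b))%Z = u ->
  0 < h -> var st vq = Z.of_nat n -> var st vh = Z.of_nat h -> n < N -> j < N -> par q L st ->
  (- (q * q * q) < x * t - y * u < q * q * q)%Z ->
  (- (q * q * q) < x * u + y * t < q * q * q)%Z ->
  (forall st' k',
    (forall a, arr st' aAR (Z.of_nat a) =
      if a == i then (arr st aAR (Z.of_nat i) + arr st aAR (Z.of_nat j))%Z
      else if a == j then ((x * t - y * u) / q)%Z
      else arr st aAR (Z.of_nat a)) ->
    (forall a, arr st' aAI (Z.of_nat a) =
      if a == i then (arr st aAI (Z.of_nat i) + arr st aAI (Z.of_nat j))%Z
      else if a == j then ((x * u + y * t) / q)%Z
      else arr st aAI (Z.of_nat a)) ->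
    k' <= k + body_cost -> Q st' k') ->
  wpc ifft_body Q st k.
Proof.
move=> b_ i_ j_ x_ y_ t_ u_ h0 eq eh hn hj [_ _ _ pQ pQ2 pQ3 _] s1 s2 post.
have eb : (Z.of_nat n / Z.of_nat h = Z.of_nat b)%Z by rewrite b_ -of_nat_divn.
have ei : (Z.of_nat n + Z.of_nat h * Z.of_nat b = Z.of_nat i)%Z by rewrite i_; clear; lia.
have ej : (Z.of_nat i + Z.of_nat h = Z.of_nat j)%Z by rewrite j_; clear; lia.
have bj : b <= i by rewrite i_; apply: leq_trans (leq_pmull _ h0) (leq_addl _ _).
rewrite /ifft_body; wpsimpl st; rewrite ?(eq, eh, pQ, pQ2, pQ3, eb, ei, ej).
have e00 : (Z.of_nat 0 - arr st 1 (Z.of_nat b))%Z = (- arr st 1 (Z.of_nat b))%Z by lia.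
rewrite ?e00.
rewrite ?(x_, y_, t_, u_).
move: (expn_gt0 2 L) lim_N lim_W q_word q_gt0; rewrite /= => N0 limN limW [qw _] q0.
rewrite !scaled_div; have neq : (i == j) = false by apply/eqP; move: h0; rewrite j_; clear; lia.
have ibj : i < N by move: hj; rewrite j_; clear; lia.
have hNw : (Z.of_nat N <= W w)%Z by lia.
vc; try (by rewrite /is_word; lia); try (by apply: apx_arr_word); try by [].
apply: post => [a|a|] /=; last by rewrite -!addnA leq_add2l.
- have -> : Z.eqb (Z.of_nat a) (Z.of_nat i) = (a == i) by lia.
  have -> : Z.eqb (Z.of_nat a) (Z.of_nat j) = (a == j) by lia.
  by case: (eqVneq a j) => [->|//]; rewrite eq_sym neq.
- have -> : Z.eqb (Z.of_nat a) (Z.of_nat i) = (a == i) by lia.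
  have -> : Z.eqb (Z.of_nat a) (Z.of_nat j) = (a == j) by lia.
  by case: (eqVneq a j) => [->|//]; rewrite eq_sym neq.
Qed.

Lemma N_word a : a <= N -> a < 2 ^ w.
Proof.
move=> ha; have [h1 h2] := q_word; have hW : Z.of_nat (2 ^ w) = W w by [].
have hq : (Z.of_nat N <= q)%Z.
  apply: le_IZR; apply: Rle_trans q_big.
  have : (1 <= IZR (Z.of_nat N))%Re by apply: (IZR_le 1); have := expn_gt0 2 L; lia.
  move: (IZR (Z.of_nat N)) => z hz; have := pow_R1_Rle z 31 hz.
  by rewrite [pow z 32]/= -/(pow z 31); nra.
by move: W_big h2 hW q_gt0 hq ha; clear; lia.
Qed.



(** The level works in place: after [n] butterflies the positions with [slot] below [n] hold new
    values and the others still hold old ones, and a butterfly touches exactly its own two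
    positions. *)
Lemma fft_level l M E X st k : l < L -> let h := 2 ^ (L - l.+1) in
  var st vh = Z.of_nat h -> par q L st -> good L q M E -> approximates L q M E st X ->
  wpc (For vq $vN2 fft_body) (fun st' k' =>
    approximates L q (4 * M)%Re (8 * E)%Re st' (fwd tw h X) /\ k' <= k + N * (body_cost + 10) + 8) st k.
Proof.
move=> hl h hh hpar hg hap.
have h0 : 0 < h by rewrite expn_gt0.
have eN : N = 2 * h * 2 ^ l by rewrite -expnS -expnD; congr expn; move: hl; clear; lia.
have eN2 : 2 ^ L.-1 = h * 2 ^ l by rewrite -expnD; congr expn; move: hl; clear; lia.
have t1 := tau_ge1 L; have [gM gE gt gq gB _] := hg.
have tq : (tau L <= IZR q)%Re by nra.
apply: (wp_for_simple (n := 2 ^ L.-1) (T := body_cost) (I := fun n s => forall a, a < N ->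
   if slot h a < n then apx (IZR q) (4 * M)%Re (8 * E)%Re (arr s aAR (Z.of_nat a)) (arr s aAI (Z.of_nat a)) (fwd tw h X a)
   else apx (IZR q) M E (arr s aAR (Z.of_nat a)) (arr s aAI (Z.of_nat a)) (X a))).
- exact: I.
- by rewrite /= (par_N2 hpar).
- by apply: N_word => //; rewrite leq_exp2l // leq_pred.
- by [].
- by move=> a ha; exact: hap.
- move=> n s k' hn hI fr.
  have [o1 o2 d1 d2 sl] := butterfly n h0.
  set i := n + h * (n %/ h) in o1 o2 d1 d2 sl.
  have jN : i + h < N.
    have : n %/ h < 2 ^ l by rewrite ltn_divLR // mulnC -eN2.
    by have := ltn_pmod n h0; have := divn_eq n h; rewrite /i eN; clear; nia.
  have iN : i < N by move: jN; clear; lia.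
  have bN : n %/ h < N.
    by apply: leq_ltn_trans iN; apply: leq_trans (leq_pmull _ h0) (leq_addl _ _).
  have hpar' := par_frame (c := For vq $vN2 fft_body) isT fr hpar.
  have Ii := hI i iN; have Ij := hI (i + h) jN.
  have /eqP si : slot h i == n by rewrite sl eqxx.
  have /eqP sj : slot h (i + h) == n by rewrite sl eqxx orbT.
  rewrite si ltnn in Ii; rewrite sj ltnn in Ij.
  have Tb := par_tw hpar' bN.
  have [s1 s2] := apx_product_size q_gt0 Ij Tb gq tq (Rle_refl M) gM ltac:(nra).
  have M0 : (0 <= M)%Re by lra.
  have [f1 f2] := apx_fwd q_gt0 gE M0 gt tq Ii Ij Tb.
  refine (fft_body_spec (h := h) (n := n) (st := setv s vq (Z.of_nat n)) erefl erefl erefl erefl erefl erefl erefl h0 _ _ _ jN _ s1 s2 _) => //.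
  + by rewrite /=; case: fr => fv _ _ _; rewrite fv.
  + by apply: leq_trans hn _; rewrite leq_exp2l // leq_pred.
  + case: hpar' => *; by split.
  move=> st' k2 e1 e2 hk; split; last by move: hk; clear; lia.
  move=> a ha; rewrite e1 e2 /= ltnS leq_eqVlt sl.
  case: (eqVneq a i) => [->|nai] /=; first by rewrite /fwd o1 d1.
  case: (eqVneq a (i + h)) => [->|naj] /=; first by rewrite /fwd o2 d2 addnK.
  exact: hI.
- move=> s k' hI fr hk; split; last first.
    have : 2 ^ L.-1 <= N by rewrite leq_exp2l // leq_pred.
    by move: hk; move: (2 ^ _) (2 ^ _) => a b; clear; nia.
  move=> a ha; have := hI a ha; rewrite /=.
  have -> : slot h a < 2 ^ L.-1; last by [].
  rewrite /slot eN2; have : a %/ (2 * h) < 2 ^ l by rewrite ltn_divLR ?muln_gt0 // mulnC -eN.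
  by have := ltn_pmod a h0; clear; nia.
Qed.

Lemma ifft_level l M E X st k : l < L -> let h := 2 ^ l in
  var st vh = Z.of_nat h -> par q L st -> good L q M E -> approximates L q M E st X ->
  wpc (For vq $vN2 ifft_body) (fun st' k' =>
    approximates L q (4 * M)%Re (16 * E)%Re st' (bwd conj_tw h X) /\
    k' <= k + N * (body_cost + 10) + 8) st k.
Proof.
move=> hl h hh hpar hg hap.
have h0 : 0 < h by rewrite expn_gt0.
have eN : N = 2 * h * 2 ^ (L - l.+1) by rewrite -expnS -expnD; congr expn; move: hl; clear; lia.
have eN2 : 2 ^ L.-1 = h * 2 ^ (L - l.+1) by rewrite -expnD; congr expn; move: hl; clear; lia.
have t1 := tau_ge1 L; have [gM gE gt gq gB g2] := hg.
have tq : (tau L <= IZR q)%Re by nra.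
apply: (wp_for_simple (n := 2 ^ L.-1) (T := body_cost) (I := fun n s => forall a, a < N ->
   if slot h a < n then apx (IZR q) (4 * M)%Re (16 * E)%Re (arr s aAR (Z.of_nat a)) (arr s aAI (Z.of_nat a)) (bwd conj_tw h X a)
   else apx (IZR q) M E (arr s aAR (Z.of_nat a)) (arr s aAI (Z.of_nat a)) (X a))).
- exact: I.
- by rewrite /= (par_N2 hpar).
- by apply: N_word => //; rewrite leq_exp2l // leq_pred.
- by [].
- by move=> a ha; exact: hap.
- move=> n s k' hn hI fr.
  have [o1 o2 d1 d2 sl] := butterfly n h0.
  set i := n + h * (n %/ h) in o1 o2 d1 d2 sl.
  have jN : i + h < N.
    have : n %/ h < 2 ^ (L - l.+1) by rewrite ltn_divLR // mulnC -eN2.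
    by have := ltn_pmod n h0; have := divn_eq n h; rewrite /i eN; clear; nia.
  have iN : i < N by move: jN; clear; lia.
  have bN : n %/ h < N.
    by apply: leq_ltn_trans iN; apply: leq_trans (leq_pmull _ h0) (leq_addl _ _).
  have hpar' := par_frame (c := For vq $vN2 ifft_body) isT fr hpar.
  have Ii := hI i iN; have Ij := hI (i + h) jN.
  have /eqP si : slot h i == n by rewrite sl eqxx.
  have /eqP sj : slot h (i + h) == n by rewrite sl eqxx orbT.
  rewrite si ltnn in Ii; rewrite sj ltnn in Ij.
  have Tb := par_tw hpar' bN.
  have [s1 s2] := apx_product_size (B := (2 * M)%Re) q_gt0 (apx_sub Ii Ij) (apx_conj Tb)
    ltac:(lra) tq ltac:(lra) ltac:(lra) gB.
  have M0 : (0 <= M)%Re by lra.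
  have [f1 f2] := apx_bwd q_gt0 gE M0 gt tq Ii Ij Tb.
  refine (ifft_body_spec (h := h) (n := n) (st := setv s vq (Z.of_nat n)) erefl erefl erefl erefl erefl erefl erefl h0 _ _ _ jN _ s1 s2 _) => //.
  + by rewrite /=; case: fr => fv _ _ _; rewrite fv.
  + by apply: leq_trans hn _; rewrite leq_exp2l // leq_pred.
  + case: hpar' => *; by split.
  move=> st' k2 e1 e2 hk; split; last by move: hk; clear; lia.
  move=> a ha; rewrite e1 e2 /= ltnS leq_eqVlt sl.
  case: (eqVneq a i) => [->|nai] /=; first by rewrite /bwd o1.
  case: (eqVneq a (i + h)) => [->|naj] /=; first by rewrite /bwd o2 d2 addnK.
  exact: hI.
- move=> s k' hI fr hk; split; last first.
    have : 2 ^ L.-1 <= N by rewrite leq_exp2l // leq_pred.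
    by move: hk; move: (2 ^ _) (2 ^ _) => a b; clear; nia.
  move=> a ha; have := hI a ha; rewrite /=.
  have -> : slot h a < 2 ^ L.-1; last by [].
  rewrite /slot eN2; have : a %/ (2 * h) < 2 ^ (L - l.+1) by rewrite ltn_divLR ?muln_gt0 // mulnC -eN.
  by have := ltn_pmod a h0; clear; nia.
Qed.

Lemma rN_ge2 : (2 <= rN L)%Re.
Proof.
rewrite /rN IZR_pow2; case: L L0 => // l _ /=.
by have := pow_R1_Rle 2 l; lra.
Qed.

Lemma pow_rN c l : l <= L -> ((2 ^ c) ^ l <= rN L ^ c)%Re.
Proof.
move=> hl; rewrite /rN IZR_pow2 -!pow_mult; apply: Rle_pow; first lra.
by move/leP: hl => hl; rewrite Nat.mul_comm; apply: Nat.mul_le_mono_r.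
Qed.

(** Since N >= 2, a constant up to 2^b costs at most [b] powers of N. The most demanding use is 128
    N^12; the exponent 32 is what five squarings of N provide. *)
Lemma rN_le_q c b a : (c <= 2 ^ b)%Re -> a + b <= 32 -> (c * rN L ^ a <= IZR q)%Re.
Proof.
move=> hc hab; have N2 := rN_ge2.
apply: Rle_trans q_big; rewrite -/(rN L).
have -> : 32 = (a + b) + (32 - (a + b)) by lia.
rewrite !pow_add; move: (32 - (a + b)) => e.
have h1 : (1 <= rN L ^ e)%Re by apply: pow_R1_Rle; lra.
have h2 : (2 ^ b <= rN L ^ b)%Re by apply: pow_incr; lra.
have h3 : (0 < rN L ^ a)%Re by apply: pow_lt; lra.
have h4 : (0 < 2 ^ b)%Re by apply: pow_lt; lra.
have h5 : (c * rN L ^ a <= rN L ^ b * rN L ^ a)%Re by apply: Rmult_le_compat_r; lra.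
have h6 : (0 <= rN L ^ b * rN L ^ a)%Re by apply: Rmult_le_pos; lra.
nra.
Qed.

Lemma good_fwd l : l <= L -> good L q (4 ^ l)%Re (tau L * 8 ^ l)%Re.
Proof.
move=> hl; have N2 := rN_ge2; have t1 := tau_ge1 L.
have m1 : (1 <= 4 ^ l)%Re by apply: pow_R1_Rle; lra.
have m2 : (4 ^ l <= 8 ^ l)%Re by apply: pow_incr; lra.
have m3 : (4 ^ l <= rN L ^ 2)%Re by have := pow_rN 2 hl; have -> : (2 ^ 2 = 4)%Re by ring.
have m4 : (8 ^ l <= rN L ^ 3)%Re by have := pow_rN 3 hl; have -> : (2 ^ 3 = 8)%Re by ring.
have m5 : (8 ^ L <= rN L ^ 3)%Re by have := pow_rN 3 (leqnn L); have -> : (2 ^ 3 = 8)%Re by ring.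
have b1 : (16 * rN L ^ 6 <= IZR q)%Re by apply: (@rN_le_q _ 4) => //; lra.
have b2 : (32 * rN L ^ 4 <= IZR q)%Re by apply: (@rN_le_q _ 5) => //; lra.
have E6 : (rN L ^ 3 * rN L ^ 3 = rN L ^ 6)%Re by ring.
have E4 : (rN L ^ 2 * rN L ^ 2 = rN L ^ 4)%Re by ring.
have P2 : (1 <= rN L ^ 2)%Re by apply: pow_R1_Rle; lra.
have P4 : (0 < rN L ^ 4)%Re by apply: pow_lt; lra.
have e1 : (tau L * 8 ^ l <= 8 * rN L ^ 6)%Re.
  rewrite -E6 /tau Rmult_assoc; apply: Rmult_le_compat_l; first lra.
  by apply: Rmult_le_compat => //; apply/Rlt_le/pow_lt; lra.
have s1 : (4 ^ l * 4 ^ l <= rN L ^ 4)%Re by rewrite -E4; apply: Rmult_le_compat; lra.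
have s2 : (rN L ^ 2 <= rN L ^ 4)%Re by rewrite -E4; nra.
split; try nra.
Qed.

(** The bounds at l = 0 are those of the pointwise product of two spectra of size 4^L = N^2 and
    error 8 N^6: size 2 N^4, and error 7 N^2 times 8 N^6. *)
Lemma good_bwd l : l <= L -> good L q (2 * rN L ^ 4 * 4 ^ l)%Re (56 * rN L ^ 8 * 16 ^ l)%Re.
Proof.
move=> hl; have N2 := rN_ge2.
have m1 : (1 <= 4 ^ l)%Re by apply: pow_R1_Rle; lra.
have m2 : (4 ^ l <= 16 ^ l)%Re by apply: pow_incr; lra.
have m3 : (4 ^ l <= rN L ^ 2)%Re by have := pow_rN 2 hl; have -> : (2 ^ 2 = 4)%Re by ring.
have m4 : (16 ^ l <= rN L ^ 4)%Re by have := pow_rN 4 hl; have -> : (2 ^ 4 = 16)%Re by ring.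
have m5 : (8 ^ L <= rN L ^ 3)%Re by have := pow_rN 3 (leqnn L); have -> : (2 ^ 3 = 8)%Re by ring.
have b1 : (128 * rN L ^ 12 <= IZR q)%Re by apply: (@rN_le_q _ 7) => //; lra.
have P8 : (1 <= rN L ^ 8)%Re by apply: pow_R1_Rle; lra.
have P4 : (1 <= rN L ^ 4)%Re by apply: pow_R1_Rle; lra.
have P6 : (1 <= rN L ^ 6)%Re by apply: pow_R1_Rle; lra.
have E12 : (rN L ^ 8 * rN L ^ 4 = rN L ^ 12)%Re by ring.
have E6 : (rN L ^ 4 * rN L ^ 2 = rN L ^ 6)%Re by ring.
have F12 : (rN L ^ 6 * rN L ^ 6 = rN L ^ 12)%Re by ring.
have E7 : (rN L ^ 4 * rN L ^ 3 = rN L ^ 7)%Re by ring.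
have E8 : (rN L ^ 7 <= rN L ^ 8)%Re by apply: Rle_pow; [lra | lia].
have e1 : (rN L ^ 8 * 16 ^ l <= rN L ^ 12)%Re by rewrite -E12; apply: Rmult_le_compat_l; lra.
have e2 : (rN L ^ 4 * 4 ^ l <= rN L ^ 6)%Re by rewrite -E6; apply: Rmult_le_compat_l; lra.
have e3 : (rN L ^ 4 * 8 ^ L <= rN L ^ 8)%Re.
  by apply: Rle_trans E8; rewrite -E7; apply: Rmult_le_compat_l; lra.
have e4 : (rN L ^ 4 * 8 ^ L * 4 ^ l <= rN L ^ 8 * 16 ^ l)%Re.
  apply: Rmult_le_compat; try lra; apply: Rmult_le_pos; try lra.
  by apply/Rlt_le/pow_lt; lra.
have e5 : (1 <= rN L ^ 4 * 4 ^ l)%Re by nra.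
have e6 : (1 <= rN L ^ 8 * 16 ^ l)%Re by nra.
have e7 : (rN L ^ 4 * 4 ^ l * (rN L ^ 4 * 4 ^ l) <= rN L ^ 12)%Re.
  by rewrite -F12; apply: Rmult_le_compat; lra.
split; rewrite /tau; try nra.
Qed.

Lemma two_word : is_word w 2.
Proof.
have h1 : 2 <= N by rewrite -{1}(expn1 2) leq_exp2l.
have h2 : N < 2 ^ w by apply: N_word.
by rewrite /is_word /Language.W; move: h1 h2; clear; lia.
Qed.

Lemma pow2_word l : l <= L -> is_word w (Z.of_nat (2 ^ l)).
Proof.
move=> hl; have : 2 ^ l < 2 ^ w by apply: N_word => //; rewrite leq_exp2l.
by rewrite /is_word /Language.W; clear; lia.
Qed.

Lemma fft_spec X st k : par q L st -> approximates L q 1 (tau L) st X ->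
  wpc fft (fun st' k' => approximates L q (4 ^ L)%Re (tau L * 8 ^ L)%Re st' (lev tw L X L) /\
    k' <= k + L * (N * (body_cost + 10) + 50) + 50) st k.
Proof.
move=> hpar hap; split; first by [].
apply: (wp_for_simple (n := L) (T := N * (body_cost + 10) + 20) (I := fun l s =>
  var s vh = Z.of_nat (2 ^ (L - l)) /\ approximates L q (4 ^ l)%Re (tau L * 8 ^ l)%Re s (lev tw L X l))).
- exact: I.
- by rewrite /= (par_L hpar).
- by apply: N_word => //; apply: ltnW; apply: ltn_expl.
- by [].
- by rewrite subn0 /= (par_N hpar) !Rmult_1_r; split.
- move=> l s k' hl [hh hI] fr.
  have hp1 : par q L s.
    by refine (par_frame _ fr _) => //; case: hpar => *; split.
  have e2 : (Z.of_nat (2 ^ (L - l)) / 2 = Z.of_nat (2 ^ (L - l.+1)))%Z.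
    have -> : (L - l) = (L - l.+1).+1 by move: hl; clear; lia.
    by rewrite expnS -(of_nat_divn _ (isT : 0 < 2)) mulKn.
  split.
    rewrite /= hh; vc => //; first by apply: pow2_word; rewrite leq_subr.
    exact: two_word.
  set s1 := setv _ vh _.
  have hp2 : par q L s1 by case: hp1 => *; split.
  have hv1 : var s1 vh = Z.of_nat (2 ^ (L - l.+1)) by rewrite /s1 /= hh e2.
  have hI1 : approximates L q (4 ^ l)%Re (tau L * 8 ^ l)%Re s1 (lev tw L X l) by [].
  eapply wp_use.
    exact (fft_level _ hl hv1 hp2 (good_fwd (ltnW hl)) hI1).
  move=> s2 k2 [ha hk] [fv _ _ _]; split; last first.
    move: hk; rewrite [code_size _]/=; move: (N * _) => u; clear; lia.
  split; first by rewrite fv.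
  by move=> a /ha; apply: apx_le; rewrite /=; lra.
- move=> s k' [_ hI] fr hk; split.
    by move=> a ha; have := hI a ha.
  move: hk; rewrite [code_size _]/=; move: (N * _) => u; clear; nia.
Qed.

Lemma ifft_spec P st k : par q L st ->
  approximates L q (2 * rN L ^ 4)%Re (56 * rN L ^ 8)%Re st P ->
  wpc ifft (fun st' k' =>
    approximates L q (2 * rN L ^ 4 * 4 ^ L)%Re (56 * rN L ^ 8 * 16 ^ L)%Re st' (unlev conj_tw P L) /\
    k' <= k + L * (N * (body_cost + 10) + 50) + 50) st k.
Proof.
move=> hpar hap; split; first by [].
apply: (wp_for_simple (n := L) (T := N * (body_cost + 10) + 20) (I := fun l s =>
  var s vh = Z.of_nat (2 ^ l) /\
  approximates L q (2 * rN L ^ 4 * 4 ^ l)%Re (56 * rN L ^ 8 * 16 ^ l)%Re s (unlev conj_tw P l))).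
- exact: I.
- by rewrite /= (par_L hpar).
- by apply: N_word => //; apply: ltnW; apply: ltn_expl.
- by [].
- have -> : (2 * rN L ^ 4 * 4 ^ 0 = 2 * rN L ^ 4)%Re by ring.
  by have -> : (56 * rN L ^ 8 * 16 ^ 0 = 56 * rN L ^ 8)%Re by ring.
- move=> l s k' hl [hh hI] fr.
  have hp1 : par q L s.
    by refine (par_frame _ fr _) => //; case: hpar => *; split.
  set s1 := setv _ _ _.
  have hp2 : par q L s1 by case: hp1 => *; split.
  have hv1 : var s1 vh = Z.of_nat (2 ^ l) by [].
  have hI1 : approximates L q (2 * rN L ^ 4 * 4 ^ l)%Re (56 * rN L ^ 8 * 16 ^ l)%Re s1 (unlev conj_tw P l) by [].
  apply: wp_seq; eapply wp_use.
    exact (ifft_level _ hl hv1 hp2 (good_bwd (ltnW hl)) hI1).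
  move=> s2 k2 [ha hk] [fv _ _ _]; split; first by [].
  split; last by move: hk; rewrite [code_size _]/=; move: (N * _) => u; clear; lia.
  split; first by rewrite /= fv // hv1 expnS; move: (2 ^ l) => u; clear; lia.
  by move=> a /ha; apply: apx_le; rewrite /=; lra.
- move=> s k' [_ hI] fr hk; split.
    by move=> a ha; have := hI a ha.
  move: hk; rewrite [code_size _]/=; move: (N * _) => u; clear; nia.
Qed.

Notation n := (text_len G).
Notation m := (pat_len G).
Hypothesis m0 : 0 < m.
Hypothesis hm : 2 * m <= N.
Hypothesis lim_U : (Z.of_nat (n + N) <= lim)%Z.

Lemma hN a : a <= N -> a < 2 ^ w.
Proof. by apply: N_word. Qed.

(** Common invariant of the loops that overwrite the work array position by position: positions
    still to be visited keep their initial contents, which [multiply] reads. *)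
Lemma fill_spec body M E X st k : stable_bound vq $vN body -> par q L st ->
  (forall i s k', i < N -> frame (For vq $vN body) st s ->
     arr s aAR (Z.of_nat i) = arr st aAR (Z.of_nat i) ->
     arr s aAI (Z.of_nat i) = arr st aAI (Z.of_nat i) ->
     wpc body (fun s2 k2 =>
       [/\ apx (IZR q) M E (arr s2 aAR (Z.of_nat i)) (arr s2 aAI (Z.of_nat i)) (X i),
         forall a, a != i -> arr s2 aAR (Z.of_nat a) = arr s aAR (Z.of_nat a) /\
                             arr s2 aAI (Z.of_nat a) = arr s aAI (Z.of_nat a)
       & k2 <= k' + body_cost]) (setv s vq (Z.of_nat i)) k') ->
  wpc (For vq $vN body) (fun st' k' => approximates L q M E st' X /\
    k' <= k + N * (body_cost + 10) + 8) st k.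
Proof.
move=> hs hpar hbody.
apply: (wp_for_simple (n := N) (T := body_cost) (I := fun i s =>
  (forall a, a < i -> apx (IZR q) M E (arr s aAR (Z.of_nat a)) (arr s aAI (Z.of_nat a)) (X a)) /\
  (forall a, i <= a -> arr s aAR (Z.of_nat a) = arr st aAR (Z.of_nat a) /\
                       arr s aAI (Z.of_nat a) = arr st aAI (Z.of_nat a)))).
- exact: I.
- by rewrite /= (par_N hpar).
- exact: hN.
- by [].
- by split.
- move=> i s k' hi [h1 h2] fr; have [e1 e2] := h2 i (leqnn i).
  apply: wp_mono (hbody i s k' hi fr e1 e2) => s2 k2 [g1 g2 g3]; split=> //; split.
    move=> a; rewrite ltnS leq_eqVlt => /orP[/eqP ->|ha] //.
    have ne : a != i by move: ha; clear; lia.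
    by have [-> ->] := g2 a ne; apply: h1.
  move=> a ha; have ne : a != i by move: ha; clear; lia.
  by have [-> ->] := g2 a ne; apply: h2; apply: ltnW.
- by move=> s k' [h1 _] fr hk; split.
Qed.

Lemma apx_bit (b : bool) : apx (IZR q) 1 (tau L) (Z.b2z b * q) 0 (Complex (b2r b) 0%Re).
Proof.
have t1 := tau_ge1 L; apply: apx_le (apx_exact _ _); try lra.
  by apply: IZR_le; move: q_gt0; lia.
by case: b => /=; rewrite ?Rabs_R1 ?Rabs_R0; lra.
Qed.

Lemma fill_pattern_spec v st k : par q L st ->
  (forall j, j < m -> arr st aV (Z.of_nat j) = Z.b2z (v j)) ->
  wpc fill_pattern (fun st' k' => approximates L q 1 (tau L) st' (kernel L m v) /\
    k' <= k + N * (body_cost + 10) + 8) st k.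
Proof.
move=> hpar hv; apply: fill_spec => // i s k' hi fr _ _.
have hpar' : par q L s by refine (par_frame _ fr _).
have hv' j : j < m -> arr s aV (Z.of_nat j) = Z.b2z (v j).
  by case: fr => _ fa _ _ hj; rewrite fa // hv.
case: hpar' => pN _ _ pQ _ _ _.
have N0 : 0 < N by rewrite expn_gt0.
have wm : m < 2 ^ w by apply: hN; move: hm; clear; lia.
have wN := hN (leqnn N).
have ej : ((Z.of_nat N - Z.of_nat i) mod Z.of_nat N = Z.of_nat ((N - i) %% N))%Z.
  by rewrite of_nat_modn //; congr Z.modulo; move: hi; clear; lia.
have hj : (N - i) %% N < N by rewrite ltn_pmod.
wpsimpl s; rewrite ?(pN, pQ) ?ej /kernel; move: ((N - i) %% N) hj => j hj.
have iw z : z < 2 ^ w -> is_word w (Z.of_nat z) by rewrite /is_word /Language.W; clear; lia.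
have hjw : j < 2 ^ w by apply: hN; apply: ltnW.
vc; try by [].
- by rewrite /is_word /Language.W; move: hi wN; clear; lia.
- exact: iw.
- by move: N0; clear; lia.
- exact: iw.
- exact: iw.
have -> : Z.ltb (Z.of_nat j) (Z.of_nat m) = (j < m) by clear; lia.
have li : (0 <= Z.of_nat i < lim)%Z by move: hi lim_N; clear; lia.
case: ifP => hjm; vc; try by []; try lia.
- rewrite hjm; split; rewrite /= ?Z.eqb_refl ?hv' //; first exact: apx_bit.
    by move=> a /eqP ha; have -> : Z.eqb (Z.of_nat a) (Z.of_nat i) = false by lia.
  by rewrite -!addnA leq_add2l.
- rewrite hjm; split; rewrite /= ?Z.eqb_refl //; first exact: (apx_bit false).
    by move=> a /eqP ha; have -> : Z.eqb (Z.of_nat a) (Z.of_nat i) = false by lia.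
  by rewrite -!addnA leq_add2l.
Qed.

Lemma fill_text_spec (u : nat -> bool) s0 st k : par q L st -> s0 <= n ->
  var st vs = Z.of_nat s0 ->
  (forall j, j < n + N -> arr st aU (Z.of_nat j) = Z.b2z (u j)) ->
  wpc fill_text (fun st' k' => approximates L q 1 (tau L) st' (signal u s0) /\
    k' <= k + N * (body_cost + 10) + 8) st k.
Proof.
move=> hpar hs0 hvs hu; apply: fill_spec => // i s k' hi fr _ _.
have hpar' : par q L s by refine (par_frame _ fr _).
have hu' j : j < n + N -> arr s aU (Z.of_nat j) = Z.b2z (u j).
  by case: fr => _ fa _ _ hj; rewrite fa // hu.
have hvs' : var s vs = Z.of_nat s0 by case: fr => fv _ _ _; rewrite fv.
case: hpar' => pN _ _ pQ _ _ _.
have ej : (Z.of_nat s0 + Z.of_nat i = Z.of_nat (s0 + i))%Z by clear; lia.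
have hsi : s0 + i < n + N by move: hi hs0; clear; lia.
wpsimpl s; rewrite ?(pN, pQ, hvs', ej).
vc; try by []; try (by move: hsi hi lim_U; clear; lia).
split; rewrite /= ?Z.eqb_refl ?hu' //; first exact: apx_bit.
  by move=> a /eqP ha; have -> : Z.eqb (Z.of_nat a) (Z.of_nat i) = false by lia.
by rewrite -!addnA leq_add2l.
Qed.

Lemma multiply_spec M E X Y st k : par q L st -> good L q M E ->
  approximates L q M E st X ->
  (forall a, a < N -> apx (IZR q) M E (arr st aBR (Z.of_nat a)) (arr st aBI (Z.of_nat a)) (Y a)) ->
  wpc multiply (fun st' k' => approximates L q (2 * M * M)%Re (7 * M * E)%Re st'
      (fun a => X a * Y a)%R /\ k' <= k + N * (body_cost + 10) + 8) st k.
Proof.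
move=> hpar hg hX hY; apply: fill_spec => // i s k' hi fr e1 e2.
have hpar' : par q L s by refine (par_frame _ fr _).
have := hY i hi; have := hX i hi; rewrite -e1 -e2.
have -> : arr st aBR (Z.of_nat i) = arr s aBR (Z.of_nat i) by case: fr => _ fa _ _; rewrite fa.
have -> : arr st aBI (Z.of_nat i) = arr s aBI (Z.of_nat i) by case: fr => _ fa _ _; rewrite fa.
move=> a1 a2; have [gM gE _ gq gB _] := hg.
have [s1 s2] := apx_product_size q_gt0 a1 a2 gq gq (Rle_refl M) (Rle_refl M) ltac:(nra).
have a3 := apx_square q_gt0 gE gM gq a1 a2.
case: hpar' => pN _ _ pQ pQ2 pQ3 _.
wpsimpl s; rewrite ?(pN, pQ, pQ2, pQ3) !scaled_div.
have [wq _] := q_word.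
vc; try by []; try exact: (apx_arr_word); try (by move: hi lim_N; clear; lia).
split; rewrite /= ?Z.eqb_refl //.
  by move=> a /eqP ha; have -> : Z.eqb (Z.of_nat a) (Z.of_nat i) = false by lia.
by rewrite -!addnA leq_add2l.
Qed.

Lemma copy_spectrum_spec st k : par q L st ->
  wpc copy_spectrum (fun st' k' => (forall a, a < N ->
      arr st' aBR (Z.of_nat a) = arr st aAR (Z.of_nat a) /\
      arr st' aBI (Z.of_nat a) = arr st aAI (Z.of_nat a)) /\
    k' <= k + N * (body_cost + 10) + 8) st k.
Proof.
move=> hpar.
apply: (wp_for_simple (n := N) (T := body_cost) (I := fun i s => forall a, a < i ->
      arr s aBR (Z.of_nat a) = arr st aAR (Z.of_nat a) /\
      arr s aBI (Z.of_nat a) = arr st aAI (Z.of_nat a))).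
- exact: I.
- by rewrite /= (par_N hpar).
- exact: hN.
- by [].
- by [].
- move=> i s k' hi hI [_ fa _ _].
  wpsimpl s; rewrite !fa //.
  vc; try by []; try (by move: hi lim_N; clear; lia); last by rewrite -!addnA leq_add2l.
  move=> a; rewrite ltnS leq_eqVlt => /orP[/eqP ->|ha] /=; first by rewrite Z.eqb_refl.
  have -> : Z.eqb (Z.of_nat a) (Z.of_nat i) = false by move: ha; clear; lia.
  exact: hI.
- by move=> s k' hI fr hk; split.
Qed.

Lemma mark_block_spec (b : nat -> bool) s0 st k : par q L st -> s0 + m <= n ->
  var st vs = Z.of_nat s0 ->
  (forall i, i < m -> (- (q * q * q) <= arr st aAR (Z.of_nat i) < q * q * q)%Z) ->
  (forall i, i < m -> Z.ltb (var st vN2 * q) (arr st aAR (Z.of_nat i)) = b i) ->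
  wpc mark_block (fun st' k' =>
    (forall p : nat, arr st' abad (Z.of_nat p) =
       if [&& s0 <= p, p < s0 + m & b (p - s0)] then 1%Z else arr st abad (Z.of_nat p)) /\
    k' <= k + m * (body_cost + 10) + 8) st k.
Proof.
move=> hpar hs0 hvs hrange hb.
have mw : m < 2 ^ w by apply: hN; move: hm; clear; lia.
apply: (wp_for_simple (n := m) (T := body_cost) (I := fun i s => forall p : nat,
   arr s abad (Z.of_nat p) =
       if [&& s0 <= p, p < s0 + i & b (p - s0)] then 1%Z else arr st abad (Z.of_nat p))).
- exact: I.
- by [].
- exact: mw.
- by [].
- by move=> p; case: ifP => // /and3P[h1 h2 _]; move: h1 h2; clear; lia.
- move=> i s k' hi hI [fv fa _ _].
  have ci : (- (q * q * q) <= arr s aAR (Z.of_nat i) < q * q * q)%Z by rewrite fa //; apply: hrange.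
  have bi : Z.ltb (var s vN2 * q) (arr s aAR (Z.of_nat i)) = b i by rewrite fa // fv //; apply: hb.
  have vs' : var s vs = Z.of_nat s0 by rewrite fv.
  have [wq q3] := q_word.
  have eN2 : var s vN2 = Z.of_nat (2 ^ L.-1) by rewrite fv // (par_N2 hpar).
  have eQ : var s vQ = q by rewrite fv // (par_Q hpar).
  have eQ3 : var s vQ3 = (q * q * q)%Z by rewrite fv // (par_Q3 hpar).
  have N2q : (0 <= Z.of_nat (2 ^ L.-1) * q < q * q * q)%Z.
    have h1 : (Z.of_nat N <= q)%Z.
      apply: le_IZR; apply: Rle_trans q_big; have := rN_ge2; rewrite -/(rN L) => h2.
      have := pow_R1_Rle (rN L) 31 ltac:(lra); move: (rN L) h2 => z hz.
      by rewrite [pow z 32]/= -/(pow z 31); nra.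
    have h2 : 2 * 2 ^ L.-1 = N by rewrite -expnS prednK.
    move: h1; rewrite -h2; move: (2 ^ L.-1) q_gt0 wq q3; clear; nia.
  wpsimpl s; rewrite ?(vs', eN2, eQ, eQ3).
  fold (arr st); vc; try by [].
  + by clear; lia.
  + by move: hi hm lim_N; clear; lia.
  + by move: W_big N2q; rewrite /is_word; clear; lia.
  + by move: W_big ci; rewrite /is_word; clear; lia.
  have -> : Z.ltb (Z.of_nat (2 ^ L.-1) * q + q * q * q) (arr s aAR (Z.of_nat i) + q * q * q) = b i.
    by rewrite -bi eN2; clear; lia.
  case: ifP => hbi; vc; try by [].
  + by clear; lia.
  + by move: hi hs0 lim_U; clear; lia.
  + move=> p /=; have -> : Z.eqb (Z.of_nat p) (Z.of_nat s0 + Z.of_nat i) = (p == s0 + i) by clear; lia.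
    case: eqP => [->|ne]; first by rewrite leq_addr addnS ltnSn addKn hbi.
    rewrite hI; congr (if _ then _ else _); move: ne; case: (b _); rewrite ?andbT ?andbF //.
    by clear; lia.
  + by rewrite -!addnA leq_add2l.
  + move=> p /=; rewrite hI; case: (eqVneq p (s0 + i)) => [->|ne].
      by rewrite addKn hbi !andbF.
    congr (if _ then _ else _); move: ne; case: (b _); rewrite ?andbT ?andbF //.
    by clear; lia.
  + by rewrite -!addnA leq_add2l.
- by move=> s k' hI fr hk; split.
Qed.

(** The accumulated error is at most 56 N^12, less than q / 2, while the exact values are 0 or at
    least N q with N >= 2, on either side of N q / 2. *)
Lemma threshold C a b : apx (IZR q) (2 * rN L ^ 4 * 4 ^ L)%Re (56 * rN L ^ 8 * 16 ^ L)%Re a b (C *+ N)%R ->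
  (- (q * q * q) <= a < q * q * q)%Z /\
  ((1 <= re C)%Re -> Z.ltb (Z.of_nat (2 ^ L.-1) * q) a) /\
  (re C = 0%Re -> Z.ltb (Z.of_nat (2 ^ L.-1) * q) a = false).
Proof.
move=> h; have N2 := rN_ge2; have q0 := IZR_lt _ _ q_gt0.
have [gM gE _ _ gB _] := good_bwd (leqnn L).
have m4 : (16 ^ L <= rN L ^ 4)%Re.
  by have := pow_rN 4 (leqnn L); have -> : (2 ^ 4 = 16)%Re by ring.
have b1 : (128 * rN L ^ 12 <= IZR q)%Re by apply: (@rN_le_q _ 7) => //; lra.
have E12 : (rN L ^ 8 * rN L ^ 4 = rN L ^ 12)%Re by ring.
have P8 : (1 <= rN L ^ 8)%Re by apply: pow_R1_Rle; lra.
have e1 : (rN L ^ 8 * 16 ^ L <= rN L ^ 12)%Re by rewrite -E12; apply: Rmult_le_compat_l; lra.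
have Eq : (2 * (56 * rN L ^ 8 * 16 ^ L) < IZR q)%Re by lra.
have [sz _] := apx_size (Rlt_le _ _ q0) h.
have [h1 _ _ _] := h; rewrite re_muln -/(rN L) in h1.
move: (56 * rN L ^ 8 * 16 ^ L)%Re (2 * rN L ^ 4 * 4 ^ L)%Re gM gE gB Eq sz h1 => E M gM gE gB Eq sz h1.
have e2 : IZR (Z.of_nat (2 ^ L.-1) * q) = (rN L / 2 * IZR q)%Re.
  rewrite mult_IZR /rN; have -> : 2 ^ L = 2 * 2 ^ L.-1 by rewrite -expnS prednK.
  have -> : Z.of_nat (2 * 2 ^ L.-1) = (2 * Z.of_nat (2 ^ L.-1))%Z by clear; lia.
  by rewrite mult_IZR; field.
have [s1 s2] := Rabs_bound sz; have [h2 h3] := Rabs_bound h1.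
have szq : (IZR q * M + E < IZR q * IZR q * IZR q)%Re.
  have z1 : (1 <= IZR q)%Re by lra.
  have z2 : (M + 1 <= IZR q)%Re by nra.
  have z3 : (IZR q * (M + 1) <= IZR q * IZR q)%Re by apply: Rmult_le_compat_l; lra.
  have z4 : (IZR q * IZR q * 1 <= IZR q * IZR q * IZR q)%Re by apply: Rmult_le_compat_l; nra.
  by lra.
split; last split.
- by split; [apply: le_IZR | apply: lt_IZR]; rewrite ?opp_IZR !mult_IZR; lra.
- move=> hC; apply/Z.ltb_spec0; apply: lt_IZR; rewrite e2.
  have : (IZR q * (rN L * 1) <= IZR q * (rN L * re C))%Re.
    by apply: Rmult_le_compat_l; [lra | apply: Rmult_le_compat_l; lra].
  have : (IZR q * 2 <= IZR q * rN L)%Re by apply: Rmult_le_compat_l; lra.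
  lra.
- move=> hC; apply/Z.ltb_spec0 => /IZR_lt; rewrite e2 => h4.
  rewrite hC in h2 h3.
  have : (IZR q * 2 <= IZR q * rN L)%Re by apply: Rmult_le_compat_l; lra.
  lra.
Qed.

Definition tcost := L * (N * (body_cost + 10) + 50) + 50.

Lemma conv_block_spec u v blk st k : par q L st ->
  var st vblk = Z.of_nat blk -> blk < n %/ m ->
  (forall j, j < n + N -> arr st aU (Z.of_nat j) = Z.b2z (u j)) ->
  (forall a, a < N -> apx (IZR q) (4 ^ L)%Re (tau L * 8 ^ L)%Re
     (arr st aBR (Z.of_nat a)) (arr st aBI (Z.of_nat a)) (lev tw L (kernel L m v) L a)) ->
  wpc conv_block (fun st' k' =>
    (forall p : nat, arr st' abad (Z.of_nat p) =
       if [&& blk * m <= p, p < blk.+1 * m & hit m u v p] then 1%Z else arr st abad (Z.of_nat p)) /\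
    k' <= k + 5 * tcost) st k.
Proof.
move=> hpar hblk hbn hu hB.
have hs0 : blk * m + m <= n.
  have : blk.+1 * m <= n %/ m * m by rewrite leq_mul2r hbn orbT.
  by have := leq_trunc_div n m; rewrite mulSn; clear; lia.
have N0 : 0 < N by rewrite expn_gt0.
split; first by vc.
set st1 := setv _ vs _.
have hp1 : par q L st1 by case: hpar => *; split.
have hvs : var st1 vs = Z.of_nat (blk * m) by rewrite /st1 /= hblk; clear; lia.
apply: wp_seq; eapply wp_use.
  by apply: (fill_text_spec (u := u) (s0 := blk * m)) hp1 _ hvs hu; apply: leq_trans hs0; apply: leq_addr.
move=> st2 k2 [h2 hk2] f2; have hp2 : par q L st2 by refine (par_frame _ f2 hp1).
apply: wp_seq; eapply wp_use; first by eapply fft_spec; eassumption.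
move=> st3 k3 [h3 hk3] f3; have hp3 : par q L st3 by refine (par_frame _ f3 hp2).
have hB3 a : a < N -> apx (IZR q) (4 ^ L)%Re (tau L * 8 ^ L)%Re
     (arr st3 aBR (Z.of_nat a)) (arr st3 aBI (Z.of_nat a)) (lev tw L (kernel L m v) L a).
  by move=> /hB; case: f3 f2 => _ fa3 _ _ [_ fa2 _ _]; rewrite !fa3 // !fa2.
apply: wp_seq; eapply wp_use.
  by apply: (multiply_spec _ hp3 _ h3 hB3); apply: good_fwd.
move=> st4 k4 [h4 hk4] f4; have hp4 : par q L st4 by refine (par_frame _ f4 hp3).
have h4' : approximates L q (2 * rN L ^ 4)%Re (56 * rN L ^ 8)%Re st4
    (fun a => lev tw L (signal u (blk * m)) L a * lev tw L (kernel L m v) L a)%R.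
  (* The growth factors of the L levels become powers of N here, the form in which the inverse
     transform expects its initial bounds. *)
  have p4 : (4 ^ L = rN L ^ 2)%Re by rewrite /rN IZR_pow2 -pow_mult Nat.mul_comm pow_mult; congr pow; ring.
  have p8 : (8 ^ L = rN L ^ 3)%Re by rewrite /rN IZR_pow2 -pow_mult Nat.mul_comm pow_mult; congr pow; ring.
  move=> a /h4; apply: apx_le; rewrite /tau p4 ?p8; apply: Req_le; ring.
apply: wp_seq; eapply wp_use; first by eapply ifft_spec; eassumption.
move=> st5 k5 [h5 hk5] f5; have hp5 : par q L st5 by refine (par_frame _ f5 hp4).
have hfr x : (writes_var x fill_text || writes_var x fft || writes_var x multiply || writes_var x ifft) = false ->
    var st5 x = var st1 x.
  move=> /Bool.orb_false_elim[/Bool.orb_false_elim[/Bool.orb_false_elim[w1 w2] w3] w4].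
  by case: f5 => -> //; case: f4 => -> //; case: f3 => -> //; case: f2 => ->.
have hcyc a : a < N -> apx (IZR q) (2 * rN L ^ 4 * 4 ^ L)%Re (56 * rN L ^ 8 * 16 ^ L)%Re
    (arr st5 aAR (Z.of_nat a)) (arr st5 aAI (Z.of_nat a))
    (cyc L (signal u (blk * m)) (kernel L m v) a *+ N)%R.
  move=> ha; have E := @inv_cyc _ tw conj_tw tw0 (fun b => proj1 (tw_parity b))
    (fun b => proj2 (tw_parity b)) tw_unit L (signal u (blk * m)) (kernel L m v) _ a (fun j _ => erefl) ha.
  by rewrite -E; apply: h5.
eapply wp_use.
  eapply (@mark_block_spec (fun i => hit m u v (blk * m + i)) (blk * m) st5 k5 hp5 hs0).
  - by rewrite hfr.
  - move=> i hi; have iN : i < N by move: hi hm; clear; lia.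
    by case: (threshold (hcyc i iN)).
  - move=> i hi; have iN : i < N by move: hi hm; clear; lia.
    have [_ [t1 t2]] := threshold (hcyc i iN); rewrite (par_N2 hp5).
    have := cyc_hit u v (blk * m) m0 hm hi; cbv zeta.
    by case: (hit m u v (blk * m + i)) => h6; [exact (t1 h6) | exact (t2 h6)].
move=> st6 k6 [h6 hk6] _; split.
  move=> p; rewrite h6 mulSn [m + _]addnC; case: f5 => _ -> // _ _; case: f4 => _ -> // _ _.
  case: f3 => _ -> // _ _; case: f2 => _ -> // _ _.
  case: (leqP (blk * m) p) => [hp|//]; by rewrite subnKC.
have L1 : N * (body_cost + 10) <= L * (N * (body_cost + 10)) by rewrite leq_pmull.
have mN : m * (body_cost + 10) <= N * (body_cost + 10) by rewrite leq_mul2r; move: hm; clear; lia.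
move: hk2 hk3 hk4 hk5 hk6 L1 mN; rewrite /tcost [code_size _]/=.
move: (N * (body_cost + 10)) (m * (body_cost + 10)) => x y; rewrite !mulnDr.
by move: (L * x) => z; move: L0; clear; lia.
Qed.

Lemma conv_spec u v st k : par q L st -> var st vnb = Z.of_nat (n %/ m) -> n < 2 ^ w ->
  (forall j, j < n + N -> arr st aU (Z.of_nat j) = Z.b2z (u j)) ->
  (forall j, j < m -> arr st aV (Z.of_nat j) = Z.b2z (v j)) ->
  wpc conv (fun st' k' =>
    (forall p : nat, arr st' abad (Z.of_nat p) =
       if (p < n %/ m * m) && hit m u v p then 1%Z else arr st abad (Z.of_nat p)) /\
    k' <= k + (n %/ m).+1 * (10 * tcost)) st k.
Proof.
move=> hpar hnb nw hu hv.
apply: wp_seq; eapply wp_use; first exact: (fill_pattern_spec _ hpar hv).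
move=> st1 k1 [h1 hk1] f1; have hp1 : par q L st1 by refine (par_frame _ f1 hpar).
apply: wp_seq; eapply wp_use; first by eapply fft_spec; eassumption.
move=> st2 k2 [h2 hk2] f2; have hp2 : par q L st2 by refine (par_frame _ f2 hp1).
apply: wp_seq; eapply wp_use; first exact: (copy_spectrum_spec _ hp2).
move=> st3 k3 [h3 hk3] f3; have hp3 : par q L st3 by refine (par_frame _ f3 hp2).
apply: (wp_for_simple (n := n %/ m) (T := 5 * tcost) (I := fun blk s => forall p : nat,
   arr s abad (Z.of_nat p) =
       if (p < blk * m) && hit m u v p then 1%Z else arr st3 abad (Z.of_nat p))).
- exact: I.
- by rewrite /=; case: f3 => -> // _ _ _; case: f2 => -> // _ _ _; case: f1 => -> //.
- by apply: leq_ltn_trans nw; apply: leq_div.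
- by [].
- by move=> p; rewrite mul0n.
- move=> blk s k' hblk hI fr.
  have hp4 : par q L s by refine (par_frame _ fr hp3).
  eapply wp_use.
    apply: (conv_block_spec (u := u) (v := v) (blk := blk)) => //.
    + by case: hp4 => *; split.
    + move=> j hj; rewrite -hu //; case: fr => _ /= -> // _ _; case: f3 => _ -> // _ _.
      by case: f2 => _ -> // _ _; case: f1 => _ -> //.
    + move=> a ha; have [e1 e2] := h3 a ha.
      by case: fr => _ /= fa _ _; rewrite !fa // e1 e2; apply: h2.
  move=> s2 k4 [h4 hk4] _; split=> // p; rewrite h4 /= hI; case: (hit m u v p); rewrite ?andbF ?andbT //.
  rewrite mulSn; case: (leqP (blk * m) p) => h5; case: (ltnP p (m + blk * m)) => h6 //=.
  by exfalso; move: h5 h6; clear; lia.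
- move=> s k' hI fr hk; split.
    move=> p; rewrite /= hI; case: ifP => // _; case: f3 => _ -> // _ _.
    by case: f2 => _ -> // _ _; case: f1 => _ -> //.
  have L1 : N * (body_cost + 10) <= L * (N * (body_cost + 10)) by rewrite leq_pmull.
  move: hk hk1 hk2 hk3 L1; rewrite /tcost !mulnDr.
  by move: (N * _) (L * (_ * _)) (n %/ m) => x z d; move: L0; clear; nia.
Qed.

End Specs.

End Convolution.
Import Convolution.

(** * Tables of roots of unity *)

Module Tables.

Set Implicit Arguments.
Unset Strict Implicit.
Unset Printing Implicit Defensive.
Local Open Scope nat_scope.

(** There are only counted loops, so [vN] and [vlg] are found by guarded doublings that run [m] and
    [n] times and idle once the target is reached. Five squarings of [vN] give the scale. *)
Definition setup :=
  vN <- ECst 2 ;; vN2 <- ECst 1 ;; vL <- ECst 1 ;;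
  For vq ELenP (If (TLt $vN (ECst 2 *' ELenP))
    (vN2 <- $vN ;; vN <- $vN *' ECst 2 ;; vL <- $vL +' ECst 1) Skip) ;;
  vX <- ECst 1 ;; vlg <- ECst 0 ;;
  For vq ELenT (If (TLt ELenT $vX) Skip (vX <- $vX *' ECst 2 ;; vlg <- $vlg +' ECst 1)) ;;
  vQ <- $vN *' $vN ;; vQ <- $vQ *' $vQ ;; vQ <- $vQ *' $vQ ;; vQ <- $vQ *' $vQ ;;
  vQ <- $vQ *' $vQ ;; vQ2 <- $vQ *' $vQ ;; vQ3 <- $vQ2 *' $vQ ;;
  vLQ <- ECst 32 *' $vL +' ECst 1 ;; vnb <- ELenT /' ELenP.

Definition sqrt_step :=
  vt <- $vv +' $vz ;; If (TLt $vX ($vt *' $vt)) Skip (vv <- $vt) ;; vz <- $vz /' ECst 2.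

Definition twiddle_step :=
  vt <- EGet aTR $vq ;; vu <- EGet aTI $vq ;;
  Put aTR ($vh +' $vq) (scaled ($vx *' $vt -' $vy *' $vu)) ;;
  Put aTI ($vh +' $vq) (scaled ($vx *' $vu +' $vy *' $vt)).

(** Level [l] appends 2^l entries, the products of the existing ones with the root [croot l] held in
    [vx] and [vy], and then replaces this root by the next one in a half-angle step. *)
Definition twiddles :=
  Put aTR (ECst 0) $vQ ;; Put aTI (ECst 0) (ECst 0) ;;
  vx <- ECst 0 ;; vy <- $vQ ;; vh <- ECst 1 ;;
  For vl $vL (
    For vq $vh twiddle_step ;;
    vh <- $vh *' ECst 2 ;;
    vX <- ($vQ *' ($vQ +' $vx)) /' ECst 2 ;; vv <- ECst 0 ;; vz <- $vQ ;;
    For vq $vLQ sqrt_step ;;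
    vy <- ($vQ *' $vy) /' (ECst 2 *' $vv) ;; vx <- $vv).

Lemma of_nat_pow2 a b : (Z.of_nat (2 ^ a) * Z.of_nat (2 ^ b))%Z = Z.of_nat (2 ^ (a + b)).
Proof. by rewrite expnD; lia. Qed.

(** Exact twiddle factors have coordinates of size at most 1, so the size bound returns to 1 after
    each product instead of doubling along the table. *)
Lemma apx_tw Q M E a b k : apx Q M E a b (tw k) -> apx Q 1 E a b (tw k).
Proof. by case=> h1 h2 _ _; have [h3 h4] := tw_le1 k; split. Qed.

Section Setup.

Variables (w : nat) (G : gpm) (tape : seq nat) (lim : Z).
Notation wpc := (wp w G tape lim).
Notation n := (text_len G).
Notation m := (pat_len G).
Notation L := (up_log 2 (2 * m)).
Notation N := (2 ^ L).
Notation lg := (trunc_log 2 n).+1.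
Variable q : Z.
Hypothesis qE : q = Z.of_nat (2 ^ (32 * L)).
Hypothesis m0 : 0 < m.
Hypothesis mn : m <= n.
Hypothesis lim_U : (Z.of_nat (n + N) <= lim)%Z.
Hypothesis lim_W : (lim <= W w)%Z.
Hypothesis W_big : (2 * (q * q * q) <= W w)%Z.
Hypothesis W_n : (Z.of_nat (4 * n) < W w)%Z.

Lemma L_bounds : [/\ 0 < L, 2 * m <= N, N < 4 * m & L <= m.+1].
Proof.
have h1 : 1 < 2 * m by move: m0; clear; lia.
have /andP[h2 h3] := up_log_bounds (isT : 1 < 2) h1.
have L0 : 0 < L by rewrite up_log_gt0.
have h4 : N = 2 * 2 ^ L.-1 by rewrite -expnS prednK.
split=> //; first by move: h2; rewrite h4; clear; lia.
rewrite -ltnS; apply: (leq_trans (n := L.-1.+2)); first by rewrite prednK.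
rewrite !ltnS -(leq_exp2l (m := 2)) //; apply: leq_trans (ltnW h2) _.
by have := ltn_expl m.-1 (isT : 1 < 2); case: (m) m0 => // x _; rewrite expnS /=; clear; lia.
Qed.

Lemma lg_bounds : n < 2 ^ lg <= 2 * n.
Proof.
have n0 : 0 < n by move: m0 mn; clear; lia.
by have /andP[h1 h2] := trunc_log_bounds (isT : 1 < 2) n0; rewrite h2 expnS leq_mul2l h1.
Qed.

Lemma q_1000 : (1000 <= q)%Z.
Proof.
have [L0 _ _ _] := L_bounds; have : 2 ^ 10 <= 2 ^ (32 * L) by rewrite leq_exp2l // (leq_trans _ (leq_pmulr 32 L0)).
by rewrite qE; move: (2 ^ (32 * L)) => z; clear; lia.
Qed.

Lemma q_gt0' : (0 < q)%Z.
Proof. by move: q_1000; clear; lia. Qed.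

Lemma q_big' : (IZR (Z.of_nat (2 ^ L)) ^ 32 <= IZR q)%Re.
Proof.
by rewrite qE !IZR_pow2 [32 * L]mulnC pow_mult; exact: Rle_refl.
Qed.

Lemma lim_N : (Z.of_nat N <= lim)%Z.
Proof. by move: lim_U; clear; lia. Qed.

Definition ready (st : store) :=
  [/\ var st vN = Z.of_nat N, var st vN2 = Z.of_nat (2 ^ L.-1), var st vL = Z.of_nat L &
   [/\ var st vQ = q, var st vQ2 = (q * q)%Z, var st vQ3 = (q * q * q)%Z,
       var st vLQ = Z.of_nat (32 * L + 1) & var st vnb = Z.of_nat (n %/ m) /\ var st vlg = Z.of_nat lg]].

(** The numbers of iterations suffice because L <= m + 1, with a start at 1, and lg <= n. *)
Lemma setup_spec st k :
  wpc setup (fun st' k' => ready st' /\ k' <= k + n * 300 + 500) st k.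
Proof.
have [L0 hm hm4 Lm] := L_bounds; have /andP[lg1 lg2] := lg_bounds.
have hW2 : Z.of_nat (2 ^ w) = W w by [].
have n0 : 0 < n by move: m0 mn; clear; lia.
split; first by []. split; first by []. split; first by [].
apply: wp_seq.
apply: (wp_for_simple (n := m) (T := 60) (I := fun i s => let l := minn i.+1 L in
  [/\ var s vN = Z.of_nat (2 ^ l), var s vN2 = Z.of_nat (2 ^ l.-1) & var s vL = Z.of_nat l])).
- exact: I.
- by [].
- by move: hW2 W_n mn; clear; lia.
- by [].
- by have -> : minn 1 L = 1 by apply/minn_idPl.
- move=> i s k' hi [e1 e2 e3] fr.
  wpsimpl s; rewrite e1 e2 e3; set l := minn i.+1 L in e1 e2 e3 *.
  have lL : 2 ^ l <= N by rewrite leq_exp2l // geq_minr.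
  vc; try by []; try (by rewrite /is_word; move: lL hm hm4 W_n mn; clear; lia).
  have -> : Z.ltb (Z.of_nat (2 ^ l)) (Z.of_nat 2 * Z.of_nat m) = (l < L).
    have -> : Z.ltb (Z.of_nat (2 ^ l)) (Z.of_nat 2 * Z.of_nat m) = (2 ^ l < 2 * m) by clear; lia.
    apply/idP/idP => [h|h]; last first.
      have h1 : 1 < 2 * m by move: m0; clear; lia.
      have /andP[h2 _] := up_log_bounds (isT : 1 < 2) h1.
      by apply: leq_ltn_trans h2; rewrite leq_exp2l // -ltnS prednK.
    by rewrite -(ltn_exp2l _ _ (isT : 1 < 2)); apply: leq_trans h hm.
  case: ifP => hl.
  + have el : minn i.+2 L = l.+1 by move: hl; rewrite /l; clear; lia.
    vc; last by rewrite -!addnA leq_add2l.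
    rewrite el /= expnS; split=> //; clear; lia.
  + have el : minn i.+2 L = l by move: hl; rewrite /l; clear; lia.
    vc; last by rewrite -!addnA leq_add2l.
    by rewrite el.
move=> s1 k1; have -> : minn m.+1 L = L by apply/minn_idPr.
move=> [e1 e2 e3] _ hk1.
split; first by []. split; first by [].
apply: wp_seq; eapply wp_use.
  apply: (wp_for_simple (n := n) (T := 60) (Q := fun s' k' => [/\ var s' vX = Z.of_nat (2 ^ lg), var s' vlg = Z.of_nat lg & k' <= k1 + n * 70 + 100]) (I := fun i s => let l := minn i lg in
  var s vX = Z.of_nat (2 ^ l) /\ var s vlg = Z.of_nat l)).
  - exact: I.
  - by [].
  - by move: hW2 W_n; clear; lia.
  - by [].
  - by rewrite min0n.
  - move=> i s k' hi [f1 f2] fr.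
    wpsimpl s; rewrite f1 f2; set l := minn i lg in f1 f2 *.
    have ll : 2 ^ l <= 2 ^ lg by rewrite leq_exp2l // geq_minr.
    vc; try by []; try (by rewrite /is_word; move: ll lg2 W_n; clear; lia).
    have -> : Z.ltb (Z.of_nat n) (Z.of_nat (2 ^ l)) = (lg <= l).
      have -> : Z.ltb (Z.of_nat n) (Z.of_nat (2 ^ l)) = (n < 2 ^ l) by clear; lia.
      apply/idP/idP => [h|h]; last by apply: leq_trans lg1 _; rewrite leq_exp2l.
      rewrite leqNgt; apply/negP => h2; move: h; rewrite ltnNge => /negP; apply.
      by have /andP[h3 _] := trunc_log_bounds (isT : 1 < 2) n0; apply: leq_trans h3; rewrite leq_exp2l.
    case: ifP => hl.
    + have el : minn i.+1 lg = l by move: hl; rewrite /l; clear; lia.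
      by vc; rewrite ?el // -?addnA leq_add2l.
    + have el : minn i.+1 lg = l.+1 by move: hl; rewrite /l; clear; lia.
      vc; rewrite ?el ?expnS //; try (by clear; lia); by rewrite -!addnA leq_add2l.
  move=> s' k'; have -> : minn n lg = lg.
    apply/minn_idPr; have := ltn_expl (trunc_log 2 n) (isT : 1 < 2).
    by have /andP[h3 _] := trunc_log_bounds (isT : 1 < 2) n0; move: h3; clear; lia.
  by move=> [f1 f2] _ hk; split=> //; move: hk => /=; rewrite /is_true; move: (n) => z; clear; lia.
move=> s2 k2 [f1 f2 hk2] [fv _ _ _].
have g1 : var s2 vN = Z.of_nat N by rewrite fv.
have g2 : var s2 vN2 = Z.of_nat (2 ^ L.-1) by rewrite fv.
have g3 : var s2 vL = Z.of_nat L by rewrite fv.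
have sq a : (Z.of_nat (2 ^ (a * L)) * Z.of_nat (2 ^ (a * L)))%Z = Z.of_nat (2 ^ ((a + a) * L)).
  by rewrite of_nat_pow2 mulnDl.
rewrite -[L]mul1n in g1.
have eqQ : let x := Z.of_nat (2 ^ (1 * L)) in let x1 := (x * x)%Z in let x2 := (x1 * x1)%Z in
    let x3 := (x2 * x2)%Z in let x4 := (x3 * x3)%Z in (x4 * x4)%Z = q.
  by rewrite /= !sq qE.
cbv zeta in eqQ; wpsimpl s2; rewrite ?(g1, g2, g3, f2) eqQ.
vc; try by []; try (by rewrite /is_word; move: W_n mn m0; clear; lia).
  split=> /=; rewrite ?g1 ?g2 ?g3 ?f2 ?mul1n //; split=> //; try (by rewrite eqQ);
    try (by change (32 * Z.of_nat L + 1 = Z.of_nat (32 * L + 1))%Z; clear; lia).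
  by split=> //; rewrite -of_nat_divn.
move: hk1 hk2 mn => /=; move: (n) (m) => a b; clear; lia.
Qed.

(** Binary digit method: v^2 <= X < (v + b)^2, where [b] is halved each time and [vz] is b / 2. As X
    < 4 q^2, one may start at b = 2 q = 2^(32 L + 1), whence the number of iterations. *)
Lemma isqrt_spec X st k : (0 <= X < 4 * q * q)%Z -> var st vX = X -> var st vv = 0%Z ->
  var st vz = q -> var st vLQ = Z.of_nat (32 * L + 1) ->
  wpc (For vq $vLQ sqrt_step) (fun st' k' => (0 <= var st' vv)%Z /\ (var st' vv * var st' vv <= X < (var st' vv + 1) * (var st' vv + 1))%Z /\ k' <= k + (32 * L + 1) * (body_cost + 10) + 8) st k.
Proof.
move=> [X0 XQ] eX ev ez eL; have q1 := q_1000.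
have Lw : 32 * L + 1 < 2 ^ w.
  have := ltn_expl (32 * L) (isT : 1 < 2); move: W_big q1; rewrite /W qE.
  by move: (2 ^ (32 * L)) (2 ^ w) => x y; clear; nia.
apply: (wp_for_simple (n := 32 * L + 1) (T := body_cost) (I := fun i s =>
  let b := Z.of_nat (2 ^ (32 * L + 1 - i)) in let v := var s vv in
  [/\ var s vX = X, var s vz = (b / 2)%Z, (0 <= v)%Z & (v * v <= X < (v + b) * (v + b))%Z])).
- exact: I.
- by [].
- exact: Lw.
- by [].
- rewrite /= subn0 ez ev eX addn1 expnS qE -{1}qE; split=> //.
    by rewrite -(Z.div_mul q 2) //; congr (_ / _)%Z; rewrite qE; clear; lia.
  by move: X0 XQ; rewrite qE; move: (2 ^ _) => z; clear; nia.
- move=> i s k' hi [e1 e2 v0 [h1 h2]] fr.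
  have ei : 32 * L + 1 - i = (32 * L - i).+1 by move: hi; clear; lia.
  have ei1 : 32 * L + 1 - i.+1 = 32 * L - i by move: hi; clear; lia.
  have yq : (1 <= Z.of_nat (2 ^ (32 * L - i)) <= q)%Z.
    have : 2 ^ (32 * L - i) <= 2 ^ (32 * L) by rewrite leq_exp2l // leq_subr.
    by have := expn_gt0 2 (32 * L - i); rewrite qE; clear; lia.
  rewrite ei expnS in e2 h2; rewrite ei1.
  move: (2 ^ (32 * L - i)) yq e2 h2 => y yq e2 h2.
  have ez' : var s vz = Z.of_nat y.
    by rewrite e2 (_ : Z.of_nat (2 * y) = (Z.of_nat y * 2)%Z) ?Z.div_mul //; clear; lia.
  rewrite /sqrt_step; wpsimpl s; rewrite e1 ez'; move: (var s vv) v0 h1 h2 => v v0 h1 h2.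
  have v2 : (v <= 2 * q)%Z by move: h1 XQ v0 q1; clear; nia.
  have sqb : ((v + Z.of_nat y) * (v + Z.of_nat y) <= 9 * q * q)%Z by move: v2 yq v0 q1; clear; nia.
  have sq0 : (0 <= (v + Z.of_nat y) * (v + Z.of_nat y))%Z by apply: Z.square_nonneg.
  have qb : (9 * q * q < W w /\ q < W w)%Z by move: W_big q1; clear; nia.
  vc; try by []; try (by rewrite /is_word; move: sqb sq0 qb X0 XQ yq q1; clear; nia).
  case: Z.ltb_spec => hc; vc; try by []; try (by rewrite /is_word; move: qb yq q1; clear; lia);
    try (by rewrite -!addnA leq_add2l).
  by split=> //; move: hc h1 h2 v0; clear; nia.
- move=> s k' [_ _ v0 h]; rewrite subnn in h; move=> _ hk; split=> //.
Qed.

Lemma E_bounds l : l < L -> (8 <= 8 ^ l.+1 /\ 100 * 8 ^ l.+1 <= IZR q)%Re.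
Proof.
move=> hl; split; first by have := pow_R1_Rle 8 l; rewrite /=; lra.
have [L0 _ _ _] := L_bounds; have limN := lim_N.
have h : ((2 ^ 3) ^ l.+1 <= rN L ^ 3)%Re by eapply pow_rN; eassumption.
have -> : 8%Re = (2 ^ 3)%Re by rewrite /=; lra.
apply: (Rle_trans _ (100 * rN L ^ 3)); first by apply: Rmult_le_compat_l h; lra.
by eapply (@rN_le_q) with (b := 7); try eassumption; try exact: q_big'; try exact: q_gt0'; rewrite //=; lra.
Qed.

Lemma apx_2q E a b x : (0 <= E <= IZR q)%Re -> apx (IZR q) 1 E a b x ->
  (a <= 2 * q)%Z /\ (b <= 2 * q)%Z.
Proof.
move=> hE h; have [] := apx_size _ h; first by lra.
by move=> /Rabs_bound h1 /Rabs_bound h2; split; apply: le_IZR; rewrite mult_IZR; lra.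
Qed.

(** A new entry is a product of two values of error [E], so its error is at most 7 E; only old
    entries are read, so no error exceeds 8 E within the level. *)
Lemma twiddle_level l st k : l < L -> var st vh = Z.of_nat (2 ^ l) ->
  var st vQ = q -> var st vQ2 = (q * q)%Z -> var st vQ3 = (q * q * q)%Z ->
  apx (IZR q) 1 (8 ^ l.+1)%Re (var st vx) (var st vy) (croot l) ->
  (forall b, b < 2 ^ l -> apx (IZR q) 1 (8 ^ l.+1)%Re (arr st aTR (Z.of_nat b)) (arr st aTI (Z.of_nat b)) (tw b)) ->
  wpc (For vq $vh twiddle_step) (fun st' k' =>
    (forall b, b < 2 ^ l.+1 -> apx (IZR q) 1 (8 ^ l.+2)%Re (arr st' aTR (Z.of_nat b)) (arr st' aTI (Z.of_nat b)) (tw b)) /\ k' <= k + N * (body_cost + 10) + 8) st k.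
Proof.
move=> hl eh eQ eQ2 eQ3 hc ht; have [E8 E100] := E_bounds hl; have q1 := q_1000; have q0 := q_gt0'.
have lN : 2 * 2 ^ l <= N by rewrite -expnS leq_exp2l.
have limN := lim_N; have Nw : N < 2 ^ w.
  have : 2 ^ L <= 2 ^ (32 * L) by rewrite leq_exp2l // leq_pmull.
  by move: W_big q1; rewrite /W qE; move: (2 ^ (32 * L)) (2 ^ w) => x y; clear; nia.
have E' : (8 ^ l.+2 = 8 * 8 ^ l.+1)%Re by [].
move: (8 ^ l.+2)%Re E' => E' eE'; move: (8 ^ l.+1)%Re E8 E100 eE' hc ht => E E8 E100 -> hc ht.
have qR : (1000 <= IZR q)%Re by apply: IZR_le.
apply: (wp_for_simple (n := 2 ^ l) (T := body_cost) (I := fun i s => forall b, b < 2 ^ l + i ->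
  apx (IZR q) 1 (if b < 2 ^ l then E else (8 * E)%Re) (arr s aTR (Z.of_nat b)) (arr s aTI (Z.of_nat b)) (tw b))).
- exact: I.
- by [].
- by move: lN Nw; clear; lia.
- by [].
- by move=> b; rewrite addn0 => hb; rewrite hb; apply: ht.
- move=> i s k' hi hI fr.
  have hci : apx (IZR q) 1 E (var s vx) (var s vy) (croot l) by case: fr => fv _ _ _; rewrite !fv.
  have hti : apx (IZR q) 1 E (arr s aTR (Z.of_nat i)) (arr s aTI (Z.of_nat i)) (tw i).
    by have := hI i; rewrite hi; apply; apply: ltn_addr.
  have [e1 e2 e3 e4] : [/\ var s vh = Z.of_nat (2 ^ l), var s vQ = q, var s vQ2 = (q * q)%Z & var s vQ3 = (q * q * q)%Z].
    by case: fr => fv _ _ _; rewrite !fv.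
  rewrite /twiddle_step; wpsimpl s; have [L0 _ _ _] := L_bounds.
  have sd e : ((e + q * q * q) / q - q * q = e / q)%Z by eapply scaled_div; eassumption.
  rewrite e1 e2 e3 e4 !sd.
  have [s1 s2] := apx_product_size (B := 1%Re) q0 hci hti ltac:(lra) ltac:(lra) ltac:(lra) ltac:(lra) ltac:(lra).
  have := @apx_twiddle q 1%Re E E _ _ _ _ _ _ q0 ltac:(lra) ltac:(lra) ltac:(lra) ltac:(lra) hci hti.
  rewrite -tw_add // => /apx_tw hnew.
  have [qw _] : is_word w q /\ (q <= q * q * q)%Z by eapply q_word; eassumption.
  have el : (Z.of_nat (2 ^ l) + Z.of_nat i)%Z = Z.of_nat (2 ^ l + i) by clear; lia.
  rewrite el.
  vc; try by []; try (by move: hi lN limN; clear; lia); try (eapply apx_arr_word; eassumption);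
    last by rewrite -!addnA leq_add2l.
  move=> b hb /=; have -> : Z.eqb (Z.of_nat b) (Z.of_nat (2 ^ l + i)) = (b == 2 ^ l + i) by clear; lia.
  case: eqP => [->|ne]; last by apply: hI; move: hb ne; clear; lia.
  by rewrite ltnNge leq_addr; apply: apx_le hnew; lra.
- move=> s k' hI fr hk; split.
    move=> b; rewrite expnS mul2n -addnn => /hI; case: ifP => // _; apply: apx_le; lra.
  have : 2 ^ l * (body_cost + 10) <= N * (body_cost + 10) by rewrite leq_mul2r; move: lN; clear; lia.
  by move: hk; move: (2 ^ l * _) (N * _) => x y; clear; lia.
Qed.

Lemma twiddles_spec st k : ready st ->
  wpc twiddles (fun st' k' => par q L st' /\ k' <= k + L * (N * (body_cost + 10) + (32 * L + 1) * (body_cost + 10) + body_cost) + body_cost) st k.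
Proof.
move=> [eN eN2 eL [eQ eQ2 eQ3 eLQ _]]; have q1 := q_1000; have q0 := q_gt0'; have [L0 _ _ _] := L_bounds.
have qR : (1000 <= IZR q)%Re by apply: IZR_le.
have lim0 : (0 < lim)%Z by have := lim_N; have := expn_gt0 2 L; clear; lia.
do 2 (split; [by []|split; [by []|split; [by split=> //; exact: lim0|]]]).
do 3 (split; first by []).
apply: (wp_for_simple (n := L) (T := N * (body_cost + 10) + (32 * L + 1) * (body_cost + 10) + 200) (I := fun l s =>
  [/\ var s vh = Z.of_nat (2 ^ l), (0 <= var s vx)%Z, (0 <= var s vy)%Z,
    apx (IZR q) 1 (8 ^ l.+1)%Re (var s vx) (var s vy) (croot l) &
    forall b, b < 2 ^ l -> apx (IZR q) 1 (8 ^ l.+1)%Re (arr s aTR (Z.of_nat b)) (arr s aTI (Z.of_nat b)) (tw b)])).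
- exact: I.
- by rewrite /= eL.
- have : 2 ^ L <= 2 ^ (32 * L) by rewrite leq_exp2l // leq_pmull.
  have := ltn_expl L (isT : 1 < 2).
  by move: W_big q1; rewrite /W qE; move: (2 ^ (32 * L)) (2 ^ w) (2 ^ L) => x y z; clear; nia.
- by [].
- split=> //=; rewrite ?eQ; try by move: q1; clear; lia.
    split; rewrite /croot /= ?Rmult_1_r ?Rmult_0_r ?Rminus_diag ?Rabs_R0 ?Rabs_R1; lra.
  by case=> // _; rewrite tw0; split; rewrite /= ?Rmult_1_r ?Rmult_0_r ?Rminus_diag ?Rabs_R0 ?Rabs_R1; lra.
- move=> l s k' hl [eh x0 y0 hc ht] fr; have [E8 E100] := E_bounds hl.
  have [f1 f2 f3 f4] : [/\ var s vQ = q, var s vQ2 = (q * q)%Z, var s vQ3 = (q * q * q)%Z & var s vLQ = Z.of_nat (32 * L + 1)].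
    by case: fr => fv _ _ _; rewrite !fv.
  have eq0 : (0 <= 8 ^ l.+1 <= IZR q)%Re by lra.
  have [xq yq] := apx_2q eq0 hc.
  have qb : (4 * q * q < W w /\ q < W w)%Z by move: W_big q1; clear; nia.
  apply: wp_seq; eapply wp_use; first by apply: (twiddle_level (l := l)).
  move=> s2 k2 [ht2 hk2] [fv fa _ _].
  have [g1 g2 g3 g4] : [/\ var s2 vQ = q, var s2 vLQ = Z.of_nat (32 * L + 1), var s2 vx = var s vx & var s2 vy = var s vy].
    by rewrite !fv.
  have eh2 : var s2 vh = Z.of_nat (2 ^ l) by rewrite fv.
  split; first by []. split; first (rewrite /= g1 g3; vc => //; rewrite /is_word; move: x0 xq q1 qb; clear; nia).
  split; first by []. split; first by [].
  have hX : (0 <= q * (q + var s vx) / 2 < 4 * q * q)%Z.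
    have d0 : (0 < 2)%Z by []. have d1 := Z.mul_div_le (q * (q + var s vx)) 2 d0.
    have d2 := Z.div_pos (q * (q + var s vx)) 2 ltac:(nia) d0.
    by split=> //; nia.
  apply: wp_seq; eapply wp_use.
    by apply: (isqrt_spec (X := (q * (q + var s vx) / 2)%Z)); rewrite /= ?g1 ?g3.
  move=> s3 k3 [v0 [[h1 h2] hk3]] [fv3 fa3 _ _].
  have [r1 r2] := root_step q0 E8 E100 hc v0 h1 h2.
  have [i1 i2 i3] : [/\ var s3 vQ = q, var s3 vy = var s vy & var s3 vh = Z.of_nat (2 ^ l.+1)].
    by rewrite !fv3 //= g1 g4 eh2 expnS; split=> //; clear; lia.
  have vq3 : (var s3 vv <= 2 * q)%Z by move: h1 hX v0 q1; clear; nia.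
  wpsimpl s3; rewrite i1 i2; vc; try by [].
  + by rewrite /is_word; move: y0 yq q1 qb W_big; clear; nia.
  + by rewrite /is_word; move: v0 vq3 q1 qb; clear; nia.
  + by move: r1; clear; lia.
  + split=> //=.
    * apply: Z.div_pos; first by move: y0 q0; clear; nia.
      by case: (var s3 vv) r1.
    * by move=> b hb; rewrite !fa3 //; apply: ht2.
  by move: (N * (body_cost + 10)) ((32 * L + 1) * (body_cost + 10)) hk2 hk3 => x y /=; clear; lia.
- move=> s k' [h1 _ _ _ ht] [fv fa _ _] hk; split.
    by split; rewrite ?fv.
  move: (N * (body_cost + 10)) ((32 * L + 1) * (body_cost + 10)) hk => x y /= hk.
  have : L * (x + y + 200 + 10) <= L * (x + y + body_cost) by rewrite leq_mul2l /body_cost -!addnA !leq_add2l orbT.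
  by move: hk; rewrite /body_cost; move: (L * _) (L * _) => u v; clear; lia.
Qed.

End Setup.

End Tables.
Import Tables.

(** * The matching program *)

Module Matching.

Set Implicit Arguments.
Unset Strict Implicit.
Unset Printing Implicit Defensive.
Local Open Scope nat_scope.

Notation vcnt2 := 41. Notation vrep2 := 42. Notation aheavy := 12.

(** Enumerating the alphabets could exceed the time bound, so only the letters occurring in the text
    are listed, in order of first occurrence. Their total degree stands in for the number of
    edges. *)
Definition scan :=
  vcnt <- ECst 0 ;; vS <- ECst 0 ;;
  For vp ELenT (va <- EIn $vp ;;
    If (TEq (EGet amark $va) (ECst 0))
      (Put amark $va (ECst 1) ;; Put adist $vcnt $va ;;
       vcnt <- $vcnt +' ECst 1 ;; vS <- $vS +' EDeg $va)
      Skip).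

(** [vD] is doubled while D^2 lg < S, which balances a multiple of D lg light convolutions against S
    / D heavy ones. For the constant [c] chosen later, [c * lg] rounds are enough because S is
    polynomial in [n]. *)
Definition params K c :=
  vD <- ECst 0 ;; vB <- ECst 2 ;; vR <- ECst 1 ;;
  vcount <- ECst c *' $vlg ;;
  If (TLt $vS $vlg) Skip (
    vD <- ECst 1 ;;
    For vq $vcount (If (TLt ($vD *' $vD *' $vlg) $vS) (vD <- ECst 2 *' $vD) Skip) ;;
    vB <- ECst 4 *' $vD ;; vR <- ECst K *' $vlg).

(** Multiply-shift hashing: the leading bits of the product modulo 2^w. The divisor [vG] is 2^w / B,
    obtained in [light] as (2^w - 1) / B + 1 because 2^w is not a word; this is exact since [B] is a
    power of two. *)
Definition hash e := EWrap ($vran *' e) /' $vG.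

(** A row belongs to a text position, so there are n B cells whatever the alphabet. Cells are
    stamped with the round number plus one, which voids the initial zeros and the marks of earlier
    rounds without clearing. *)
Definition fill_table :=
  For vp ELenT (va <- EIn $vp ;; vdeg <- EDeg $va ;;
    If (TLt $vD $vdeg) Skip
      (For vk $vdeg (Put atab ($vp *' $vB +' hash (ENbr $va $vk)) ($vrep +' ECst 1)))).

Definition light_text :=
  For vp ELenT (va <- EIn $vp ;;
    If (TLt $vD (EDeg $va)) (Put aU $vp (ECst 0))
      (If (TEq (EGet atab ($vp *' $vB +' $vbeta)) ($vrep +' ECst 1))
        (Put aU $vp (ECst 0)) (Put aU $vp (ECst 1)))).

Definition light_pattern :=
  For vp ELenP (If (TEq (hash (EIn (ELenT +' $vp))) $vbeta)
    (Put aV $vp (ECst 1)) (Put aV $vp (ECst 0))).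

Definition light :=
  For vrep $vR (Rand vran ;;
    vG <- EWrap (ECst 0 -' ECst 1) /' $vB +' ECst 1 ;;
    fill_table ;;
    For vbeta $vB (light_text ;; light_pattern ;; conv)).

Definition select_heavy :=
  vcnt2 <- ECst 0 ;;
  For vp $vcnt (va <- EGet adist $vp ;;
    If (TLt $vD (EDeg $va)) (Put aheavy $vcnt2 $va ;; vcnt2 <- $vcnt2 +' ECst 1) Skip).

Definition heavy_text :=
  For vp ELenT (If (TEq (EIn $vp) $va) (Put aU $vp (ECst 1)) (Put aU $vp (ECst 0))).

Definition heavy_pattern :=
  For vp ELenP (Put aV $vp (ECst 1 -' EMatch $va (EIn (ELenT +' $vp)))).

Definition heavy :=
  For vrep2 $vcnt2 (va <- EGet aheavy $vrep2 ;; heavy_text ;; heavy_pattern ;; conv).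

Definition report :=
  vcount <- ELenT -' ELenP +' ECst 1 ;;
  For vp $vcount (If (TEq (EGet abad $vp) (ECst 0)) (Rep ($vp +' ECst 1)) Skip).

Definition gpm_cmd K c :=
  setup ;; twiddles ;; scan ;; params K c ;; light ;; select_heavy ;; heavy ;; report.

Definition char G i := nth 0 (input G) i.
(** [undup] keeps last occurrences; the two reversals make it keep first ones, in the order in which
    [scan] meets them. *)
Definition letters G i : seq nat := rev (undup (rev (take i (input G)))).
Notation degree := text_degree_oracle.
Definition weight G i := sumn (map (degree G) (letters G i)).
Definition search S l D := if D * D * l < S then 2 * D else D.
Definition cutoff G l c := if weight G (text_len G) < l then 0
  else iter c (search (weight G (text_len G)) l) 1.
(** With D = 0 the light letters have no neighbours, so no collision can hide their mismatches and
    one round is enough; there are 2 buckets rather than 1 because 2^w / B must be a word. *)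
Definition buckets D := if D == 0 then 2 else 4 * D.
Definition rounds K l D := if D == 0 then 1 else K * l.
Definition bucket w B r x := (r * x) %% 2 ^ w %/ (2 ^ w %/ B).
Definition covered w G B r i b :=
  has (fun k => bucket w B r (nbr_oracle G (char G i) k) == b) (iota 0 (degree G (char G i))).
Definition light_u w G D B r b i :=
  [&& i < text_len G, degree G (char G i) <= D & ~~ covered w G B r i b].
Definition light_v w G B r b j := bucket w B r (char G (text_len G + j)) == b.
Definition heavy_u G x i := (i < text_len G) && (char G i == x).
Definition heavy_v G x j := ~~ match_oracle G x (char G (text_len G + j)).

Lemma size_input G : size (input G) = text_len G + pat_len G.
Proof. by rewrite size_cat !size_map !size_tuple. Qed.

Lemma char_text G i : i < text_len G -> char G i < text_alph G.
Proof.
move=> hi; rewrite /char nth_cat size_map size_tuple hi.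
have : all (fun x => x < text_alph G) [seq val a | a <- text G].
  by apply/allP => x /mapP[y _ ->]; exact: ltn_ord.
by move/(all_nthP 0) => -> //; rewrite size_map size_tuple.
Qed.

Lemma take_letters G i : i < size (input G) ->
  letters G i.+1 = if char G i \in letters G i then letters G i else rcons (letters G i) (char G i).
Proof.
move=> hi; rewrite /letters (take_nth 0 hi) rev_rcons /= !mem_rev mem_undup ?mem_rev.
by case: ifP => _ //; rewrite rev_cons.
Qed.

Lemma mem_letters G i x : (x \in letters G i) = (x \in take i (input G)).
Proof. by rewrite mem_rev mem_undup mem_rev. Qed.

Lemma uniq_letters G i : uniq (letters G i).
Proof. by rewrite rev_uniq undup_uniq. Qed.

Lemma size_letters G i : size (letters G i) <= i.
Proof.
rewrite size_rev; apply: leq_trans (size_undup _) _; rewrite size_rev size_take; case: ifP => //.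
by move/negbT; rewrite -leqNgt.
Qed.

Lemma letters_lt G x : x \in letters G (text_len G) -> x < text_alph G.
Proof.
rewrite mem_letters => /(nthP 0)[j]; rewrite size_takel ?size_input ?leq_addr // => hj <-.
by rewrite nth_take //; apply: char_text.
Qed.

Lemma pair_eqn B x y x' y' : y < B -> y' < B -> (x * B + y == x' * B + y') = (x == x') && (y == y').
Proof.
move=> h h'; apply/eqP/andP => [e|[/eqP -> /eqP ->]] //; have B0 : 0 < B by apply: leq_ltn_trans h.
split; apply/eqP.
  by have := congr1 (divn^~ B) e; rewrite /= !divnMDl // !divn_small // !addn0.
by have := congr1 (modn^~ B) e; rewrite /= !modnMDl !modn_small.
Qed.

(** * Specifications of the pieces of the matching program *)

Section Main.

Variables (w : nat) (G : gpm) (tape : seq nat) (lim : Z) (q : Z) (K c l : nat).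
Notation wpc := (wp w G tape lim).
Notation n := (text_len G).
Notation m := (pat_len G).
Notation L := (up_log 2 (2 * m)).
Notation N := (2 ^ L).
Notation lg := (trunc_log 2 n).+1.
Hypothesis qE : q = Z.of_nat (2 ^ (32 * L)).
Hypothesis m0 : 0 < m.
Hypothesis mn : m <= n.
Hypothesis lim_U : (Z.of_nat (n + N) <= lim)%Z.
Hypothesis lim_W : (lim <= W w)%Z.
Hypothesis W_big : (2 * (q * q * q) <= W w)%Z.
Hypothesis W_n : (Z.of_nat (4 * n) < W w)%Z.
Hypothesis alph_lim : (Z.of_nat (text_alph G) <= lim)%Z.
Hypothesis degree_w : forall x, degree G x < 2 ^ w.
Notation S := (weight G n).
Hypothesis S_w : 4 * S < 2 ^ w.
Notation D := (cutoff G lg (c * lg)).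
Notation B := (buckets D).
Notation rnd := (rounds K lg D).
Hypothesis B_pow : B = 2 ^ l.
Hypothesis l_w : l < w.
Hypothesis tab_lim : (Z.of_nat (n * B) <= lim)%Z.
Hypothesis count_w : c * lg < 2 ^ w.
Hypothesis rounds_w : (K * lg).+1 < 2 ^ w.
Hypothesis text_w : text_alph G < 2 ^ w.
Hypothesis pat_w : pat_alph G < 2 ^ w.

Lemma conv_spec' u v st k : par q L st -> var st vnb = Z.of_nat (n %/ m) ->
  (forall j, j < n + N -> arr st aU (Z.of_nat j) = Z.b2z (u j)) ->
  (forall j, j < m -> arr st aV (Z.of_nat j) = Z.b2z (v j)) ->
  wpc conv (fun st' k' =>
    (forall p : nat, arr st' abad (Z.of_nat p) =
       if (p < n %/ m * m) && hit m u v p then 1%Z else arr st abad (Z.of_nat p)) /\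
    k' <= k + (n %/ m).+1 * (10 * tcost L)) st k.
Proof.
have [L0 hm _ _] := L_bounds m0.
have q0 : (0 < q)%Z := q_gt0' qE m0. have qb := q_big' qE.
have lN : (Z.of_nat N <= lim)%Z := lim_N lim_U.
have nw : n < 2 ^ w by move: W_n; rewrite /W; clear; lia.
by move=> *; eapply conv_spec; eassumption.
Qed.

Lemma nw4 : 4 * n < 2 ^ w.
Proof. by move: W_n; rewrite /W; clear; lia. Qed.

Lemma n_lim : (Z.of_nat n <= lim)%Z.
Proof. by move: lim_U; clear; lia. Qed.

Lemma wordn x : x < 2 ^ w -> is_word w (Z.of_nat x).
Proof. by rewrite /is_word /W; clear; lia. Qed.

Lemma charE x : nth 0 (input G) (Z.to_nat (Z.of_nat x)) = char G x.
Proof. by rewrite Nat2Z.id. Qed.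

Lemma scan_spec st k : (forall x : nat, arr st amark (Z.of_nat x) = 0%Z) ->
  wpc scan (fun st' k' =>
    [/\ var st' vcnt = Z.of_nat (size (letters G n)), var st' vS = Z.of_nat S,
      forall i, i < size (letters G n) -> arr st' adist (Z.of_nat i) = Z.of_nat (nth 0 (letters G n) i)
    & k' <= k + n * (body_cost + 10) + 100]) st k.
Proof.
move=> h0; split; first by []. split; first by [].
apply: (wp_for_simple (n := n) (T := body_cost) (I := fun i s =>
  [/\ var s vcnt = Z.of_nat (size (letters G i)), var s vS = Z.of_nat (weight G i),
   forall x : nat, arr s amark (Z.of_nat x) = Z.b2z (x \in letters G i)
  & forall j, j < size (letters G i) -> arr s adist (Z.of_nat j) = Z.of_nat (nth 0 (letters G i) j)])).
- exact: I.
- by [].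
- by have := nw4; clear; lia.
- by [].
- by rewrite /weight /letters take0.
- move=> i s k' hi [e1 e2 e3 e4] fr; have ch := char_text hi.
  have hs : i < size (input G) by rewrite size_input ltn_addr.
  have sl : size (letters G i) < n by apply: leq_ltn_trans (size_letters G i) hi.
  have nl := n_lim.
  wpsimpl s; rewrite !charE e1 e2 e3; vc; try by []; try (by move: hs ch alph_lim sl nl; clear; lia).
  + by case: (_ \in _); apply: (wordn (x := 1)) || apply: (wordn (x := 0)); have := nw4; move: hi; clear; lia.
  + by apply: (wordn (x := 0)); rewrite expn_gt0.
  have := take_letters hs; case: ifP => hm e; rewrite /=.
    by vc; [rewrite /weight e; split | rewrite -!addnA leq_add2l].
  vc; try by []; try (by move: hs ch alph_lim sl nl; clear; lia).
  + by apply: wordn; apply: leq_trans ch (ltnW text_w).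
  + split=> /=.
    * by rewrite e size_rcons; clear; lia.
    * by rewrite /weight e map_rcons sumn_rcons Nat2Z.id /=; clear; lia.
    * move=> x; rewrite e mem_rcons inE e3.
      have -> : Z.eqb (Z.of_nat x) (Z.of_nat (char G i)) = (x == char G i) by clear; lia.
      by case: eqP.
    * move=> j; rewrite e size_rcons ltnS nth_rcons => hj.
      have -> : Z.eqb (Z.of_nat j) (Z.of_nat (size (letters G i))) = (j == size (letters G i)) by clear; lia.
      case: eqP => [->|ne]; first by rewrite ltnn.
      by rewrite e4 ?ifT //; move: hj ne; clear; lia.
  + by rewrite -!addnA leq_add2l.
- by move=> s k' [e1 e2 e3 e4] fr hk; split=> //; move: hk => /=; move: (n * _) => z; clear; lia.
Qed.

Lemma search_pos S0 i : 0 < iter i (search S0 lg) 1.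
Proof. by elim: i => //= i; rewrite /search; case: ifP => // _; clear; lia. Qed.

(** A doubling happens only if D^2 lg < S, so the square stays below 4 S; this keeps the product
    tested by the program a word. *)
Lemma search_le S0 i : lg <= S0 -> iter i (search S0 lg) 1 * iter i (search S0 lg) 1 * lg <= 4 * S0.
Proof.
move=> h; elim: i => [|i IH] /=; first by rewrite !mul1n; apply: leq_trans h (leq_pmull _ _).
by move: IH; move: (iter i _ _) => x IH; rewrite /search; case: ifP => // h1; rewrite mulnACA -mulnA leq_mul2l /= ltnW.
Qed.

Lemma params_spec st k : var st vlg = Z.of_nat lg -> var st vS = Z.of_nat S ->
  wpc (params K c) (fun st' k' =>
    [/\ var st' vD = Z.of_nat D, var st' vB = Z.of_nat B, var st' vR = Z.of_nat rnd
    & k' <= k + (c * lg) * (body_cost + 10) + 200]) st k.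
Proof.
move=> e1 e2.
have lw : lg < 2 ^ w.
  have /andP[_ h1] := lg_bounds m0 mn; have := ltn_expl lg (isT : 1 < 2); have := nw4.
  by move: h1; move: (2 ^ lg) => x; clear; lia.
do 4 (split; first by []); split.
  by rewrite /= e1 e2; vc => //; apply: wordn; move: S_w lw; clear; lia.
rewrite [test_val _ _ _ _]/= e1 e2.
have -> : Z.ltb (Z.of_nat S) (Z.of_nat lg) = (S < lg) by clear; lia.
rewrite /cutoff; case: ltnP => h.
  split=> //=.
  by rewrite -!addnA leq_add2l; apply: leq_trans (leq_addl _ _).
have D0 i : (iter i (search S lg) 1 == 0) = false by have := search_pos S i; case: (iter _ _ _).
split; first by []. apply: wp_seq.
apply: (wp_for_simple (n := c * lg) (T := 100) (I := fun i s => var s vD = Z.of_nat (iter i (search S lg) 1))).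
- exact: I.
- by rewrite /= e1; clear; lia.
- exact: count_w.
- by [].
- by [].
- move=> i s k' hi e fr.
  have [g1 g2] : var s vlg = Z.of_nat lg /\ var s vS = Z.of_nat S.
    by case: fr => fv _ _ _; rewrite !fv.
  have sl := search_le i h; have sp := search_pos S i.
  wpsimpl s; rewrite e g1 g2 iterS.
  move: (iter i (search S lg) 1) sl sp => x sl sp; rewrite /search.
  have -> : (Z.of_nat x * Z.of_nat x * Z.of_nat lg)%Z = Z.of_nat (x * x * lg) by rewrite !Nat2Z.inj_mul.
  vc; try by []; try (by apply: wordn; move: S_w sl; move: (x * x * lg) => y; clear; lia).
  have -> : Z.ltb (Z.of_nat (x * x * lg)) (Z.of_nat S) = (x * x * lg < S) by clear; lia.
  case: (x * x * lg < S); vc; try by []; try (by clear; lia); try by rewrite -!addnA leq_add2l.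
- move=> s k' e fr hk.
  have g1 : var s vlg = Z.of_nat lg by case: fr => fv _ _ _; have := fv vlg erefl => /= ->.
  do 2 (split; first by []).
  rewrite /= /buckets /rounds D0 e g1; split; rewrite ?e //; try by clear; lia.
    by move: (iter _ _ _) => x; change ((4 * Z.of_nat x)%Z = Z.of_nat (4 * x)%N); clear; lia.
  by move: hk; rewrite /test_size /= /body_cost; move: (c * lg) => z; clear; lia.
Qed.

Lemma addZ a b : (Z.of_nat a + Z.of_nat b)%Z = Z.of_nat (a + b).
Proof. by clear; lia. Qed.

Lemma mulZ a b : (Z.of_nat a * Z.of_nat b)%Z = Z.of_nat (a * b).
Proof. by clear; lia. Qed.

Lemma eqb_nat i j : Z.eqb (Z.of_nat j) (Z.of_nat i) = (j == i).
Proof. by clear; lia. Qed.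

Lemma bits_spec a bnd len body (u : nat -> bool) st k :
  safe w G lim st bnd -> eval w G st bnd = Z.of_nat len -> len < 2 ^ w -> loop_size vp bnd <= 7 ->
  (forall i s k', i < len -> frame (For vp bnd body) st s ->
     wpc body (fun s2 k2 => (forall j : nat, arr s2 a (Z.of_nat j) =
       if j == i then Z.b2z (u i) else arr s a (Z.of_nat j)) /\ k2 <= k' + body_cost)
       (setv s vp (Z.of_nat i)) k') ->
  wpc (For vp bnd body) (fun st' k' => (forall j : nat, arr st' a (Z.of_nat j) =
    if j < len then Z.b2z (u j) else arr st a (Z.of_nat j)) /\
    k' <= k + len * (body_cost + 10) + 8) st k.
Proof.
move=> h1 h2 h3 h4 hb.
apply: (wp_for_simple (n := len) (T := body_cost) (I := fun i s => forall j : nat,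
  arr s a (Z.of_nat j) = if j < i then Z.b2z (u j) else arr st a (Z.of_nat j))) => //.
move=> i s k' hi hI fr; apply: wp_mono (hb i s k' hi fr) => s2 k2 [h hk]; split=> // j.
by rewrite h ltnS leq_eqVlt; case: eqP => [->|_] //=; rewrite hI.
Qed.

Definition marked st (b : nat -> bool) :=
  forall p, p < n %/ m * m -> arr st abad (Z.of_nat p) = Z.b2z (b p).

(** The last blocks read the text array past its end; zeros there create no marks. *)
Definition clean st := forall j, n <= j -> arr st aU (Z.of_nat j) = 0%Z.

Lemma conv_marked u v b st k : par q L st -> var st vnb = Z.of_nat (n %/ m) ->
  (forall j : nat, arr st aU (Z.of_nat j) = Z.b2z (u j)) ->
  (forall j : nat, j < m -> arr st aV (Z.of_nat j) = Z.b2z (v j)) -> marked st b ->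
  wpc conv (fun st' k' => marked st' (fun p => b p || hit m u v p) /\
    k' <= k + (n %/ m).+1 * (10 * tcost L)) st k.
Proof.
move=> h1 h2 h3 h4 h5; eapply wp_use; first by apply: conv_spec' h1 h2 (fun j _ => h3 j) h4.
move=> st' k' [h6 h7] _; split=> // p hp; rewrite h6 hp /=.
by case: (hit m u v p); rewrite ?orbT ?orbF // h5.
Qed.

Lemma B_gt1 : 1 < B.
Proof. by rewrite /buckets; case: (D) => [|x] //=; clear; lia. Qed.

Lemma B_w : B < 2 ^ w.
Proof. by rewrite B_pow ltn_exp2l. Qed.

Lemma D_w : D < 2 ^ w.
Proof. by apply: leq_ltn_trans B_w; rewrite /buckets; case: (D) => [|x] //=; clear; lia. Qed.

Lemma rnd_w : rnd < 2 ^ w.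
Proof.
rewrite /rounds; case: ifP => _; last exact: ltnW.
by have := B_gt1; have := B_w; clear; lia.
Qed.

Lemma bucket_lt r x : bucket w B r x < B.
Proof.
have e : 2 ^ w = B * (2 ^ w %/ B).
  by rewrite B_pow [in RHS]mulnC divnK // dvdn_exp2l // ltnW.
rewrite /bucket ltn_divLR ?divn_gt0 ?(leq_trans _ B_gt1) //; last exact: ltnW B_w.
by rewrite -e ltn_mod expn_gt0.
Qed.

Notation gap := (2 ^ w %/ B).

Lemma gap_gt0 : 0 < gap.
Proof. by rewrite divn_gt0 ?(leq_trans _ B_gt1) //; exact: ltnW B_w. Qed.

Lemma bucketE r x : ((Z.of_nat r * Z.of_nat x) mod W w / Z.of_nat gap)%Z = Z.of_nat (bucket w B r x).
Proof.
rewrite /W -Nat2Z.inj_mul -of_nat_modn ?expn_gt0 //.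
by rewrite -of_nat_divn // gap_gt0.
Qed.

Lemma gapE : ((Z.of_nat 0 - Z.of_nat 1) mod W w / Z.of_nat B + Z.of_nat 1)%Z = Z.of_nat gap.
Proof.
have w0 := expn_gt0 2 w; have B1 := B_gt1; have g0 := gap_gt0.
have e : 2 ^ w = B * gap by rewrite B_pow [in RHS]mulnC divnK // dvdn_exp2l // ltnW.
have -> : ((Z.of_nat 0 - Z.of_nat 1) mod W w)%Z = (W w - 1)%Z.
  by symmetry; apply: (Z.mod_unique _ _ (-1)); [left|]; move: w0; rewrite /W; clear; lia.
have -> : ((W w - 1) / Z.of_nat B)%Z = (Z.of_nat gap - 1)%Z.
  symmetry; apply: (Z.div_unique _ _ _ (Z.of_nat B - 1)); first by left; move: B1; clear; lia.
  by rewrite /W {1}e Nat2Z.inj_mul; ring.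
by clear; lia.
Qed.

(** State of the table while row [i] has received its first [k] neighbours. All stamps are at most
    rep + 1, so none equals the stamp of the next round. *)
Definition table st r rep i k :=
  (forall x : nat, (0 <= arr st atab (Z.of_nat x) <= Z.of_nat rep.+1)%Z) /\
  forall i' b, b < B -> Z.eqb (arr st atab (Z.of_nat (i' * B + b))) (Z.of_nat rep.+1) =
    [&& i' < i, degree G (char G i') <= D & covered w G B r i' b] ||
    (i' == i) && has (fun k => bucket w B r (nbr_oracle G (char G i) k) == b) (iota 0 k).

Lemma table_step st r rep i :
  table st r rep i (if degree G (char G i) <= D then degree G (char G i) else 0) ->
  table st r rep i.+1 0.
Proof.
move=> [h1 h2]; split=> // i' b hb; rewrite h2 //= andbF orbF ltnS [in RHS]leq_eqVlt.
case: eqP => [->|_] /=; last by rewrite orbF.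
by rewrite ltnn /= /covered; case: (_ <= D).
Qed.

Lemma fill_table_spec r rep st k : rep < rnd -> var st vran = Z.of_nat r -> var st vG = Z.of_nat gap ->
  var st vB = Z.of_nat B -> var st vD = Z.of_nat D -> var st vrep = Z.of_nat rep ->
  (forall x : nat, (0 <= arr st atab (Z.of_nat x) <= Z.of_nat rep)%Z) ->
  wpc fill_table (fun st' k' => table st' r rep n 0 /\
    k' <= k + n * (D * (body_cost + 10) + body_cost + 10) + 8) st k.
Proof.
move=> hr e1 e2 e3 e4 e5 h0; rewrite /fill_table /hash.
have nl := n_lim; have n4 := nw4.
apply: (wp_for_simple (n := n) (T := D * (body_cost + 10) + body_cost) (I := fun i s => table s r rep i 0)).
- exact: I.
- by [].
- by move: n4; clear; lia.
- by [].
- split=> [x|i b hb]; first by have := h0 x; clear; lia.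
  by rewrite ltn0 /= andbF; apply/Z.eqb_neq; have := h0 (i * B + b); clear; lia.
- move=> i s k' hi hI fr; have ch := char_text hi.
  split; first by rewrite /=; vc => //; move: hi mn; rewrite ?size_input; clear; lia.
  split; first by rewrite /= charE; vc => //; apply: wordn; apply: leq_trans ch (ltnW text_w).
  set s1 := setv _ vdeg _.
  have s1v : var s1 va = Z.of_nat (char G i) by rewrite /s1 /= charE.
  have s1d : var s1 vdeg = Z.of_nat (degree G (char G i)) by rewrite /s1 /= charE Nat2Z.id.
  have s1D : var s1 vD = Z.of_nat D by rewrite /s1 /=; case: fr => -> .
  have s1B : var s1 vB = Z.of_nat B by rewrite /s1 /=; case: fr => -> .
  have s1r : var s1 vran = Z.of_nat r by rewrite /s1 /=; case: fr => -> .
  have s1G : var s1 vG = Z.of_nat gap by rewrite /s1 /=; case: fr => -> .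
  have s1p : var s1 vrep = Z.of_nat rep by rewrite /s1 /=; case: fr => -> .
  have s1i : var s1 vp = Z.of_nat i by [].
  have hI1 : table s1 r rep i 0 by [].
  move: s1 s1v s1d s1D s1B s1r s1G s1p s1i hI1 => s1 s1v s1d s1D s1B s1r s1G s1p s1i hI1.
  split; first by rewrite /= s1d s1D; vc => //; apply: wordn => //; exact: D_w.
  rewrite [test_val _ _ _ _]/= s1d s1D.
  have -> : Z.ltb (Z.of_nat D) (Z.of_nat (degree G (char G i))) = (D < degree G (char G i)) by clear; lia.
  case: ltnP => hd.
    split; first by apply: table_step; rewrite leqNgt hd.
    rewrite -!addnA leq_add2l; apply: leq_trans (leq_addl _ _); by [].
  apply: (wp_for_simple (n := degree G (char G i)) (T := body_cost) (I := fun k s => table s r rep i k)).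
  + exact: I.
  + by [].
  + exact: degree_w.
  + by [].
  + exact: hI1.
  + move=> kk s2 k2 hk [h1 h2] fr2.
    have [f1 f2 f3 f4] : [/\ var s2 va = Z.of_nat (char G i), var s2 vB = Z.of_nat B, var s2 vran = Z.of_nat r & var s2 vG = Z.of_nat gap].
      by case: fr2 => fv _ _ _; rewrite !fv.
    have [f5 f6] : var s2 vrep = Z.of_nat rep /\ var s2 vp = Z.of_nat i.
      by case: fr2 => fv _ _ _; rewrite !fv.
    have hb := bucket_lt r (nbr_oracle G (char G i) kk).
    have hg : is_word w (Z.of_nat gap).
      by apply: wordn; rewrite ltn_Pdiv ?expn_gt0 ?B_gt1.
    wpsimpl s2; rewrite f1 f2 f3 f4 f5 f6 !Nat2Z.id bucketE (mulZ i) (addZ (i * B)).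
    have ib : i * B + bucket w B r (nbr_oracle G (char G i) kk) < n * B.
      apply: leq_trans (_ : i.+1 * B <= _); first by rewrite mulSn addnC ltn_add2r.
      by rewrite leq_mul2r hi orbT.
    vc; try by [].
    * by apply: wordn; apply: leq_trans ch (ltnW text_w).
    * by apply: wordn; apply: ltn_trans hk (degree_w _).
    * by rewrite /is_word; apply: Z.mod_pos_bound; have := expn_gt0 2 w; rewrite /W; clear; lia.
    * by have := gap_gt0; clear; lia.
    * by clear; lia.
    * by move: ib tab_lim; move: (n * B) => z; clear; lia.
    * split=> [x|i' b hb'].
        cbv beta iota zeta delta [arr Nat.eqb]; fold (arr s2); rewrite eqb_nat.
        by case: eqP => _; [clear; lia | exact: h1].
      cbv beta iota zeta delta [arr Nat.eqb]; fold (arr s2); rewrite eqb_nat pair_eqn // -(addn1 kk) iotaD has_cat /= orbF add0n.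
      have := h2 i' b hb'; rewrite [b == _]eq_sym.
      case: (i' == i); case: (bucket _ _ _ _ == b); rewrite /= ?andbT ?andbF ?orbF ?orbT //= => _.
      by apply/Z.eqb_eq; clear; lia.
    * by rewrite -?addnA leq_add2l.
  + move=> s2 k2 hT _ hk; split; first by apply: table_step; rewrite /= hd; case: hT.
    have : degree G (char G i) * (body_cost + 10) <= D * (body_cost + 10) by rewrite leq_mul2r hd orbT.
    rewrite /test_size /= in hk; move: hk.
    by move: (degree _ _ * _) (D * _) => x y; rewrite /body_cost; clear; lia.
- by move=> s k' hI _ hk; split.
Qed.

Lemma light_text_spec r rep b st k : b < B -> rep < rnd -> var st vB = Z.of_nat B ->
  var st vD = Z.of_nat D -> var st vrep = Z.of_nat rep -> var st vbeta = Z.of_nat b ->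
  table st r rep n 0 ->
  wpc light_text (fun st' k' => (forall j : nat, arr st' aU (Z.of_nat j) =
      if j < n then Z.b2z (light_u w G D B r b j) else arr st aU (Z.of_nat j)) /\
    k' <= k + n * (body_cost + 10) + 8) st k.
Proof.
move=> hb hr e1 e2 e3 e4 [h1 h2]; have nl := n_lim; have n4 := nw4.
apply: bits_spec => //; first by move: n4; clear; lia.
move=> i s k' hi fr; have ch := char_text hi.
have [f1 f2 f3 f4] : [/\ var s vB = Z.of_nat B, var s vD = Z.of_nat D, var s vrep = Z.of_nat rep & var s vbeta = Z.of_nat b].
  by case: fr => fv _ _ _; rewrite !fv.
have ft x : arr s atab x = arr st atab x by case: fr => _ -> .
have ib : i * B + b < n * B.
  apply: leq_trans (_ : i.+1 * B <= _); first by rewrite mulSn addnC ltn_add2r.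
  by rewrite leq_mul2r hi orbT.
have rw : rep.+1 < 2 ^ w by apply: leq_ltn_trans rnd_w.
wpsimpl s; rewrite charE f1 f2 f3 f4 Nat2Z.id mulZ addZ ft.
have -> : (Z.of_nat rep + Z.of_nat 1)%Z = Z.of_nat rep.+1 by clear; lia.
have -> : Z.ltb (Z.of_nat D) (Z.of_nat (degree G (char G i))) = (D < degree G (char G i)) by clear; lia.
have hu : light_u w G D B r b i = (degree G (char G i) <= D) && ~~ Z.eqb (arr st atab (Z.of_nat (i * B + b))) (Z.of_nat rep.+1).
  by rewrite h2 // hi /= andbF orbF /light_u hi /=; case: (_ <= D).
vc; try by []; try (by move: hi mn; rewrite ?size_input; clear; lia).
- by apply: wordn; apply: leq_trans ch (ltnW text_w).
- by apply: wordn; exact: D_w.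
- by apply: wordn.
case: ltnP => hd; vc; try by []; try (by move: hi nl; clear; lia).
- by move=> j /=; rewrite eqb_nat; case: eqP => // _; rewrite hu leqNgt hd.
- by rewrite -!addnA leq_add2l.
- by move: ib tab_lim; move: (n * B) => z; clear; lia.
- by have := h1 (i * B + b); move: rw; rewrite /is_word /W; clear; lia.
- exact: wordn.
case E: Z.eqb; rewrite E in hu; vc; try by []; try (by move: hi nl; clear; lia); try by rewrite -!addnA leq_add2l.
- by move=> j /=; rewrite eqb_nat; case: eqP => // _; rewrite hu hd.
- by move=> j /=; rewrite eqb_nat; case: eqP => // _; rewrite hu hd.
Qed.

Lemma light_pattern_spec r b st k : b < B -> var st vran = Z.of_nat r -> var st vG = Z.of_nat gap ->
  var st vbeta = Z.of_nat b ->
  wpc light_pattern (fun st' k' => (forall j : nat, arr st' aV (Z.of_nat j) =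
      if j < m then Z.b2z (light_v w G B r b j) else arr st aV (Z.of_nat j)) /\
    k' <= k + m * (body_cost + 10) + 8) st k.
Proof.
move=> hb e1 e2 e3; have nl := n_lim; have n4 := nw4; rewrite /light_pattern /hash.
apply: bits_spec => //; first by move: n4 mn; clear; lia.
move=> i s k' hi fr.
have [f1 f2 f3] : [/\ var s vran = Z.of_nat r, var s vG = Z.of_nat gap & var s vbeta = Z.of_nat b].
  by case: fr => fv _ _ _; rewrite !fv.
have hg : is_word w (Z.of_nat gap).
  by apply: wordn; rewrite ltn_Pdiv ?expn_gt0 ?B_gt1.
wpsimpl s; rewrite addZ charE f1 f2 f3 bucketE.
vc; try by []; try (by move: hi; rewrite ?size_input; clear; lia).
- by rewrite /is_word; apply: Z.mod_pos_bound; have := expn_gt0 2 w; rewrite /W; clear; lia.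
- by have := gap_gt0; clear; lia.
- by apply: wordn; apply: ltn_trans (bucket_lt _ _) B_w.
- by apply: wordn; apply: ltn_trans hb B_w.
rewrite eqb_nat -/(light_v w G B r b i); case E: (light_v _ _ _ _ _ _); vc; try by [];
  try (by move: hi mn nl; clear; lia); try by rewrite -!addnA leq_add2l.
- by move=> j /=; rewrite eqb_nat; case: eqP => // _; rewrite E.
- by move=> j /=; rewrite eqb_nat; case: eqP => // _; rewrite E.
Qed.


Definition col_cost := (n + m) * (body_cost + 10) + (n %/ m).+1 * (10 * tcost L) + 50.

Definition draw i := word w (nth 0 tape i).

Definition light_bad rep p :=
  has (fun b => hit m (light_u w G D B (draw rep) b) (light_v w G B (draw rep) b) p) (iota 0 B).

Definition heavies := filter (fun x => D < degree G x) (letters G n).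

Definition heavy_bad x p := hit m (heavy_u G x) (heavy_v G x) p.

Definition bad p := has (light_bad^~ p) (iota 0 rnd) || has (heavy_bad^~ p) heavies.

Definition light_cost := n * (D * (body_cost + 10) + body_cost + 10) + B * (col_cost + 10) + body_cost.

Lemma light_u_out r b j : n <= j -> light_u w G D B r b j = false.
Proof. by rewrite /light_u leqNgt => /negbTE ->. Qed.

(** The invariant [used s = rep] ties each round to the tape word of the same index; the
    independence of the rounds in the error analysis rests on it. *)
Lemma light_spec st k : par q L st -> var st vnb = Z.of_nat (n %/ m) -> var st vR = Z.of_nat rnd ->
  var st vB = Z.of_nat B -> var st vD = Z.of_nat D -> used st = 0 -> marked st xpred0 -> clean st ->
  (forall x : nat, arr st atab (Z.of_nat x) = 0%Z) ->
  wpc light (fun st' k' => [/\ marked st' (fun p => has (light_bad^~ p) (iota 0 rnd)), clean st'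
    & k' <= k + rnd * (light_cost + 10) + 8]) st k.
Proof.
move=> hp e1 e2 e3 e4 hu hm hc ht; have bw := B_w; have b1 := B_gt1.
apply: (wp_for_simple (n := rnd) (T := light_cost) (I := fun rep s =>
  [/\ used s = rep, marked s (fun p => has (light_bad^~ p) (iota 0 rep)), clean s &
    forall x : nat, (0 <= arr s atab (Z.of_nat x) <= Z.of_nat rep)%Z])).
- exact: I.
- by rewrite /= e2.
- exact: rnd_w.
- by [].
- by split=> // x; rewrite ht; clear; lia.
- move=> rep s k' hr [u1 m1 c1 t1] fr.
  have hp1 : par q L s by refine (par_frame _ fr hp).
  have [f1 f2 f3] : [/\ var s vnb = Z.of_nat (n %/ m), var s vB = Z.of_nat B & var s vD = Z.of_nat D].
    by case: fr => fv _ _ _; rewrite !fv.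
  split.
    rewrite /= f2; vc => //.
    + by rewrite /is_word; apply: Z.mod_pos_bound; have := expn_gt0 2 w; rewrite /W; clear; lia.
    + exact: wordn.
    + by move: b1; clear; lia.
  set s1 := setv _ vG _.
  have g1 : var s1 vran = Z.of_nat (draw rep) by rewrite /s1 /= u1.
  have g2 : var s1 vG = Z.of_nat gap by rewrite /s1 /= f2 gapE.
  have [g3 g4] : var s1 vB = Z.of_nat B /\ var s1 vD = Z.of_nat D by [].
  have [g5 g6] : var s1 vrep = Z.of_nat rep /\ var s1 vnb = Z.of_nat (n %/ m) by [].
  have hp2 : par q L s1 by case: hp1 => *; split.
  have m2 : marked s1 (fun p => has (light_bad^~ p) (iota 0 rep)) by [].
  have c2 : clean s1 by []. have u2 : used s1 = rep.+1 by rewrite /s1 /= u1.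
  have t2 : forall x : nat, (0 <= arr s1 atab (Z.of_nat x) <= Z.of_nat rep)%Z by [].
  move: s1 g1 g2 g3 g4 g5 g6 hp2 m2 c2 u2 t2 => s1 g1 g2 g3 g4 g5 g6 hp2 m2 c2 u2 t2.
  apply: wp_seq; eapply wp_use; first exact: (fill_table_spec _ hr g1 g2 g3 g4 g5 t2).
  move=> s2 k2 [t3 hk2] fr2.
  have hp3 : par q L s2 by refine (par_frame _ fr2 hp2).
  have [a1 a2 a3 a4] : [/\ var s2 vran = Z.of_nat (draw rep), var s2 vG = Z.of_nat gap, var s2 vB = Z.of_nat B & var s2 vD = Z.of_nat D].
    by case: fr2 => fv _ _ _; rewrite !fv.
  have [a5 a6 a7] : [/\ var s2 vrep = Z.of_nat rep, var s2 vnb = Z.of_nat (n %/ m) & used s2 = rep.+1].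
    by case: fr2 => fv _ fu _; rewrite !fv // fu.
  have m3 : marked s2 (fun p => has (light_bad^~ p) (iota 0 rep)).
    by move=> p /m2; case: fr2 => _ -> .
  have c3 : clean s2 by move=> p /c2; case: fr2 => _ -> .
  apply: (wp_for_simple (n := B) (T := col_cost) (I := fun b s =>
    marked s (fun p => has (light_bad^~ p) (iota 0 rep) ||
      has (fun b => hit m (light_u w G D B (draw rep) b) (light_v w G B (draw rep) b) p) (iota 0 b)) /\ clean s)).
  + exact: I.
  + exact: a3.
  + exact: bw.
  + by [].
  + by split=> // p hpm; rewrite /= orbF; apply: m3.
  + move=> b s3 k3 hb [m4 c4] fr3.
    have hp4 : par q L (setv s3 vbeta (Z.of_nat b)).
      by have : par q L s3 by [refine (par_frame _ fr3 hp3)]; case=> *; split.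
    have t4 : table s3 (draw rep) rep n 0.
      by case: t3 => h1 h2; case: fr3 => _ fa _ _; split=> [x|i' b' hb']; rewrite fa //; apply: h2.
    have [d1 d2 d3 d4] : [/\ var s3 vran = Z.of_nat (draw rep), var s3 vG = Z.of_nat gap, var s3 vB = Z.of_nat B & var s3 vD = Z.of_nat D].
      by case: fr3 => fv _ _ _; rewrite !fv.
    have [d5 d6] : var s3 vrep = Z.of_nat rep /\ var s3 vnb = Z.of_nat (n %/ m).
      by case: fr3 => fv _ fu _; rewrite !fv.
    apply: wp_seq; eapply wp_use; first exact: (light_text_spec (r := draw rep) (rep := rep) (b := b)).
    move=> s4 k4 [hU hk4] fr4; apply: wp_seq; eapply wp_use.
      by apply: (light_pattern_spec (r := draw rep) (b := b)) => //; case: fr4 => -> .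
    move=> s5 k5 [hV hk5] fr5; eapply wp_use.
      apply: (conv_marked (u := light_u w G D B (draw rep) b) (v := light_v w G B (draw rep) b)).
      * by refine (par_frame _ fr5 _) => //; refine (par_frame _ fr4 hp4).
      * by case: fr5 => -> // _ _ _; case: fr4 => -> //.
      * move=> j; case: fr5 => _ -> // _ _; rewrite hU; case: ltnP => // hj.
        by rewrite light_u_out // c4.
      * by move=> j hj; rewrite hV hj.
      * move=> p hpm; case: fr5 => _ -> // _ _; case: fr4 => _ -> // _ _; exact: m4.
    move=> s6 k6 [m5 hk6] fr6; split; last first.
      by move: hk4 hk5 hk6; rewrite /col_cost mulnDl; move: (n * _) (m * _) (_.+1 * _) => x y z; clear; lia.
    split.
      by move=> p hpm; rewrite m5 // -[in RHS](addn1 b) iotaD has_cat /= orbF add0n orbA.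
    move=> j hj; case: fr6 => _ -> // _ _; case: fr5 => _ -> // _ _; rewrite hU ltnNge hj /=.
    exact: c4.
  + move=> s3 k3 [m4 c4] fr3 hk3; split; last first.
      move: hk2 hk3; rewrite /light_cost /=; move: (n * _) (B * _) => x y; rewrite /body_cost; clear; lia.
    split=> //.
    * by case: fr3 => _ _ fu _; have /= -> := fu erefl.
    * move=> p hpm; change (arr s3 abad (Z.of_nat p) = Z.b2z (has (light_bad^~ p) (iota 0 rep.+1))).
      by rewrite m4 // -(addn1 rep) iotaD has_cat /= orbF add0n.
    * by move=> x; case: t3 => h1 _; case: fr3 => _ /= fa _ _; rewrite fa.
- by move=> s k' [_ m1 c1 _] _ hk; split.
Qed.

Lemma select_heavy_spec st k : var st vcnt = Z.of_nat (size (letters G n)) -> var st vD = Z.of_nat D ->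
  (forall i, i < size (letters G n) -> arr st adist (Z.of_nat i) = Z.of_nat (nth 0 (letters G n) i)) ->
  wpc select_heavy (fun st' k' => [/\ var st' vcnt2 = Z.of_nat (size heavies),
    forall i, i < size heavies -> arr st' aheavy (Z.of_nat i) = Z.of_nat (nth 0 heavies i)
    & k' <= k + n * (body_cost + 10) + 50]) st k.
Proof.
move=> e1 e2 e3; have sl := size_letters G n; have nl := n_lim; have n4 := nw4.
split; first by [].
apply: (wp_for_simple (n := size (letters G n)) (T := body_cost) (I := fun i s =>
  let h := filter (fun x => D < degree G x) (take i (letters G n)) in
  var s vcnt2 = Z.of_nat (size h) /\
  forall j, j < size h -> arr s aheavy (Z.of_nat j) = Z.of_nat (nth 0 h j))).
- exact: I.
- by [].
- by move: sl n4; clear; lia.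
- by [].
- by rewrite take0.
- move=> i s k' hi [h1 h2] fr.
  have f1 : var s vD = Z.of_nat D by case: fr => fv _ _ _; rewrite fv.
  have f2 : arr s adist (Z.of_nat i) = Z.of_nat (nth 0 (letters G n) i) by case: fr => _ -> // _ _; apply: e3.
  have hx : nth 0 (letters G n) i < text_alph G.
    by apply: letters_lt; apply: mem_nth.
  wpsimpl s; rewrite f1 f2 h1 Nat2Z.id (take_nth 0) // filter_rcons.
  have sh : size (filter (fun x => D < degree G x) (take i (letters G n))) <= i.
    by rewrite size_filter (leq_trans (count_size _ _)) // size_take hi.
  move: (filter _ (take i _)) h1 h2 sh => h h1 h2 sh.
  move: (nth 0 (letters G n) i) hx f2 => x hx f2.
  have -> : Z.ltb (Z.of_nat D) (Z.of_nat (degree G x)) = (D < degree G x) by clear; lia.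
  vc; try by []; try (by move: hi sl nl; clear; lia).
  + by apply: wordn; apply: leq_trans hx (ltnW text_w).
  + by apply: wordn; exact: D_w.
  + exact: wordn.
  case: (D < degree G x); vc; try by []; try (by move: hi sh sl nl; clear; lia); try by rewrite -!addnA leq_add2l.
  + by rewrite size_rcons; clear; lia.
  + move=> j; rewrite size_rcons ltnS nth_rcons eqb_nat => hj.
    case: eqP => [->|ne]; first by rewrite ltnn.
    by rewrite h2 ?ifT //; move: hj ne; clear; lia.
- move=> s k'; rewrite take_size => -[h1 h2] _ hk; split; [exact: h1 | exact: h2 |].
  have : size (letters G n) * (body_cost + 10) <= n * (body_cost + 10) by rewrite leq_mul2r sl orbT.
  by move: hk => /=; move: (_ * (body_cost + 10)) (n * _) => x y; clear; lia.
Qed.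

Lemma heavy_text_spec x st k : var st va = Z.of_nat x -> x < 2 ^ w ->
  wpc heavy_text (fun st' k' => (forall j : nat, arr st' aU (Z.of_nat j) =
      if j < n then Z.b2z (heavy_u G x j) else arr st aU (Z.of_nat j)) /\
    k' <= k + n * (body_cost + 10) + 8) st k.
Proof.
move=> e1 xw; have nl := n_lim; have n4 := nw4.
apply: bits_spec => //; first by move: n4; clear; lia.
move=> i s k' hi fr; have ch := char_text hi.
have f1 : var s va = Z.of_nat x by case: fr => fv _ _ _; rewrite fv.
wpsimpl s; rewrite charE f1 eqb_nat; vc; try by []; try (by move: hi; rewrite ?size_input; clear; lia).
- by apply: wordn; apply: leq_trans ch (ltnW text_w).
- exact: wordn.
have hu : heavy_u G x i = (char G i == x) by rewrite /heavy_u hi.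
case E: (char G i == x); rewrite E in hu; vc; try by []; try (by move: hi nl; clear; lia); try by rewrite -!addnA leq_add2l.
- by move=> j /=; rewrite eqb_nat; case: eqP => // _; rewrite hu.
- by move=> j /=; rewrite eqb_nat; case: eqP => // _; rewrite hu.
Qed.

Lemma char_pattern j : j < m -> char G (n + j) < pat_alph G.
Proof.
move=> hj; rewrite /char nth_cat size_map size_tuple.
have -> : (n + j < n) = false by rewrite ltnNge leq_addr.
rewrite addKn.
have : all (fun x => x < pat_alph G) [seq val a | a <- pattern G].
  by apply/allP => x /mapP[y _ ->]; exact: ltn_ord.
by move/(all_nthP 0) => -> //; rewrite size_map size_tuple.
Qed.

Lemma heavy_pattern_spec x st k : var st va = Z.of_nat x -> x < 2 ^ w ->
  wpc heavy_pattern (fun st' k' => (forall j : nat, arr st' aV (Z.of_nat j) =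
      if j < m then Z.b2z (heavy_v G x j) else arr st aV (Z.of_nat j)) /\
    k' <= k + m * (body_cost + 10) + 8) st k.
Proof.
move=> e1 xw; have nl := n_lim; have n4 := nw4.
apply: bits_spec => //; first by move: n4 mn; clear; lia.
move=> i s k' hi fr.
have f1 : var s va = Z.of_nat x by case: fr => fv _ _ _; rewrite fv.
wpsimpl s; rewrite addZ charE f1 !Nat2Z.id; vc; try by []; try (by move: hi mn nl; rewrite ?size_input; clear; lia).
- exact: wordn.
- by apply: wordn; apply: ltn_trans (char_pattern hi) pat_w.
- move=> j /=; rewrite eqb_nat; case: eqP => // _; rewrite /heavy_v.
  by case: (match_oracle _ _ _).
- by rewrite -?addnA leq_add2l.
Qed.

Lemma heavy_spec b0 st k : par q L st -> var st vnb = Z.of_nat (n %/ m) ->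
  var st vcnt2 = Z.of_nat (size heavies) ->
  (forall i, i < size heavies -> arr st aheavy (Z.of_nat i) = Z.of_nat (nth 0 heavies i)) ->
  marked st b0 -> clean st ->
  wpc heavy (fun st' k' => marked st' (fun p => b0 p || has (heavy_bad^~ p) heavies) /\
    k' <= k + size heavies * (col_cost + 20) + 8) st k.
Proof.
move=> hp e1 e2 e3 hm hc; have nl := n_lim; have n4 := nw4.
have hs : size heavies <= n.
  by rewrite size_filter (leq_trans (count_size _ _)) // size_letters.
apply: (wp_for_simple (n := size heavies) (T := col_cost + 10) (I := fun i s =>
  marked s (fun p => b0 p || has (heavy_bad^~ p) (take i heavies)) /\ clean s)).
- exact: I.
- by [].
- by move: hs n4; clear; lia.
- by [].
- by split=> // p hpm; rewrite take0 /= orbF; apply: hm.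
- move=> i s k' hi [m1 c1] fr.
  have hp1 : par q L s by refine (par_frame _ fr hp).
  have f2 : arr s aheavy (Z.of_nat i) = Z.of_nat (nth 0 heavies i) by case: fr => _ -> // _ _; apply: e3.
  have f1 : var s vnb = Z.of_nat (n %/ m) by case: fr => fv _ _ _; rewrite fv.
  split; first by rewrite /=; vc => //; move: hi hs nl; clear; lia.
  set s1 := setv _ va _.
  have g1 : var s1 va = Z.of_nat (nth 0 heavies i) by rewrite /s1 /= f2.
  have g2 : var s1 vnb = Z.of_nat (n %/ m) by [].
  have hp2 : par q L s1 by case: hp1 => *; split.
  have m2 : marked s1 (fun p => b0 p || has (heavy_bad^~ p) (take i heavies)) by [].
  have c2 : clean s1 by [].
  have xw : nth 0 heavies i < 2 ^ w.
    have : nth 0 heavies i \in heavies by apply: mem_nth.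
    by rewrite mem_filter => /andP[_ /letters_lt h]; apply: ltn_trans h text_w.
  rewrite (take_nth 0) //; move: (nth 0 heavies i) xw f2 g1 => x xw _ g1.
  move: s1 g1 g2 hp2 m2 c2 => s1 g1 g2 hp2 m2 c2.
  apply: wp_seq; eapply wp_use; first exact: (heavy_text_spec _ g1 xw).
  move=> s4 k4 [hU hk4] fr4; apply: wp_seq; eapply wp_use.
    by apply: (heavy_pattern_spec (x := x)) => //; case: fr4 => -> .
  move=> s5 k5 [hV hk5] fr5; eapply wp_use.
    apply: (conv_marked (u := heavy_u G x) (v := heavy_v G x)).
    + by refine (par_frame _ fr5 _) => //; refine (par_frame _ fr4 hp2).
    + by case: fr5 => -> // _ _ _; case: fr4 => -> //.
    + move=> j; case: fr5 => _ -> // _ _; rewrite hU; case: ltnP => // hj.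
      by rewrite /heavy_u ltnNge hj c2.
    + by move=> j hj; rewrite hV hj.
    + move=> p hpm; case: fr5 => _ -> // _ _; case: fr4 => _ -> // _ _; exact: m2.
  move=> s6 k6 [m5 hk6] fr6; split; last first.
    by move: hk4 hk5 hk6; rewrite /col_cost mulnDl /=; move: (n * _) (m * _) (_.+1 * _) => u v z; clear; lia.
  split.
    move=> p hpm; rewrite m5 // has_rcons /heavy_bad -orbA; congr (Z.b2z (_ || _)); exact: orbC.
  move=> j hj; case: fr6 => _ -> // _ _; case: fr5 => _ -> // _ _; rewrite hU ltnNge hj /=.
  exact: c2.
- move=> s k' [m1 c1] _ hk; split; first by rewrite take_size in m1.
  by have <- : col_cost + 10 + 10 = col_cost + 20 by rewrite -addnA.
Qed.

Lemma report_spec b st k : marked st b -> reps st = [::] ->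
  wpc report (fun st' k' => reps st' = map succn (filter (predC b) (iota 0 (n - m + 1))) /\
    k' <= k + n * (body_cost + 10) + 100) st k.
Proof.
move=> hm hr; have nl := n_lim; have n4 := nw4.
(* The whole blocks processed by [conv] cover every alignment because n mod m <= m - 1. *)
have hnm : n - m + 1 <= n %/ m * m.
  by have := divn_eq n m; have := ltn_pmod n m0; move: (n %/ m * m) (n %% m) => x y; move: m0 mn; clear; lia.
split; first by [].
apply: (wp_for_simple (n := n - m + 1) (T := body_cost) (I := fun i s =>
  reps s = map succn (filter (predC b) (iota 0 i)))).
- exact: I.
- by rewrite /=; move: mn; clear; lia.
- by move: n4 m0 mn; clear; lia.
- by [].
- exact: hr.
- move=> i s k' hi h fr.
  have hb : arr s abad (Z.of_nat i) = Z.b2z (b i).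
    by case: fr => _ -> // _ _; apply: hm; apply: leq_trans hi hnm.
  wpsimpl s; rewrite hb h -{1 2}(addn1 i) iotaD filter_cat map_cat /= add0n.
  vc; try by []; try (by move: hi nl m0 mn; clear; lia).
  + by case: (b i) => /=; rewrite /is_word /W; move: hi n4 m0 mn; clear; lia.
  + by apply: (wordn (x := 0)); rewrite expn_gt0.
  case: (b i) => /=; vc; try by []; try (by rewrite -!addnA leq_add2l).
  + by rewrite cats0.
  + by rewrite /is_word /W; move: hi m0 mn n4; clear; lia.
  + by rewrite cats1; congr rcons; clear; lia.
- move=> s k' h _ hk; split=> //.
  have : (n - m + 1) * (body_cost + 10) <= n * (body_cost + 10) by rewrite leq_mul2r; move: m0 mn; clear; lia.
  by move: hk => /=; move: (_ * (body_cost + 10)) (n * _) => x y; clear; lia.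
Qed.

Definition total_cost := n * 300 + 500 +
  (L * (N * (body_cost + 10) + (32 * L + 1) * (body_cost + 10) + body_cost) + body_cost) +
  (n * (body_cost + 10) + 100) + (c * lg * (body_cost + 10) + 200) +
  (rnd * (light_cost + 10) + 8) + (n * (body_cost + 10) + 50) +
  (size heavies * (col_cost + 20) + 8) + (n * (body_cost + 10) + 100).

Lemma gpm_spec k : wpc (gpm_cmd K c) (fun st' k' =>
    reps st' = map succn (filter (predC bad) (iota 0 (n - m + 1))) /\
    k' <= k + total_cost) start k.
Proof.
apply: wp_seq; eapply wp_use; first by eapply setup_spec; eassumption.
move=> s1 k1 [[r1 r2 r3 [r4 r5 r6 r7 [r8 r9]]] hk1] f1.
apply: wp_seq; eapply wp_use; first by eapply twiddles_spec; try eassumption; split=> //; split.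
move=> s2 k2 [p2 hk2] f2.
apply: wp_seq; eapply wp_use.
  apply: scan_spec => x; case: f2 => _ -> // _ _; case: f1 => _ -> //.
move=> s3 k3 [d1 d2 d3 hk3] f3.
apply: wp_seq; eapply wp_use.
  apply: params_spec => //; case: f3 => -> // _ _ _; case: f2 => -> //.
move=> s4 k4 [g1 g2 g3 hk4] f4.
have nb4 : var s4 vnb = Z.of_nat (n %/ m).
  by case: f4 => -> // _ _ _; case: f3 => -> // _ _ _; case: f2 => -> //.
have a4 a : [|| a == abad, a == aU | a == atab] -> forall x, arr s4 a x = 0%Z.
  by case/or3P => /eqP -> x; case: f4 => _ -> // _ _; case: f3 => _ -> // _ _; case: f2 => _ -> // _ _; case: f1 => _ -> //.
have p4 : par q L s4 by refine (par_frame _ f4 _) => //; refine (par_frame _ f3 _).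
apply: wp_seq; eapply wp_use.
  apply: light_spec => //.
  - by case: f4 => _ _ -> // _; case: f3 => _ _ -> // _; case: f2 => _ _ -> // _; case: f1 => _ _ -> //.
  - by move=> p _; rewrite a4.
  - by move=> p _; rewrite a4.
  - by move=> p; rewrite a4.
move=> s5 k5 [m5 c5 hk5] f5.
apply: wp_seq; eapply wp_use.
  apply: select_heavy_spec.
  - by case: f5 => -> // _ _ _; case: f4 => -> //.
  - by case: f5 => -> // _ _ _.
  - by move=> i hi; case: f5 => _ -> // _ _; case: f4 => _ -> // _ _; apply: d3.
move=> s6 k6 [h1 h2 hk6] f6.
apply: wp_seq; eapply wp_use.
  apply: (heavy_spec (b0 := fun p => has (light_bad^~ p) (iota 0 rnd))) => //.
  - by refine (par_frame _ f6 _) => //; refine (par_frame _ f5 _).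
  - by case: f6 => -> // _ _ _; case: f5 => -> //.
  - by move=> p hpm; case: f6 => _ -> // _ _; apply: m5.
  - by move=> p hpm; case: f6 => _ -> // _ _; apply: c5.
move=> s7 k7 [m7 hk7] f7.
eapply wp_use.
  apply: report_spec; first exact: m7.
  case: f7 => _ _ _ -> //; case: f6 => _ _ _ -> //; case: f5 => _ _ _ -> //; case: f4 => _ _ _ -> //.
  by case: f3 => _ _ _ -> //; case: f2 => _ _ _ -> //; case: f1 => _ _ _ -> //.
move=> s8 k8 [h8 hk8] _; split; first exact: h8.
move: hk1 hk2 hk3 hk4 hk5 hk6 hk7 hk8; rewrite /total_cost.
move: (n * 300) (L * _) (n * _) (c * lg * _) (rnd * _) (size heavies * _) => x1 x2 x3 x4 x5 x6.
by move: body_cost => bc; clear; lia.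
Qed.

End Main.

End Matching.
Import Matching.

(** * Collisions and errors *)

Module Correctness.

Set Implicit Arguments.
Unset Strict Implicit.
Unset Printing Implicit Defensive.
Local Open Scope nat_scope.

Lemma char_tnth_text G (k : 'I_(text_len G)) : char G k = tnth (text G) k :> nat.
Proof.
rewrite /char nth_cat size_map size_tuple ltn_ord.
have := tnth_nth (tnth (text G) k) (text G) k => ->.
by rewrite (nth_map (tnth (text G) k)) ?size_tuple.
Qed.

Lemma char_tnth_pattern G (j : 'I_(pat_len G)) : char G (text_len G + j) = tnth (pattern G) j :> nat.
Proof.
rewrite /char nth_cat size_map size_tuple.
have -> : (text_len G + j < text_len G) = false by rewrite ltnNge leq_addr.
rewrite addKn; have := tnth_nth (tnth (pattern G) j) (pattern G) j => ->.
by rewrite (nth_map (tnth (pattern G) j)) ?size_tuple.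
Qed.

Lemma match_oracleE G (x : 'I_(text_alph G)) (y : 'I_(pat_alph G)) :
  match_oracle G x y = ((x, y) \in matching G).
Proof.
apply/existsP/idP => [[[x' y']] /andP[h /andP[/eqP /= h1 /eqP h2]]|h].
  by move/val_inj: h1 => <-; move/val_inj: h2 => <-.
by exists (x, y); rewrite h !eqxx.
Qed.

Lemma degree_nbrs G (x : 'I_(text_alph G)) : degree G x = size (nbrs x).
Proof.
rewrite (perm_size (nbrsP x)) -cardE /text_degree_oracle.
rewrite -[RHS](card_imset _ (f := pair x)); last by move=> y y' [].
apply: eq_card => -[x' y]; rewrite !inE /=; apply/andP/imsetP => [[h /eqP e]|[y' h [-> ->]]].
  by exists y; rewrite ?inE; move/val_inj: e => <-.
by move: h; rewrite inE eqxx.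
Qed.

Lemma mem_nbrs G (x : 'I_(text_alph G)) y : (y \in nbrs x) = ((x, y) \in matching G).
Proof. by rewrite (perm_mem (nbrsP x)) mem_enum inE. Qed.

Lemma coveredE w G B r (k : 'I_(text_len G)) b : covered w G B r k b =
  has (fun y => bucket w B r (val y) == b) (nbrs (tnth (text G) k)).
Proof.
rewrite /covered char_tnth_text; set x := tnth _ _.
have e : nbr_oracle G x =1 nth 0 (map val (nbrs x)) by move=> i; rewrite /nbr_oracle valK.
rewrite degree_nbrs (eq_has (a2 := preim (nth 0 (map val (nbrs x))) (fun y => bucket w B r y == b))); last first.
  by move=> i; rewrite /= e.
rewrite -has_map -(size_map val) map_nth_iota0 // take_size has_map; exact: eq_has.
Qed.

Lemma degree_le G x : degree G x <= pat_alph G.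
Proof.
case: (ltnP x (text_alph G)) => hx.
  rewrite (degree_nbrs (Ordinal hx)) (perm_size (nbrsP _)) -cardE.
  by apply: leq_trans (max_card _) _; rewrite card_ord.
rewrite /degree eq_card0 // => -[x' y]; rewrite !inE /=; case: eqP => [e|_]; rewrite ?andbF //.
by move: (ltn_ord x') hx; rewrite e => h; rewrite leqNgt h.
Qed.

(** After exchanging the sums, an edge is counted at most once, through its own text character, as
    [s] has no repetition. *)
Lemma sum_degree_le G (s : seq nat) : uniq s -> sumn (map (degree G) s) <= #|matching G|.
Proof.
move=> us; rewrite sumnE big_map.
have e x : degree G x = \sum_(e in matching G | e.1 == x :> nat) 1.
  by rewrite sum1_card; apply: eq_card => y; rewrite !inE.
under eq_bigr do rewrite e.
rewrite (exchange_big_dep (mem (matching G))) /=; last by move=> i j _ /andP[].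
rewrite -[leqRHS]sum1_card; apply: leq_sum => y _.
rewrite sum1_count; apply: (@leq_trans (count (pred1 (val y.1)) s)).
  by apply: sub_count => z /= /andP[_]; rewrite eq_sym.
by rewrite count_uniq_mem // leq_b1.
Qed.

Section Bad.

Variables (w : nat) (G : gpm) (K c : nat).
Notation n := (text_len G).
Notation m := (pat_len G).
Notation lg := (trunc_log 2 n).+1.
Notation D := (cutoff G lg (c * lg)).
Notation B := (buckets D).
Notation rnd := (rounds K lg D).
Hypothesis m0 : 0 < m.
Hypothesis mn : m <= n.
Hypothesis bucket_ltB : forall r x, bucket w B r x < B.

(** A pattern character lies in one bucket only, so the disjunction over all buckets collapses to
    that one. *)
Lemma light_badP tape rep p : p + m <= n -> light_bad w G tape c rep p =
  [exists j : 'I_m, (degree G (char G (p + j)) <= D) &&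
     ~~ covered w G B (draw w tape rep) (p + j) (bucket w B (draw w tape rep) (char G (n + j)))].
Proof.
move=> hp; apply/hasP/existsP => [[b _ /existsP[j /andP[/and3P[_ h2 h3] /eqP h1]]]|[j /andP[h2 h3]]].
  by exists j; rewrite h2 h1.
exists (bucket w B (draw w tape rep) (char G (n + j))); first by rewrite mem_iota /= add0n.
apply/existsP; exists j; rewrite /light_v eqxx /light_u h2 h3 !andbT.
by have := ltn_ord j; move: hp; clear; lia.
Qed.

(** A matching pattern character is itself one of the neighbours, so its bucket is always covered,
    whatever the random word. *)
Lemma occurs_not_bad tape p : p + m <= n -> occurs G p.+1 -> ~~ bad w G tape K c p.
Proof.
move=> hp /andP[_ /forallP h].
have hm (j : 'I_m) (hj : p + j < n) :
    (tnth (text G) (Ordinal hj), tnth (pattern G) j) \in matching G.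
  by have /forallP/(_ (Ordinal hj)) := h j; rewrite /= addSn eqxx.
have hj (j : 'I_m) : p + j < n by have := ltn_ord j; move: hp; clear; lia.
rewrite /bad negb_or; apply/andP; split; apply/hasPn.
  move=> rep _; rewrite light_badP //; apply/existsP => -[j /andP[_ /negP]]; apply.
  have := coveredE w B (draw w tape rep) (Ordinal (hj j)) (bucket w B (draw w tape rep) (char G (n + j))) => /= ->.
  apply/hasP; exists (tnth (pattern G) j); first by rewrite mem_nbrs hm.
  by rewrite char_tnth_pattern.
move=> x _; apply/existsP => -[j /andP[/andP[_ /eqP h2] /negP h1]]; apply: h1; rewrite -h2.
by have := char_tnth_text (Ordinal (hj j)) => /= ->; rewrite char_tnth_pattern match_oracleE hm.
Qed.

Lemma mismatch p : p + m <= n -> ~~ occurs G p.+1 ->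
  exists (k : 'I_n) (j : 'I_m), [/\ k = p + j :> nat & (tnth (text G) k, tnth (pattern G) j) \notin matching G].
Proof.
move=> hp; rewrite /occurs negb_and => /orP[|/forallPn[j /forallPn[k]]].
  by move: hp mn; clear; lia.
by rewrite negb_imply addSn eqSS => /andP[/eqP e h]; exists k, j.
Qed.

(** A mismatch at a heavy letter is always found by the convolution of that letter, so a mismatch
    can stay hidden only behind a collision in every round. *)
Lemma not_bad_hidden tape p (k : 'I_n) (j : 'I_m) : p + m <= n -> k = p + j :> nat ->
  (tnth (text G) k, tnth (pattern G) j) \notin matching G -> ~~ bad w G tape K c p ->
  degree G (tnth (text G) k) <= D /\
  forall rep, rep < rnd -> has (fun z => bucket w B (draw w tape rep) (val z) ==
     bucket w B (draw w tape rep) (val (tnth (pattern G) j))) (nbrs (tnth (text G) k)).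
Proof.
move=> hp ek hM; rewrite negb_or => /andP[/hasPn hl /hasPn hh].
have ck := char_tnth_text k; have cj := char_tnth_pattern j.
have hD : degree G (tnth (text G) k) <= D.
  rewrite leqNgt; apply/negP => hD.
  have hx : (tnth (text G) k : nat) \in heavies G c.
    rewrite mem_filter hD mem_letters -ck /char /=.
    have hk : k < size (take n (input G)) by rewrite size_takel ?size_input ?leq_addr.
    by rewrite -(nth_take 0 (ltn_ord k)) mem_nth.
  have /negP := hh _ hx; apply; apply/existsP; exists j.
  by rewrite /heavy_v cj match_oracleE hM /heavy_u -ek ck ltn_ord eqxx.
split=> // rep hr.
have hr' : rep \in iota 0 rnd by rewrite mem_iota.
have := hl _ hr'; rewrite light_badP // => /existsPn/(_ j).
by rewrite -ek ck cj hD coveredE /= negbK.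
Qed.

End Bad.

(** Multiplying r + g k by d T adds 2 P d k to the small residue [e]. If two translates agree modulo
    2 P H, then e - e' is a multiple of 2 P of absolute value below 2 P, hence 0, and [H] divides d
    (k - k'); coprimality and k < H conclude. *)
Lemma shift_le (P H T d g r r' k k' : nat) (e e' : Z) : 0 < P -> g * T = 2 * P -> coprime H d ->
  (Z.abs e < Z.of_nat P)%Z -> (Z.abs e' < Z.of_nat P)%Z -> k' <= k -> k < H ->
  (exists u, Z.of_nat r * Z.of_nat (d * T) = e + Z.of_nat (2 * P * H) * u)%Z ->
  (exists u, Z.of_nat r' * Z.of_nat (d * T) = e' + Z.of_nat (2 * P * H) * u)%Z ->
  (exists z, Z.of_nat (r + g * k) = Z.of_nat (r' + g * k') + Z.of_nat (2 * P * H) * z)%Z -> k = k'.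
Proof.
move=> P0 gT cop he he' kk kH [u hu] [v hv] [z hz].
have E : (e - e' = 2 * Z.of_nat P * (Z.of_nat H * (z * Z.of_nat d * Z.of_nat T - u + v) - Z.of_nat d * (Z.of_nat k - Z.of_nat k')))%Z.
  have gTZ : (Z.of_nat g * Z.of_nat T = 2 * Z.of_nat P)%Z by move: gT; clear; lia.
  rewrite !Nat2Z.inj_add !Nat2Z.inj_mul in hu hv hz.
  have -> : (e = Z.of_nat r * (Z.of_nat d * Z.of_nat T) - Z.of_nat 2 * Z.of_nat P * Z.of_nat H * u)%Z by rewrite hu; ring.
  have -> : (e' = Z.of_nat r' * (Z.of_nat d * Z.of_nat T) - Z.of_nat 2 * Z.of_nat P * Z.of_nat H * v)%Z by rewrite hv; ring.
  have -> : (Z.of_nat r = Z.of_nat r' + Z.of_nat g * Z.of_nat k' + Z.of_nat 2 * Z.of_nat P * Z.of_nat H * z - Z.of_nat g * Z.of_nat k)%Z.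
    by rewrite -hz; ring.
  change (Z.of_nat 2) with 2%Z.
  transitivity (2 * Z.of_nat P * Z.of_nat H * (z * (Z.of_nat d * Z.of_nat T) - u + v) - (Z.of_nat g * Z.of_nat T) * (Z.of_nat d * (Z.of_nat k - Z.of_nat k')))%Z; first by ring.
  by rewrite gTZ; ring.
move: E; set q := (z * _ * _ - u + v)%Z; move: q => q E.
have E0 : (Z.of_nat H * q = Z.of_nat d * (Z.of_nat k - Z.of_nat k'))%Z.
  by move: E he he' P0; move: (Z.of_nat H * q)%Z (Z.of_nat d * _)%Z => x y; clear; nia.
have dv : H %| d * (k - k').
  apply/dvdnP; exists (Z.to_nat q).
  have q0 : (0 <= q)%Z by move: E0 kk kH; clear; nia.
  by apply: Nat2Z.inj; move: E0 kk q0; rewrite !Nat2Z.inj_mul; clear; nia.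
rewrite Gauss_dvdr // in dv; case: (posnP (k - k')) => h0; first by move: kk h0; clear; lia.
by have := dvdn_leq h0 dv; move: kH; clear; lia.
Qed.

Lemma mod_witness a b : exists u, (Z.of_nat a = Z.of_nat (a %% b) + Z.of_nat b * u)%Z.
Proof. by exists (Z.of_nat (a %/ b)); have := divn_eq a b; clear; lia. Qed.

(** With B = 2^l, a collision brings r (x - y) within P = 2^w / B of 0 modulo 2^w. Write x - y = d
    2^t with d odd. The B / 2 translates of such [r] by multiples of g = 2 P / 2^t are pairwise
    distinct, also for different [r], so there are at most 2^w / (B / 2) of them. The multiplier
    ranges over all words, not only odd ones; the bound on [x] gives t <= w - l, which makes [g] an
    integer. *)
Lemma collision w l x y : 0 < l -> l < w -> y < x -> x * 2 ^ l <= 2 ^ w ->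
  #|[set r : 'I_(2 ^ w) | bucket w (2 ^ l) r x == bucket w (2 ^ l) r y]| * 2 ^ l <= 2 * 2 ^ w.
Proof.
move=> l0 lw yx xw.
have d0 : 0 < x - y by rewrite subn_gt0.
have [d cop ed] := pfactor_coprime (isT : prime 2) d0; set t := logn 2 (x - y) in ed.
pose P := 2 ^ (w - l); pose H := 2 ^ l.-1.
have P0 : 0 < P by rewrite expn_gt0.
have eW : 2 ^ w = 2 * P * H.
  by rewrite /P /H -expnS -expnD; congr (_ ^ _); move: l0 lw; clear; lia.
have eP : 2 ^ w %/ 2 ^ l = P by rewrite -expnB // ltnW.
have tw : t <= w - l.
  rewrite -(leq_exp2l (m := 2)) //; apply: (@leq_trans x).
    apply: (@leq_trans (x - y)); last exact: leq_subr.
    by rewrite ed leq_pmull //; case: (d) cop => //; rewrite /coprime gcdn0.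
  by rewrite -(leq_pmul2r (expn_gt0 2 l : 0 < 2 ^ l)) -expnD subnK // ltnW.
pose g := 2 ^ (w - l - t).+1.
have gT : g * 2 ^ t = 2 * P by rewrite /g /P -expnD -expnS; congr (_ ^ _); move: tw; clear; lia.
set A := [set r | _].
have eH : 2 ^ l = 2 * H by rewrite /H -expnS prednK.
rewrite eH mulnCA leq_mul2l /=.
have W0 : 0 < 2 ^ w by rewrite expn_gt0.
pose f (rk : 'I_(2 ^ w) * 'I_H) : 'I_(2 ^ w) := Ordinal (ltn_pmod (rk.1 + g * rk.2) W0).
rewrite -(card_ord H) -cardsT -cardsX -[X in _ <= X](card_ord (2 ^ w)).
have copH : coprime H d by rewrite /H coprimeXl.
have wit r : r \in A -> exists2 e, (Z.abs e < Z.of_nat P)%Z &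
    exists u, (Z.of_nat r * Z.of_nat (d * 2 ^ t) = e + Z.of_nat (2 * P * H) * u)%Z.
  rewrite inE /bucket eP -ed -eW => /eqP h.
  have [u hu] := mod_witness (r * x) (2 ^ w); have [v hv] := mod_witness (r * y) (2 ^ w).
  exists (Z.of_nat ((r * x) %% 2 ^ w) - Z.of_nat ((r * y) %% 2 ^ w))%Z; last first.
    exists (u - v)%Z; rewrite Nat2Z.inj_sub ?Z.mul_sub_distr_l; last by apply/leP/ltnW.
    by rewrite -!Nat2Z.inj_mul hu hv; ring.
  have := divn_eq ((r * x) %% 2 ^ w) P; have := divn_eq ((r * y) %% 2 ^ w) P; rewrite h.
  have := ltn_pmod ((r * x) %% 2 ^ w) P0; have := ltn_pmod ((r * y) %% 2 ^ w) P0.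
  move: (_ %/ P * P) (_ %% P) (_ %% P) => a b b'.
  by move: (_ %% _) (_ %% _) => s s'; clear; lia.
rewrite -(@card_in_imset _ _ f); first exact: max_card.
move=> [r k] [r' k']; rewrite !inE /= => /andP[hr _] /andP[hr' _] /(congr1 val) /= e.
have [s hs us] := wit r ltac:(by rewrite inE); have [s' hs' us'] := wit r' ltac:(by rewrite inE).
have hz a b : a %% 2 ^ w = b %% 2 ^ w -> exists z, (Z.of_nat a = Z.of_nat b + Z.of_nat (2 * P * H) * z)%Z.
  move=> h; have [u hu] := mod_witness a (2 ^ w); have [v hv] := mod_witness b (2 ^ w).
  by exists (u - v)%Z; rewrite -eW hu hv h; ring.
have ek : k = k' :> nat.
  case: (leqP k' k) => hkk.
    exact: (shift_le P0 gT copH hs hs' hkk (ltn_ord k) us us' (hz _ _ e)).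
  by symmetry; exact: (shift_le P0 gT copH hs' hs (ltnW hkk) (ltn_ord k') us' us (hz _ _ (esym e))).
congr pair; apply: val_inj => //=.
move: e; rewrite ek => /eqP; rewrite eqn_modDr => /eqP.
by rewrite !modn_small.
Qed.

(** Independence as counting: the tapes in question form a product of sets, [C] in the first [k]
    places and the whole of [T] in the others. *)
Lemma card_prefix (T : finType) (C : {set T}) t k : k <= t -> 2 * #|C| <= #|T| ->
  #|[set x : t.-tuple T | [forall i : 'I_t, (i < k) ==> (tnth x i \in C)]]| * 2 ^ k <= #|T| ^ t.
Proof.
move=> kt hC; set A := [set x | _].
pose F (i : 'I_t) : pred T := fun z => (i < k) ==> (z \in C).
pose f (x : t.-tuple T) := [ffun i => tnth x i].
have fi : injective f.
  by move=> x y /ffunP h; apply: eq_from_tnth => i; have := h i; rewrite !ffunE.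
have hA : #|A| <= \prod_(i < t) #|F i|.
  rewrite -(card_imset _ fi); apply: (@leq_trans #|family F|).
    apply: subset_leq_card; apply/subsetP => y /imsetP[x]; rewrite inE => /forallP h ->.
    by apply/familyP => i; rewrite ffunE; apply: h.
  by rewrite card_family foldrE big_map big_enum.
apply: (@leq_trans (\prod_(i < t) (#|F i| * (if i < k then 2 else 1)))).
  rewrite big_split /=; apply: leq_mul => //.
  by rewrite -big_mkcond -(big_ord_widen t (fun=> 2)) // prod_nat_const card_ord.
rewrite -[t in _ ^ t]card_ord -prod_nat_const; apply: leq_prod => i _.
rewrite /F; case: (i < k) => /=; last by rewrite muln1 max_card.
by rewrite mulnC; apply: leq_trans hC; rewrite leq_mul2l /=; apply: subset_leq_card; apply/subsetP.
Qed.

End Correctness.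
Import Correctness.

(** * Running time *)

Module Complexity.

Set Implicit Arguments.
Unset Strict Implicit.
Unset Printing Implicit Defensive.
Local Open Scope nat_scope.

(** Union bound, with the common factor [b] in place of a denominator. *)
Lemma card_has (T : finType) (A : eqType) (P : A -> pred T) (s : seq A) b M :
  (forall z, z \in s -> #|[set r | P z r]| * b <= M) ->
  #|[set r | has (P^~ r) s]| * b <= size s * M.
Proof.
elim: s => [|z s IH] h /=.
  by rewrite (_ : [set r | false] = set0) ?cards0 //; apply/setP => r; rewrite !inE.
have -> : [set r | P z r || has (P^~ r) s] = [set r | P z r] :|: [set r | has (P^~ r) s].
  by apply/setP => r; rewrite !inE.
rewrite mulSn; apply: (@leq_trans ((#|[set r | P z r]| + #|[set r | has (P^~ r) s]|) * b)).
  by rewrite leq_mul2r leq_card_setU orbT.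
rewrite mulnDl; apply: leq_add; first by apply: h; rewrite mem_head.
by apply: IH => z' hz; apply: h; rewrite inE hz orbT.
Qed.

Section Search.

Variables (S0 l : nat).
Hypothesis l0 : 0 < l.
Notation x i := (iter i (search S0 l) 1).

Lemma iter_search_pow i : exists2 j, j <= i & x i = 2 ^ j.
Proof.
elim: i => [|i [j hj e]] /=; first by exists 0.
rewrite e /search; case: ifP => _; last by exists j => //; apply: leqW.
by exists j.+1; rewrite ?expnS.
Qed.

(** Once the test fails it fails forever, and until then every step doubles. *)
Lemma iter_search_big i : S0 <= x i * x i * l \/ x i = 2 ^ i.
Proof.
elim: i => [|i IH] /=; first by right.
move: IH; move: (x i) => y IH; rewrite /search; case: (ltnP _ S0) => h; last by left.
by case: IH => [h'|->]; [move: h; rewrite ltnNge h' | right; rewrite expnS].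
Qed.

Lemma iter_search_le i : l <= S0 -> x i * x i * l <= 4 * S0.
Proof.
move=> h; elim: i => [|i IH] /=; first by rewrite !mul1n; apply: leq_trans h (leq_pmull _ _).
by move: IH; move: (x i) => y IH; rewrite /search; case: ifP => // h1; rewrite mulnACA -mulnA leq_mul2l /= ltnW.
Qed.

End Search.

(** In this lemma and the next two, the cost estimates are detached from the program, here with [x],
    [y], [l] for [n], [m], [L], so that nonlinear arithmetic meets only atoms. The numerical
    constants are generous. *)
Lemma col_arith (T Q l x y : nat) : (Z.of_nat T <= 1140 * Z.of_nat (l * y))%Z -> Q * y <= 2 * x ->
  0 < l -> 0 < y -> y <= x ->
  (Z.of_nat ((x + y) * (250 + 10) + Q * (10 * T) + 50) <= 40000 * Z.of_nat (x * l))%Z.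
Proof.
move=> T1 Q1 l0 x0 xy; have y0 : x * 1 <= x * l by rewrite leq_mul2l l0 orbT.
have h1 := Z.mul_le_mono_nonneg_l _ _ (Z.of_nat Q) (Zle_0_nat Q) T1.
have h2 : l * (Q * y) <= l * (2 * x) by rewrite leq_mul2l Q1 orbT.
by move: h1 h2 y0 x0 xy; clear; nia.
Qed.

Lemma light_arith (C y b x z l : nat) : (Z.of_nat C <= 40000 * Z.of_nat (z * l))%Z -> 0 < l -> 0 < z ->
  1 < b -> x <= b ->
  (Z.of_nat (z * (x * (250 + 10) + 250 + 10) + b * (C + 10) + 250) <= 41000 * Z.of_nat (z * l * b))%Z.
Proof.
move=> hC l0 z0 b1 xb; have y0 : z * 1 <= z * l by rewrite leq_mul2l l0 orbT.
rewrite muln1 in y0.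
have h1 := Z.mul_le_mono_nonneg_l _ _ (Z.of_nat b) (Zle_0_nat b) hC.
have h2 : z * x <= z * l * b by apply: leq_mul.
have h3 : z * 1 <= z * l * b by apply: leq_mul => //; apply: ltnW.
have h4 : 1 * b <= z * l * b by apply: leq_mul => //; rewrite muln_gt0 z0.
by move: h1 h2 h3 h4 z0 b1; rewrite -(mulZ (z * l) b); move: (z * l) => t; clear; nia.
Qed.

Lemma total_arith (x l p c g lc cc h r b : nat) : l * p <= 4 * (x * l) -> l * l <= 2 * (x * l) ->
  c * g <= c * (x * l) -> l * 1 <= l * x -> x * 1 <= x * l -> 0 < x ->
  (Z.of_nat lc <= 41000 * Z.of_nat (x * l * b))%Z -> (Z.of_nat cc <= 40000 * Z.of_nat (x * l))%Z ->
  0 < b ->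
  (Z.of_nat (x * 300 + 500 + (l * (p * (250 + 10) + (32 * l + 1) * (250 + 10) + 250) + 250) +
    (x * (250 + 10) + 100) + (c * g * (250 + 10) + 200) + (r * (lc + 10) + 8) +
    (x * (250 + 10) + 50) + (h * (cc + 20) + 8) + (x * (250 + 10) + 100)).+1 <=
  (100000 + 300 * Z.of_nat c) * Z.of_nat (x * l * (1 + b * r + h)))%Z.
Proof.
rewrite !muln1 [l * x]mulnC => h1 h2 h3 h4 h5 x0 f1 f2 b0.
move: (x * l) h1 h2 h3 h4 h5 f1 f2 => y h1 h2 h3 h4 h5 f1 f2.
have k1 := Z.mul_le_mono_nonneg_l _ _ (Z.of_nat r) (Zle_0_nat r) f1.
have k2 := Z.mul_le_mono_nonneg_l _ _ (Z.of_nat h) (Zle_0_nat h) f2.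
have y0 : 0 < y by apply: leq_trans h5.
have k5 : 1 * 1 * r <= y * b * r by do 2 apply: leq_mul => //.
have k6 : 1 * h <= y * h by apply: leq_mul.
have k7 : (0 <= Z.of_nat (c * (y * b * r)))%Z by clear; lia.
have k8 : (0 <= Z.of_nat (c * (y * h)))%Z by clear; lia.
by move: h1 h2 h3 h4 h5 k1 k2 k5 k6 k7 k8 y0; clear; nia.
Qed.

(** * Word size, error probability and running time *)

Section Instance.

Variables (w : nat) (G : gpm) (a d K : nat).
Notation n := (text_len G).
Notation m := (pat_len G).
Notation L := (up_log 2 (2 * m)).
Notation N := (2 ^ L).
Notation lg := (trunc_log 2 n).+1.
Notation c := (a + d + 1).
Notation S := (weight G n).
Notation D := (cutoff G lg (c * lg)).
Notation B := (buckets D).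
Notation rnd := (rounds K lg D).
Hypothesis m0 : 0 < m.
Hypothesis mn : m <= n.
Hypothesis text_small : text_alph G <= a * n ^ d.
Hypothesis pat_small : pat_alph G <= a * n ^ d.
Hypothesis K0 : 0 < K.

(** Since a <= 2^a and n < 2^lg, every character fits in [c * lg] bits. *)
Lemma alph_bound : a * n ^ d <= 2 ^ (c * lg).
Proof.
have /andP[h1 _] := lg_bounds m0 mn.
have h2 : n ^ d <= 2 ^ (d * lg).
  by case: (d) => [|e] //; rewrite [e.+1 * _]mulnC expnM leq_exp2r // ltnW.
apply: leq_trans (_ : 2 ^ (a * lg) * 2 ^ (d * lg) <= _).
  apply: leq_mul h2; apply: leq_trans (ltnW (ltn_expl a (isT : 1 < 2))) _.
  by rewrite leq_exp2l // leq_pmulr.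
by rewrite -expnD leq_exp2l // !mulnDl leq_addr.
Qed.

Lemma matching_bound : #|matching G| <= 2 ^ (2 * (c * lg)).
Proof.
apply: leq_trans (max_card _) _; rewrite card_prod !card_ord mul2n -addnn expnD.
by apply: leq_mul; apply: leq_trans alph_bound.
Qed.

Lemma S_le : S <= #|matching G|.
Proof. by apply: sum_degree_le; apply: uniq_letters. Qed.

(** If the search never reaches its target, then D = 2^(c lg), whose square is already at least the
    largest possible number of edges. *)
Lemma cutoff_cases : (D = 0 /\ S < lg) \/
  [/\ lg <= S, exists2 j, j <= c * lg & D = 2 ^ j, S <= D * D * lg & D * D * lg <= 4 * S].
Proof.
rewrite /cutoff; case: ltnP => h; [by left | right].
split=> //; first exact: iter_search_pow; last exact: iter_search_le.
case: (iter_search_big S lg (c * lg)) => // ->.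
apply: leq_trans S_le _; apply: leq_trans matching_bound _.
by rewrite -expnD addnn -mul2n leq_pmulr.
Qed.

Lemma buckets_pow : exists2 l, 0 < l <= (c + 2) * lg & B = 2 ^ l.
Proof.
case: cutoff_cases => [[-> _]|[_ [j hj e] _ _]].
  by exists 1 => //; rewrite /= addn2.
exists j.+2; last first.
  by rewrite /buckets e; case: eqP => [h|_]; [have := expn_gt0 2 j; rewrite h | rewrite !expnS mulnA].
rewrite mulnDl /=; apply: (@leq_trans (j + 2)); first by rewrite addn2.
by apply: leq_add => //; rewrite leq_pmulr.
Qed.

(** Bits needed: q^3 takes 96 L with L <= lg + 1, covered by 300 lg; the characters, the table and 4
    S are covered with the help of 4 c lg, and the number of rounds with K lg. *)
Hypothesis hw : (300 + 4 * c + K) * lg <= w.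

Lemma pow_le x : x <= (300 + 4 * c + K) * lg -> 2 ^ x <= 2 ^ w.
Proof. by move=> h; rewrite leq_exp2l // (leq_trans h). Qed.

Lemma L_lg : L <= lg + 1.
Proof.
have [_ _ h _] := L_bounds m0; have /andP[h1 _] := lg_bounds m0 mn.
rewrite -ltnS -(ltn_exp2l (m := 2)) //; apply: leq_trans h _.
by rewrite addn1 !expnS; move: mn h1; rewrite expnS; move: (2 ^ _) => z; clear; lia.
Qed.

Lemma run_spec t (tape : t.-tuple 'I_(2 ^ w)) : (total_cost G K c).+1 <= t ->
  halted (program_of (gpm_cmd K c)) (run G (program_of (gpm_cmd K c)) tape) /\
  out (run G (program_of (gpm_cmd K c)) tape) =
    map succn (filter (predC (bad w G (map val tape) K c)) (iota 0 (n - m + 1))).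
Proof.
move=> ht; have /andP[n1 n2] := lg_bounds m0 mn; have [l /andP[l0 ll] eB] := buckets_pow.
have [L0 hm hm4 Lm] := L_bounds m0; have Llg := L_lg.
have lg0 : 0 < lg by [].
pose q := Z.of_nat (2 ^ (32 * L)); pose lim := Z.of_nat (2 ^ ((c + 6) * lg)).
have limb x : x <= (c + 6) * lg -> 2 ^ x <= 2 ^ ((c + 6) * lg) by rewrite leq_exp2l.
have ab := alph_bound.
have Sb : S <= 2 ^ (2 * (c * lg)) := leq_trans S_le matching_bound.
have W4 : 2 ^ (lg + 4) <= 2 ^ w by apply: pow_le; move: lg0; clear; nia.
have n4 : 16 * n < 2 ^ (lg + 4) by rewrite expnD; move: n1; move: (2 ^ lg) => z; clear; lia.
have lim4 : 2 ^ (lg + 4) <= 2 ^ ((c + 6) * lg) by apply: limb; move: lg0; clear; nia.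
have g1 : (Z.of_nat (n + N) <= lim)%Z.
  by rewrite /lim; move: n4 lim4 hm4 mn; move: (2 ^ _) (2 ^ _) (2 ^ _) => x y z; clear; lia.
have limw : 2 ^ ((c + 6) * lg + 5) <= 2 ^ w by apply: pow_le; move: lg0; clear; nia.
have g2 : (lim <= W w)%Z.
  by move: limw; rewrite /lim /W expnD; move: (2 ^ _) => x; clear; lia.
have g3 : (2 * (q * q * q) <= W w)%Z.
  have : 2 ^ (1 + (32 * L + 32 * L + 32 * L)) <= 2 ^ w by apply: pow_le; move: lg0 Llg; clear; nia.
  rewrite (expnD 2 1) (expnD 2 (32 * L + 32 * L)) (expnD 2 (32 * L) (32 * L)) expn1 /q /W; move: (2 ^ (32 * L)) (2 ^ w) => x y h.
  have h2 : (Z.of_nat (2 * (x * x * x)) <= Z.of_nat y)%Z by move: h; rewrite !mulnA; clear; lia.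
  by rewrite -!mulZ in h2.
have g4 : (Z.of_nat (4 * n) < W w)%Z.
  by move: n4 W4; rewrite /W; move: (2 ^ _) (2 ^ _) => x y; clear; lia.
have cw : 2 ^ (c * lg).+1 <= 2 ^ w by apply: pow_le; move: lg0; clear; nia.
have g5 : (Z.of_nat (text_alph G) <= lim)%Z.
  have : 2 ^ (c * lg) <= 2 ^ ((c + 6) * lg) by apply: limb; rewrite leq_mul2r leq_addr orbT.
  by move: text_small ab; rewrite /lim; move: (2 ^ _) (2 ^ _) (a * _) => x y z; clear; lia.
have pw x : x <= a * n ^ d -> x < 2 ^ w.
  move=> hx; apply: leq_trans cw; rewrite expnS; move: hx ab (expn_gt0 2 (c * lg)).
  by move: (2 ^ _) (a * _) => y z; clear; lia.
have g6 x : degree G x < 2 ^ w by apply: pw; apply: leq_trans (degree_le G x) pat_small.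
have g7 : 4 * S < 2 ^ w.
  have h : 2 ^ (2 * (c * lg)).+3 <= 2 ^ w by apply: pow_le; move: lg0; clear; nia.
  by apply: leq_trans h; rewrite !expnS; move: Sb (expn_gt0 2 (2 * (c * lg))); move: (2 ^ _) => y; clear; lia.
have g8 : l < w by apply: leq_trans hw; apply: leq_ltn_trans ll _; move: lg0; clear; nia.
have g9 : (Z.of_nat (n * B) <= lim)%Z.
  have h : n * B <= 2 ^ ((c + 6) * lg).
    rewrite eB; apply: leq_trans (_ : 2 ^ lg * 2 ^ l <= _); first by rewrite leq_mul2r ltnW ?orbT.
    by rewrite -expnD; apply: limb; move: ll lg0; clear; nia.
  by rewrite /lim; move: h; move: (2 ^ _) (n * B) => x y; clear; lia.
have g10 : c * lg < 2 ^ w.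
  by apply: leq_trans (ltn_expl (c * lg) (isT : 1 < 2)) _; apply: pow_le; move: lg0; clear; nia.
have g11 : (K * lg).+1 < 2 ^ w.
  apply: leq_trans (ltn_expl (K * lg).+1 (isT : 1 < 2)) _; apply: pow_le; move: lg0; clear; nia.
have s1 : (Z.of_nat (size (input G)) + Z.of_nat num_arrays * lim <= W w)%Z.
  rewrite size_input /lim /W /num_arrays; move: limw; rewrite expnD (_ : 2 ^ 5 = 32) //.
  by move: n4 lim4 mn; move: (2 ^ w) (2 ^ ((c + 6) * lg)) (2 ^ (lg + 4)) => z y x; clear; lia.
have s2 : (0 <= lim)%Z by rewrite /lim; clear; lia.
have s3 : wp w G (map val tape) lim (gpm_cmd K c) (fun st' k' =>
   reps st' = map succn (filter (predC (bad w G (map val tape) K c)) (iota 0 (n - m + 1))) /\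
   k' <= 1 + total_cost G K c) start 1.
  eapply (@gpm_spec w G _ lim q K c l); try eassumption; try (by []).
  - by apply: pw.
  - by apply: pw.
have s4 : forall st k, (reps st = map succn (filter (predC (bad w G (map val tape) K c)) (iota 0 (n - m + 1))) /\
   k <= 1 + total_cost G K c) -> k <= t by move=> st k [_ hk]; apply: leq_trans hk _.
have [h1 [st [k [[e _] eo]]]] := @program_of_correct w G t tape lim (gpm_cmd K c)
   (fun st' k' => reps st' = map succn (filter (predC (bad w G (map val tape) K c)) (iota 0 (n - m + 1))) /\
    k' <= 1 + total_cost G K c)
   s1 s2 erefl
   s3 s4.
by split=> //; rewrite eo e.
Qed.

Lemma bucket_small r x : bucket w B r x < B.
Proof.
have [l /andP[l0 ll] eB] := buckets_pow; have lg0 : 0 < lg by [].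
have lw : l < w by apply: leq_trans hw; apply: leq_ltn_trans ll _; move: lg0; clear; nia.
have eg : 2 ^ w %/ 2 ^ l = 2 ^ (w - l) by rewrite -expnB // ltnW.
by rewrite /bucket eB eg ltn_divLR ?expn_gt0 // -expnD subnKC ?ltn_mod ?expn_gt0 // ltnW.
Qed.

Lemma complete t (tape : t.-tuple 'I_(2 ^ w)) i : (total_cost G K c).+1 <= t -> occurs G i ->
  i \in out (run G (program_of (gpm_cmd K c)) tape).
Proof.
move=> ht; have [_ ->] := run_spec tape ht; case: i => [|p] hi; first by case/andP: hi.
have hp : p + m <= n by case/andP: hi => /andP[_ h] _; move: h mn; clear; lia.
have bl := bucket_small; apply: map_f; rewrite mem_filter mem_iota /= add0n; apply/andP; split.
  by eapply occurs_not_bad; eassumption.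
by move: hp m0 mn; clear; lia.
Qed.

(** Every neighbour of [x] differs from [y], so it collides with probability at most 2 / B = 1 / (2
    D); the union bound over at most [D] neighbours leaves 1/2. *)
Lemma hidden_bound (x : 'I_(text_alph G)) (y : 'I_(pat_alph G)) : (x, y) \notin matching G ->
  degree G x <= D -> D != 0 ->
  2 * #|[set r : 'I_(2 ^ w) | has (fun z : 'I_(pat_alph G) => bucket w B r z == bucket w B r y) (nbrs x)]| <= 2 ^ w.
Proof.
move=> hM hD D0; have [l /andP[l0 ll] eB] := buckets_pow.
have lg0 : 0 < lg by [].
have lw : l < w by apply: leq_trans hw; apply: leq_ltn_trans ll _; move: lg0; clear; nia.
have small (z : 'I_(pat_alph G)) : z * 2 ^ l <= 2 ^ w.
  apply: leq_trans (_ : 2 ^ (c * lg) * 2 ^ l <= _).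
    by rewrite leq_mul2r (leq_trans (ltnW (ltn_ord z)) (leq_trans pat_small alph_bound)) orbT.
  by rewrite -expnD; apply: pow_le; move: ll lg0; clear; nia.
have coll z : z \in nbrs x ->
    #|[set r : 'I_(2 ^ w) | bucket w B r (z : nat) == bucket w B r (y : nat)]| * B <= 2 * 2 ^ w.
  rewrite mem_nbrs => hz; rewrite eB; case: (ltngtP y z) => h.
  - exact: collision.
  - rewrite (_ : [set r | _] = [set r : 'I_(2 ^ w) | bucket w (2 ^ l) r y == bucket w (2 ^ l) r z]); first exact: collision.
    by apply/setP => r; rewrite !inE eq_sym.
  - by move/val_inj: h => h; rewrite h hz in hM.
have := card_has coll; rewrite -degree_nbrs.
set C := #|_|; have -> : B = 4 * D by rewrite /buckets (negbTE D0).
have D1 : 0 < D by rewrite lt0n.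
have : degree G x * (2 * 2 ^ w) <= D * (2 * 2 ^ w) by rewrite leq_mul2r hD orbT.
move=> h1 h2; have h := leq_trans h2 h1.
rewrite -(leq_pmul2l (_ : 0 < 2 * D)); last by rewrite muln_gt0.
by move: h; rewrite [C * _]mulnC; move: (2 ^ w) (D) => u v; clear; nia.
Qed.

Lemma hidden_bound' (x : 'I_(text_alph G)) (y : 'I_(pat_alph G)) : (x, y) \notin matching G ->
  degree G x <= D -> D != 0 ->
  2 * #|[set r : 'I_(2 ^ w) | has (fun z : 'I_(pat_alph G) => bucket w B r z == bucket w B r y) (nbrs x)]| <=
  #|'I_(2 ^ w)|.
Proof. by rewrite card_ord; exact: hidden_bound. Qed.

(** One mismatch is fixed for each false alignment; it stays hidden only if the first K lg words all
    fall into a set of density at most 1/2. The factor [n] is the union bound over the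
    alignments. *)
Lemma error_bound t : (total_cost G K c).+1 <= t ->
  #|[set tape : t.-tuple 'I_(2 ^ w) | has (fun i => ~~ occurs G i)
     (out (run G (program_of (gpm_cmd K c)) tape))]| * 2 ^ (K * lg) <= n * (2 ^ w) ^ t.
Proof.
move=> ht.
(* The tape must hold one word per round; it does, because each round costs time. *)
have rt : rnd <= t.
  apply: leq_trans (leqW _) ht; apply: (@leq_trans (rnd * (light_cost G c + 10))).
    by rewrite leq_pmulr // addnS.
  rewrite /total_cost; do 3 apply: leq_trans _ (leq_addr _ _).
  by rewrite addnCA leq_addr.
pose P p (tape : t.-tuple 'I_(2 ^ w)) := [&& p + m <= n, ~~ occurs G p.+1 & ~~ bad w G (map val tape) K c p].
apply: (@leq_trans (#|[set tape | has (P^~ tape) (iota 0 n)]| * 2 ^ (K * lg))).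
  rewrite leq_mul2r; apply/orP; right; apply: subset_leq_card; apply/subsetP => tape; rewrite !inE.
  have [_ ->] := run_spec tape ht; case/hasP => i /mapP[p]; rewrite mem_filter mem_iota add0n /= => /andP[h1 h2] -> h3.
  by apply/hasP; exists p; rewrite ?mem_iota /P ?h1 ?h3 ?andbT; move: h2 m0 mn; clear; lia.
rewrite -[X in _ <= X * _](size_iota 0 n); apply: card_has => p _.
case: (boolP ((p + m <= n) && ~~ occurs G p.+1)) => [/andP[hp ho]|hn]; last first.
  rewrite (_ : [set r | _] = set0) ?cards0 //; apply/setP => r; rewrite !inE /P andbA.
  by rewrite (negbTE hn).
have [k [j [ek hM]]] := mismatch mn hp ho.
have bl := bucket_small.
have nbh tape : ~~ bad w G tape K c p -> degree G (tnth (text G) k) <= D /\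
  forall rep, rep < rnd -> has (fun z => bucket w B (draw w tape rep) (val z) ==
     bucket w B (draw w tape rep) (val (tnth (pattern G) j))) (nbrs (tnth (text G) k)).
  by move=> hb; eapply not_bad_hidden; eassumption.
(* With D = 0 a light letter has no neighbours, so the single round finds the mismatch whatever its
   random word. *)
have [k0 | D0] := eqVneq D 0.
  rewrite (_ : [set r | _] = set0) ?cards0 //; apply/setP => r; rewrite !inE; apply/negP => /and3P[_ _ hb].
  have [hd /(_ 0)] := nbh _ hb.
  rewrite /rounds k0 eqxx => /(_ isT); move: hd; rewrite k0 leqn0 degree_nbrs => /eqP/size0nil -> //.
have [le_D | gt_D] := leqP (degree G (tnth (text G) k)) D; last first.
  rewrite (_ : [set r | _] = set0) ?cards0 //; apply/setP => r; rewrite !inE; apply/negP => /and3P[_ _ hb].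
  by have [hd _] := nbh _ hb; move: gt_D; rewrite ltnNge hd.
have er : rnd = K * lg by rewrite /rounds (negbTE D0).
rewrite er in rt; have cp := card_prefix rt (hidden_bound' hM le_D D0); rewrite card_ord in cp.
apply: leq_trans cp; rewrite leq_mul2r; apply/orP; right; apply: subset_leq_card.
apply/subsetP => tape; rewrite !inE => /and3P[_ _ hb]; apply/forallP => i; apply/implyP => hi.
have [_ h] := nbh _ hb.
have dr : draw w (map val tape) i = tnth tape i.
  rewrite /draw (nth_map (tnth tape i)) ?size_tuple // -tnth_nth /word modn_small //; exact: ltn_ord.
by rewrite inE; have := h i; rewrite er dr; apply.
Qed.

Lemma size_heavies : size (heavies G c) * D.+1 <= S.
Proof.
rewrite /heavies /weight; elim: (letters G n) => [|x s IH] //=.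
by case: ifP => h /=; [rewrite mulSn; apply: leq_add | apply: leq_trans IH (leq_addl _ _)].
Qed.

Notation cols := (1 + B * rnd + size (heavies G c)).

(** Squares keep the bound within the naturals. If S < lg, at most [S] letters are heavy and S^2 <=
    S lg. Otherwise the number h of heavy letters satisfies h D <= S, and S <= D^2 lg gives h^2 S <=
    h^2 D^2 lg <= S^2 lg; the light part has (4 D K lg)^2 <= 64 K^2 S lg because D^2 lg <= 4 S. *)
Lemma cols_bound : cols * cols <= (30 + 200 * K * K) * (maxn 1 #|matching G| * lg).
Proof.
apply: (@leq_trans ((30 + 200 * K * K) * (maxn 1 S * lg))); last first.
  rewrite leq_mul2l leq_mul2r; apply/orP; right; apply/orP; right.
  by rewrite geq_max leq_maxl /=; apply: leq_trans S_le (leq_maxr _ _).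
have hh := size_heavies; have lg0 : 0 < lg by [].
move: (size (heavies G c)) hh => h hh.
case: cutoff_cases => [[D0 Sl]|[Sl [j _ e] Sd dS]].
  rewrite /rounds /buckets D0 /= muln1; rewrite D0 in hh.
  have : h <= S by move: hh; clear; lia.
  move: Sl; move: (S) (lg) (maxn 1 S) (leq_maxl 1 S) (leq_maxr 1 S) => s l M M0 sM sl hs.
  have h1 : h * h <= M * l by apply: leq_mul; [apply: leq_trans hs sM | apply: leq_trans hs (ltnW sl)].
  have h2 : 1 * h <= M * l by apply: leq_mul => //; apply: leq_trans hs (ltnW sl).
  have h3 : 1 * 1 <= M * l by apply: leq_mul => //; move: sl; clear; lia.
  apply: (@leq_trans (30 * (M * l))); last by rewrite leq_mul2r leq_addr orbT.
  by move: h1 h2 h3; move: (M * l) => Y; clear; nia.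
have D0 : (D == 0) = false by rewrite e; have := expn_gt0 2 j; case: (2 ^ j).
have D1 : 0 < D by rewrite lt0n D0.
rewrite /rounds /buckets D0; move: (leq_maxr 1 S); move: (maxn 1 S) => M SM.
apply: (@leq_trans ((30 + 200 * K * K) * (S * lg))); last by rewrite leq_mul2l leq_mul2r SM !orbT.
move: (D) D1 hh Sl Sd dS => x x0 hh Sl Sd dS.
move: (S) (lg) lg0 hh Sl Sd dS => s l lg0 hh Sl Sd dS.
have s0 : 0 < s by apply: leq_trans Sl.
have hx : h * x <= s by apply: leq_trans hh; rewrite leq_mul2l leqnSn orbT.
have h2 : h * h <= s * l.
  rewrite -(leq_pmul2r s0); apply: (@leq_trans (h * h * (x * x * l))); first by rewrite leq_mul2l Sd orbT.
  have -> : h * h * (x * x * l) = (h * x) * (h * x) * l by clear; nia.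
  have -> : s * l * s = s * s * l by clear; nia.
  by rewrite leq_mul2r leq_mul ?orbT.
have b2 : (4 * x * (K * l)) * (4 * x * (K * l)) <= 64 * K * K * (s * l).
  have -> : (4 * x * (K * l)) * (4 * x * (K * l)) = 16 * K * K * l * (x * x * l) by clear; nia.
  have -> : 64 * K * K * (s * l) = 16 * K * K * l * (4 * s) by clear; nia.
  by rewrite leq_mul2l dS orbT.
have sl1 : 0 < s * l by rewrite muln_gt0 s0.
have c1 (u v : nat) : (1 + u + v) * (1 + u + v) <= 3 * (1 + u * u + v * v).
  have := Z.square_nonneg (1 - Z.of_nat u); have := Z.square_nonneg (1 - Z.of_nat v).
  by have := Z.square_nonneg (Z.of_nat u - Z.of_nat v); clear; nia.
apply: leq_trans (c1 _ _) _; move: h2 b2 sl1; move: (4 * x * (K * l)) (s * l) => u Y h2 b2 sl1.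
have e1 : (30 + 200 * K * K) * Y = 30 * Y + 200 * (K * K * Y) by clear; nia.
have e2 : 64 * K * K * Y = 64 * (K * K * Y) by clear; nia.
by rewrite e1; rewrite e2 in b2; move: h2 b2 sl1; move: (u * u) (h * h) (K * K * Y) => p r z; clear; lia.
Qed.

Lemma tcost_le : (Z.of_nat (tcost L) <= 1140 * Z.of_nat (L * m))%Z.
Proof.
have [L0 _ hm4 _] := L_bounds m0; rewrite /tcost /body_cost.
have h1 : L * N <= L * (4 * m) by rewrite leq_mul2l ltnW ?orbT.
have h2 : L * 1 <= L * m by rewrite leq_mul2l m0 orbT.
have -> : L * (N * (250 + 10) + 50) + 50 = 260 * (L * N) + 50 * L + 50 by clear; nia.
have e : L * (4 * m) = 4 * (L * m) by clear; nia.
by move: h1 h2 L0; rewrite e; move: (L * N) (L * m) => x y; clear; lia.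
Qed.

Lemma col_cost_le : (Z.of_nat (col_cost G) <= 40000 * Z.of_nat (n * L))%Z.
Proof.
have [L0 _ _ _] := L_bounds m0; have T1 := tcost_le; rewrite /col_cost /body_cost.
(* This makes blocks of cost O(m L) sum to O(n L) even when [m] is close to [n]. *)
have Q1 : (n %/ m).+1 * m <= 2 * n.
  by rewrite mulSn; apply: leq_trans (leq_add mn (leq_divM _ _)) _; rewrite mul2n addnn.
by apply: col_arith.
Qed.

Lemma B_ge : [/\ 1 < B, D <= B & 0 < rnd].
Proof.
rewrite /buckets /rounds; case: (D) => [|x] //=; rewrite muln_gt0 K0 /=; split=> //; clear; lia.
Qed.

Lemma light_cost_le : (Z.of_nat (light_cost G c) <= 41000 * Z.of_nat (n * L * B))%Z.
Proof.
have [L0 _ _ _] := L_bounds m0; have C := col_cost_le; have [B1 DB _] := B_ge.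
by rewrite /light_cost /body_cost; apply: light_arith => //; apply: leq_trans mn.
Qed.

Lemma total_cost_le :
  ((total_cost G K c).+1 <= Z.to_nat (100000 + 300 * Z.of_nat c) * (n * L * cols))%N.
Proof.
have [L0 _ hm4 Lm] := L_bounds m0; have C := col_cost_le; have LC := light_cost_le; have [B1 DB R1] := B_ge.
have n0 : 0 < n by apply: leq_trans mn.
have y0 : n * 1 <= n * L by rewrite leq_mul2l L0 orbT.
have lgn : lg <= n.
  have /andP[h1 _] := trunc_log_bounds (isT : 1 < 2) n0; apply: leq_trans h1; exact: ltn_expl.
have h1 : L * N <= L * (4 * n) by rewrite leq_mul2l (leq_trans (ltnW hm4)) ?orbT // leq_mul2l mn.
have h2 : L * L <= L * (2 * n) by rewrite leq_mul2l (leq_trans Lm) ?orbT //; move: m0 mn; clear; lia.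
have h3 : c * lg <= c * (n * L) by rewrite leq_mul2l (leq_trans lgn) ?orbT // -[n in n <= _]muln1.
apply/leP/Nat2Z.inj_le; rewrite Nat2Z.inj_mul Z2Nat.id; last by clear; lia.
rewrite /total_cost /body_cost; apply: total_arith => //.
- by apply: leq_trans h1 _; rewrite mulnCA leq_mul2l /= mulnC.
- by apply: leq_trans h2 _; rewrite mulnCA leq_mul2l /= mulnC.
- by rewrite leq_mul2l n0 orbT.
- exact: ltnW.
Qed.

End Instance.

End Complexity.
Import Complexity.

(** * The theorem *)

From mathcomp Require Import reals exp.

Import Order.TTheory GRing.Theory Num.Theory.
Local Open Scope ring_scope.

Section RealBounds.

Variable R : realType.
Notation u := ((ln 2%:R : R)^-1).

Lemma ln2_gt0 : 0 < ln 2%:R :> R.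
Proof. by rewrite ln_gt0 // ltr1n. Qed.

(** Binary logarithms are converted with the factor 1 / ln 2; the maximum with 1 has the form it
    takes in [time_bound]. *)
Lemma pow2_le_ln (k x : nat) : (2 ^ k <= x)%N -> k%:R <= u * Num.max 1 (ln x%:R).
Proof.
move=> h; rewrite -[leLHS](mulKf (lt0r_neq0 ln2_gt0)) ler_wpM2l ?invr_ge0 ?(ltW ln2_gt0) //.
have x0 : (0 < x)%N by apply: leq_trans h; rewrite expn_gt0.
rewrite mulr_natr -lnXn ?ltr0n // le_max -natrX ler_ln ?posrE ?ltr0n ?expn_gt0 //.
by rewrite ler_nat h orbT.
Qed.

Lemma add_le_ln (k j x : nat) : (2 ^ k <= x)%N ->
  (k + j)%:R <= (j%:R + u) * Num.max 1 (ln x%:R).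
Proof.
move=> h; rewrite natrD addrC mulrDl lerD ?pow2_le_ln //.
by rewrite -[leLHS]mulr1 ler_wpM2l // le_max lexx.
Qed.

Lemma nat_le_sqrt (x y : nat) : (x * x <= y)%N -> x%:R <= Num.sqrt (y%:R : R).
Proof.
move=> h; rewrite -[leLHS]ger0_norm // -sqrtr_sqr ler_wsqrtr // expr2 -natrM ler_nat //.
Qed.

End RealBounds.

Theorem theorem3p2 (R : realType) (c : R) (a d : nat) :
  exists (p : program) (kappa : nat) (C : R),
  forall (G : gpm) (w : nat),
    let n := text_len G in
    let m := pat_len G in
    (0 < m <= n)%N ->
    (text_alph G <= a * n ^ d)%N ->
    (pat_alph G <= a * n ^ d)%N ->
    (kappa * (trunc_log 2 n).+1 <= w)%N ->
  exists t : nat,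
    [/\ t%:R <= C * time_bound R n m #|matching G|,
        forall tape : t.-tuple 'I_(2 ^ w),
          halted p (run G p tape) /\
          (forall i, occurs G i -> i \in out (run G p tape))
      & unif_prob R [set tape : t.-tuple 'I_(2 ^ w) |
          has (fun i => ~~ occurs G i) (out (run G p tape))]
        <= n%:R `^ (- c)].
Proof.
(* [k0] exceeds |c|; the additional power of [n] provided by [K] pays for the union bound over the
   alignments. *)
pose k0 := Num.bound `|c|; pose K := k0.+1; pose e := (a + d + 1)%N.
pose A := Z.to_nat (100000 + 300 * Z.of_nat e); pose kc := (30 + 200 * K * K)%N.
pose u : R := (ln 2%:R)^-1.
exists (program_of (gpm_cmd K e)), (300 + 4 * e + K)%N,
  (A%:R * (2%:R + u) * Num.sqrt kc%:R * Num.sqrt (1%:R + u)).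
move=> G w n m /andP[m0 mn] ta pa hw; have n0 : (0 < n)%N by apply: leq_trans mn.
have u0 : 0 <= u by rewrite invr_ge0 (ltW (ln2_gt0 R)).
(* A worst case that does not depend on the tape; the extra step is the instruction that computes
   the base address. *)
exists (total_cost G K e).+1; split.
- pose L := up_log 2 (2 * m); pose lg := (trunc_log 2 n).+1; pose D := cutoff G lg (e * lg).
  pose x := (1 + buckets D * rounds K lg D + size (heavies G e))%N.
  have tc : ((total_cost G K e).+1 <= A * (n * L * x))%N.
    by eapply total_cost_le; eassumption || exact: isT.
  have hc : (x * x <= kc * (maxn 1 #|matching G| * lg))%N.
    by eapply cols_bound; eassumption || exact: isT.
  move: tc; rewrite -(ler_nat R) => /le_trans; apply.
  have hL : L%:R <= (2%:R + u) * Num.max 1 (ln m%:R).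
    have [_ _ h4 _] := L_bounds m0; rewrite -/L in h4.
    (* N < 4 m gives 2^(L - 2) <= m; the remaining 2 goes into the constant because the logarithm is
       read as at least 1. *)
    apply: (@le_trans _ _ ((L - 2) + 2)%:R); first by rewrite ler_nat addnC -leq_subLR.
    apply: add_le_ln; move: h4; case: (L) => [|[|i]] //; rewrite !subSS subn0 !expnS mulnA.
    by rewrite ltn_mul2l /= => /ltnW.
  have hlg : lg%:R <= (1%:R + u) * Num.max 1 (ln n%:R).
    by rewrite /lg -addn1; apply: add_le_ln; case/andP: (trunc_log_bounds (isT : (1 < 2)%N) n0).
  have hx := @nat_le_sqrt R _ _ hc.
  have hx2 : x%:R <= Num.sqrt kc%:R * (Num.sqrt (maxn 1 #|matching G|)%:R *
      (Num.sqrt (1%:R + u) * Num.sqrt (Num.max 1 (ln n%:R)))) :> R.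
    apply: le_trans hx _; rewrite !natrM !sqrtrM ?ler0n // ler_wpM2l ?sqrtr_ge0 // ler_wpM2l ?sqrtr_ge0 //.
    by rewrite -sqrtrM ?addr_ge0 // ler_wsqrtr.
  rewrite /time_bound !natrM.
  apply: (@le_trans _ _ (A%:R * (n%:R * ((2%:R + u) * Num.max 1 (ln m%:R)) * (Num.sqrt kc%:R * (Num.sqrt (maxn 1 #|matching G|)%:R *
      (Num.sqrt (1%:R + u) * Num.sqrt (Num.max 1 (ln n%:R)))))))).
    by rewrite ler_wpM2l // ler_pM ?mulr_ge0 // ler_wpM2l.
  by rewrite le_eqVlt; apply/orP; left; apply/eqP; exact: mulr_regroup.
- move=> tape; split; first by have [] := run_spec m0 mn ta pa hw tape (leqnn _).
  by move=> i hi; eapply complete; eassumption || exact: isT || exact: leqnn.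
- set t := (total_cost G K e).+1; rewrite /unif_prob card_tuple card_ord; set E := #|_|.
  have hE : (E * 2 ^ (K * (trunc_log 2 n).+1) <= n * (2 ^ w) ^ t)%N.
    by eapply error_bound; eassumption || exact: isT || exact: leqnn.
  have /andP[n1 _] := lg_bounds m0 mn.
  have hK : (n ^ K <= 2 ^ (K * (trunc_log 2 n).+1))%N.
    by rewrite [(K * _)%N]mulnC expnM leq_exp2r // ltnW.
  (* One factor of n^K = n n^k0 cancels the [n] of the union bound. *)
  have hE2 : (E * n ^ k0 <= (2 ^ w) ^ t)%N.
    rewrite -(leq_pmul2l n0) mulnCA -expnS; apply: leq_trans hE; by rewrite leq_mul2l hK orbT.
  apply: (@le_trans _ _ (n%:R ^+ k0)^-1).
    rewrite ler_pdivrMr ?ltr0n ?expn_gt0 // mulrC ler_pdivlMr ?exprn_gt0 ?ltr0n //.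
    by rewrite -natrX -natrM ler_nat.
  rewrite -powR_mulrn ?ler0n // -powRN ler_powR ?ler1n // lerN2.
  by apply: le_trans (ler_norm c) _; apply: ltW; apply: archi_boundP.
Qed.
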